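(* Let $q$ be a prime power, $F$ a field of characteristic $p>0$ not dividing $q$, and $m=m(p,q)$. Let $0\le k\le n$ and $0<i<m$. Then (i) $H^n_{k,i}\ne 0$ if and only if $(k,i)$ is a middle index for $n$; (ii) if $(k,i)$ is a middle index for $n$, then $$H^n_{k,i}\cong\bigoplus_{t\in T_{k,i}} D^{(n-t,t)}$$ as $F\mathrm{GL}(n,q)$-modules, where $$T_{k,i}:=\begin{cases}\{t: k\le t\le n-k+i-1\} & \text{if } k\ge \tfrac12 n \text{ and } i\le \tfrac12(m-n)+k,\\ \{t: k\le t\le k+m-i-1\} & \text{if } k\ge \tfrac12 n \text{ and } i> \tfrac12(m-n)+k,\\ \{t: n-k\le t\le n-k+i-1\} & \text{if } k< \tfrac12 n \text{ and } i\le \tfrac12(m-n)+k,\\ \{t: n-k\le t\le k+m-i-1\} & \text{if } k< \tfrac12 n \text{ and } i> \tfrac12(m-n)+k,\end{cases}$$ $t$ ranging over integers, with the convention $D^{(n-t,t)}=0$ if $n-t<0$.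
   Context: For $i\ge 1$ put $[i]_q=1+q+\dots+q^{i-1}$, and let $m=m(p,q):=\min\{i>1 : [i]_q=0 \text{ in } F\}$. For integers $n\ge 0$ and $k$ let $L^n_k$ be the set of $k$-dimensional subspaces of $\mathbb{F}_q^n$ and let $M^n_k=FL^n_k$ be the $F$-vector space with basis $L^n_k$ ($M^n_k=0$ if $k<0$ or $k>n$). The incidence map $\partial:M^n_k\to M^n_{k-1}$ is the linear map sending $x\in L^n_k$ to the sum of all $(k-1)$-dimensional subspaces of $x$. One has $\partial^m=0$. The group $G_n=\mathrm{GL}(n,q)$ acts on $M^n_k$ by permuting subspaces, commuting with $\partial$. For $0<i<m$ the incidence homology is the $FG_n$-module $$H^n_{k,i}:=(\ker\partial^i\cap M^n_k)\,/\,\partial^{m-i}(M^n_{k+m-i}).$$ A pair of integers $(k,i)$ is a middle index for $n$ if $0\le k\le n$, $0<i<m$ and $n<2k+m-i<n+m$. For a two-part composition $\lambda$ of $n$ (parts $\ge0$), $S^\lambda$ is the Specht module over $F$ in James' theory of representations of $\mathrm{GL}(n,q)$ in non-defining characteristic, and $D^\lambda=S^\lambda/(S^\lambda\cap (S^\lambda)^\perp)$ is its head, the standard irreducible $FG_n$-module indexed by $\lambda$; one has $D^{(\lambda_1,\lambda_2)}=D^{(\lambda_2,\lambda_1)}$. Explicitly, for $0\le s\le n/2$, $S^{(n-s,s)}\subseteq M^n_s$ is the intersection over $0\le r<s$ of the kernels of the linear maps $M^n_s\to M^n_r$ sending $x\in L^n_s$ to the sum of all its $r$-dimensional subspaces,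 and $\perp$ is taken with respect to the symmetric bilinear form on $M^n_s$ for which $L^n_s$ is an orthonormal basis. *)

(* Defs.v *)
From HB Require Import structures.
From mathcomp Require Import all_boot all_order all_algebra.
From mathcomp Require Import all_fingroup all_solvable all_field all_character.

Set Implicit Arguments.
Unset Strict Implicit.
Unset Printing Implicit Defensive.

Import GRing.Theory.
Local Open Scope ring_scope.

Definition qnum (F : fieldType) (q i : nat) : F := \sum_(j < i) q%:R ^+ j.

(* m = min { i > 1 : [i]_q = 0 in F } *)
Definition is_qchar (F : fieldType) (q m : nat) : Prop :=
  [/\ (1 < m)%N, qnum F q m = 0
    & forall i : nat, (1 < i)%N -> qnum F q i = 0 -> (m <= i)%N].

(* The minimum exists (indeed it is at most p). *)
Lemma is_qchar_exists (F : fieldType) (p q : nat) :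
  p \in [pchar F] -> ~~ (p %| q)%N -> exists m, is_qchar F q m.
Proof.
move=> pF pq; have p_pr := pcharf_prime pF.
have ex : exists i, (1 < i)%N && (qnum F q i == 0).
  have [q1|q1] := eqVneq (q%:R : F) 1.
    exists p; rewrite prime_gt1 //= /qnum q1.
    under eq_bigr do rewrite expr1n.
    by rewrite sumr_const card_ord pcharf0.
  have geo k : (q%:R - 1 : F) * qnum F q k = q%:R ^+ k - 1.
    by rewrite /qnum -subrX1.
  have q1' : (q%:R - 1 : F) != 0 by rewrite subr_eq0.
  have p1 : (q%:R : F) ^+ p.-1 = 1.
    have cqp : coprime q p by rewrite coprime_sym prime_coprime.
    have := Euler_exp_totient cqp; rewrite totient_prime // => e.
    rewrite -natrX -(GRing.natr_mod_pchar pF) e.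
    by rewrite (GRing.natr_mod_pchar pF).
  exists p.-1; apply/andP; split; last first.
    by have := geo p.-1; rewrite p1 subrr => /eqP; rewrite mulf_eq0 (negPf q1').
  have := prime_gt1 p_pr; case: p {geo} pF pq p_pr p1 => [|[|[|p]]] //= _ _ _.
  by rewrite expr1 => e; rewrite e eqxx in q1.
case: (ex_minnP ex) => m /andP[m1 /eqP m0] mmin.
by exists m; split=> // i i1 /eqP i0; apply: mmin; rewrite i1.
Qed.

(* MathComp's {'GL_n[K]} consists of matrices of size n.-1.+1, which is wrong  *)
(* for n = 0; this version is correct for every n.                             *)
Record GLelt (K : finFieldType) (n : nat) :=
  GLElt { GLmx :> 'M[K]_n; GLmxP : GLmx \in unitmx }.

HB.instance Definition _ K n := [isSub for @GLmx K n].
HB.instance Definition _ K n := [Finite of GLelt K n by <:].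

Section GLops.
Variables (K : finFieldType) (n : nat).

Definition GLone : GLelt K n := GLElt (unitmx1 K n).
Lemma GLmul_subproof (g h : GLelt K n) : (g : 'M_n) *m h \in unitmx.
Proof. by rewrite unitmx_mul !GLmxP. Qed.
Definition GLmul (g h : GLelt K n) := GLElt (GLmul_subproof g h).
Lemma GLinv_subproof (g : GLelt K n) : invmx g \in unitmx.
Proof. by rewrite unitmx_inv GLmxP. Qed.
Definition GLinv (g : GLelt K n) := GLElt (GLinv_subproof g).

Lemma GLmulA : associative GLmul.
Proof. by move=> x y z; apply: val_inj; rewrite /= mulmxA. Qed.
Lemma GLmul1 : left_id GLone GLmul.
Proof. by move=> x; apply: val_inj; rewrite /= mul1mx. Qed.
Lemma GLmulV : left_inverse GLone GLinv GLmul.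
Proof. by move=> x; apply: val_inj; rewrite /= mulVmx ?GLmxP. Qed.

HB.instance Definition _ := Finite_isGroup.Build (GLelt K n)
  GLmulA GLmul1 GLmulV.
End GLops.

Definition GLq (K : finFieldType) (n : nat) : {group GLelt K n} :=
  [set: GLelt K n]%G.

Definition subspaces (K : finFieldType) (n : nat) : Type := {vspace 'rV[K]_n}.
HB.instance Definition _ K n := Choice.on (subspaces K n).

Lemma subspaces_canc (K : finFieldType) (n : nat) :
  pcancel (fun U : subspaces K n => [set v : 'rV[K]_n | v \in U])
          (fun A => Some (span (enum A) : subspaces K n)).
Proof.
move=> U; congr Some; apply/eqP; rewrite eqEsubv; apply/andP; split.
  by apply/span_subvP=> v; rewrite mem_enum inE.
by apply/subvP=> v Uv; apply: memv_span; rewrite mem_enum inE.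
Qed.
HB.instance Definition _ K n : isCountable (subspaces K n) :=
  PCanIsCountable (@subspaces_canc K n).
HB.instance Definition _ K n : isFinite (subspaces K n) :=
  PCanIsFinite (@subspaces_canc K n).

Section PermutationModule.
Variables (F : fieldType) (K : finFieldType) (n : nat).

Local Notation sp := (subspaces K n).

(* K^n is the space of row vectors, on which GLq acts on the right. *)
Definition sp_act (U : sp) (g : GLelt K n) : sp :=
  (linfun (mulmxr (g : 'M[K]_n) : 'rV[K]_n -> 'rV[K]_n) @: U)%VS.

(* The direct sum M^n of all the M^n_k is realised as 'rV[F]_Ndim: the a-th    *)
(* coordinate belongs to the subspace enum_val a.  Matrices act on the right,  *)
(* so that row a of a matrix is the image of the basis vector enum_val a.      *)
Definition Ndim : nat := #|{: sp}|.

Definition rel_mx (r : rel sp) : 'M[F]_Ndim :=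
  \matrix_(a, b) (r (enum_val a) (enum_val b))%:R.

Definition perm_repr_mx (g : GLelt K n) : 'M[F]_Ndim :=
  rel_mx (fun U V => V == sp_act U g).

Lemma sp_act1 U : sp_act U 1%g = U.
Proof.
rewrite /sp_act -[RHS]lim1g; congr (_ @: U)%VS; apply/lfunP=> v.
by rewrite lfunE /= id_lfunE mulmx1.
Qed.

Lemma sp_actM U g h : sp_act U (g * h)%g = sp_act (sp_act U g) h.
Proof.
rewrite /sp_act -limg_comp; congr (_ @: U)%VS; apply/lfunP=> v.
by rewrite comp_lfunE !lfunE /= mulmxA.
Qed.

Lemma sp_actK g : cancel (sp_act^~ g) (sp_act^~ g^-1%g).
Proof. by move=> U; rewrite -sp_actM mulgV sp_act1. Qed.
Lemma sp_actKV g : cancel (sp_act^~ g^-1%g) (sp_act^~ g).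
Proof. by move=> U; rewrite -sp_actM mulVg sp_act1. Qed.

Lemma perm_mul_rel g r :
  perm_repr_mx g *m rel_mx r = rel_mx (fun U V => r (sp_act U g) V).
Proof.
apply/matrixP=> a b; rewrite !mxE (bigD1 (enum_rank (sp_act (enum_val a) g))) //=.
rewrite !mxE enum_rankK eqxx mul1r big1 ?addr0 // => c; rewrite !mxE => nc.
case: eqP => [e|]; last by rewrite mul0r.
by rewrite -e enum_valK eqxx in nc.
Qed.

Lemma rel_mul_perm g r :
  rel_mx r *m perm_repr_mx g = rel_mx (fun U V => r U (sp_act V g^-1%g)).
Proof.
apply/matrixP=> a b; rewrite !mxE.
rewrite (bigD1 (enum_rank (sp_act (enum_val b) g^-1%g))) //=.
rewrite !mxE enum_rankK sp_actKV eqxx mulr1 big1 ?addr0 // => c; rewrite !mxE => nc.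
case: eqP => [e|]; last by rewrite mulr0.
by rewrite e sp_actK enum_valK eqxx in nc.
Qed.

Lemma perm_repr_mxP : mx_repr (GLq K n) perm_repr_mx.
Proof.
split=> [|g h _ _].
  apply/matrixP=> a b; rewrite !mxE sp_act1 (inj_eq enum_val_inj).
  by rewrite eq_sym.
rewrite [X in _ = _ *m X]/perm_repr_mx perm_mul_rel.
by apply/matrixP=> a b; rewrite !mxE sp_actM.
Qed.

Definition perm_repr : mx_representation F (GLq K n) Ndim :=
  MxRepresentation perm_repr_mxP.

Lemma sp_act_sub g U V :
  (sp_act U g <= sp_act V g)%VS = (U <= V)%VS.
Proof.
apply/idP/idP; last exact: limgS.
move=> /(limgS (linfun (mulmxr ((g^-1)%g : 'M[K]_n) : 'rV[K]_n -> 'rV[K]_n))).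
by move: (sp_actK g U) (sp_actK g V); rewrite /sp_act /= => -> ->.
Qed.

Lemma sp_act_dim g U : \dim (sp_act U g) = \dim U.
Proof.
rewrite /sp_act limg_dim_eq //; apply/eqP; rewrite -subv0; apply/subvP=> v.
rewrite memv_cap memv_ker => /andP[_]; rewrite lfunE /= => /eqP e.
by rewrite memv0 -[v]mulmx1 -(mulmxV (GLmxP g)) mulmxA e mul0mx.
Qed.

Lemma rel_mx_centg (r : rel sp) :
    (forall g U V, r (sp_act U g) (sp_act V g) = r U V) ->
  centgmx perm_repr (rel_mx r).
Proof.
move=> rP; apply/centgmxP=> g _; rewrite /perm_repr /= perm_mul_rel rel_mul_perm.
by apply/matrixP=> a b; rewrite !mxE -[in LHS](rP g) sp_actKV.
Qed.

(* The diagonal projector whose row space is M^n_k (zero when k > n). *)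
Definition Mk (k : nat) : 'M[F]_Ndim :=
  rel_mx (fun U V => (V == U) && (\dim U == k)).

(* The boundary map on the whole of M^n, and the map sending a subspace to the *)
(* sum of all its r-dimensional subspaces.                                     *)
Definition incidence : 'M[F]_Ndim :=
  rel_mx (fun U V => (V <= U)%VS && ((\dim V).+1 == \dim U)).

Definition shadow (r : nat) : 'M[F]_Ndim :=
  rel_mx (fun U V => (V <= U)%VS && (\dim V == r)).

Definition ker_incidence (k i : nat) : 'M[F]_Ndim :=
  (kermx (incidence ^+ i) :&: Mk k)%MS.

Definition im_incidence (k j : nat) : 'M[F]_Ndim := Mk k *m incidence ^+ j.

Definition specht (s : nat) : 'M[F]_Ndim :=
  (Mk s :&: \bigcap_(r < s) kermx (shadow r))%MS.

(* The orthogonal in Mk s for the form making the basis orthonormal. *)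
Definition specht_perp (s : nat) : 'M[F]_Ndim :=
  (Mk s :&: kermx (specht s)^T)%MS.

Lemma Mk_centg k : centgmx perm_repr (Mk k).
Proof.
apply: rel_mx_centg => g U V.
by rewrite (can_eq (sp_actK g)) sp_act_dim.
Qed.

Lemma incidence_centg : centgmx perm_repr incidence.
Proof. by apply: rel_mx_centg => g U V; rewrite sp_act_sub !sp_act_dim. Qed.

Lemma shadow_centg r : centgmx perm_repr (shadow r).
Proof. by apply: rel_mx_centg => g U V; rewrite sp_act_sub !sp_act_dim. Qed.

Lemma mul_centg A B :
  centgmx perm_repr A -> centgmx perm_repr B -> centgmx perm_repr (A *m B).
Proof.
move=> /centgmxP cA /centgmxP cB; apply/centgmxP=> g Gg.
by rewrite -mulmxA cB // mulmxA cA // mulmxA.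
Qed.

Lemma exp_centg A i : centgmx perm_repr A -> centgmx perm_repr (A ^+ i).
Proof.
move=> cA; elim: i => [|i IH]; last by rewrite exprS; apply: mul_centg.
by apply/centgmxP=> g Gg; rewrite expr0 -[1]/(1%:M) mulmx1 mul1mx.
Qed.

Lemma centg_module A : centgmx perm_repr A -> mxmodule perm_repr A.
Proof.
move=> /centgmxP cA; apply/mxmoduleP=> g Gg.
by rewrite cA // submxMl.
Qed.

Lemma ker_incidence_module k i : mxmodule perm_repr (ker_incidence k i).
Proof.
apply: capmx_module; last exact/centg_module/Mk_centg.
exact/kermx_centg_module/exp_centg/incidence_centg.
Qed.

Lemma im_incidence_module k j : mxmodule perm_repr (im_incidence k j).
Proof.
exact/centg_module/mul_centg/exp_centg/incidence_centg/Mk_centg.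
Qed.

Lemma specht_module s : mxmodule perm_repr (specht s).
Proof.
apply: capmx_module; first exact/centg_module/Mk_centg.
elim/big_ind: _ => [|A B mA mB|r _]; first exact: mxmodule1.
  exact: capmx_module.
exact/kermx_centg_module/shadow_centg.
Qed.

Lemma perm_repr_tr g : (perm_repr g)^T = perm_repr g^-1%g.
Proof.
apply/matrixP=> a b; rewrite !mxE; congr (nat_of_bool _)%:R.
by apply/eqP/eqP=> ->; rewrite ?sp_actK ?sp_actKV.
Qed.

Lemma specht_perp_module s : mxmodule perm_repr (specht_perp s).
Proof.
apply: capmx_module; first exact/centg_module/Mk_centg.
apply/mxmoduleP=> g _; apply/sub_kermxP.
rewrite -mulmxA -[perm_repr g]trmxK -trmx_mul perm_repr_tr.
have /mxmoduleP/(_ (g^-1)%g (in_setT _))/submxP[D ->] := specht_module s.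
by rewrite trmx_mul mulmxA mulmx_ker mul0mx.
Qed.

(* section_repr modU modV is the module (U + V) / U = V / (U :&: V); here the  *)
(* image lies in the kernel because incidence ^+ m = 0.                        *)
Definition incidence_homology (m k i : nat) : representation F (GLq K n) :=
  Representation (section_repr
    (im_incidence_module (k + (m - i)) (m - i)) (ker_incidence_module k i)).

(* specht_head s is D^(n-s,s) for 2s <= n. *)
Definition specht_head (s : nat) : representation F (GLq K n) :=
  Representation (section_repr
    (capmx_module (specht_module s) (specht_perp_module s)) (specht_module s)).

(* D^(n-t,t) for arbitrary t, using D^(l1,l2) = D^(l2,l1), and 0 if n < t. *)
Definition Dmod (t : nat) : representation F (GLq K n) :=
  if (t <= n)%N then specht_head (minn t (n - t)) else grepr0.

End PermutationModule.

(* n < 2k + m - i < n + m; subtraction is exact when i < m. *)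
Definition middle_index (n m k i : nat) : bool :=
  [&& (k <= n)%N, (0 < i)%N, (i < m)%N
    & (n < k.*2 + (m - i) < n + m)%N].

(* k >= n/2 is written n <= 2k, and i <= (m - n)/2 + k is written              *)
(* 2i + n <= m + 2k; index_iota a b is the list of t with a <= t <= b - 1.     *)
Definition Tset (n m k i : nat) : seq nat :=
  if (n <= k.*2)%N then
    if (i.*2 + n <= m + k.*2)%N then index_iota k (n - k + i)
    else index_iota k (k + (m - i))
  else
    if (i.*2 + n <= m + k.*2)%N then index_iota (n - k) (n - k + i)
    else index_iota (n - k) (k + (m - i)).

(* Main.v *)
(* Write d for the incidence map, e for its transpose, [a] for qnum, S_t for   *)
(* the Specht module in M_t and F_k for the elements of M_j whose shadows in   *)
(* dimensions < k vanish.                                                      *)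
(* The key fact is that, for k <= j <= n - k, the k-shadow maps F_k in M_j     *)
(* onto S_k. By duality it says that a function on L_k whose inclusion sums on *)
(* L_j form a polynomial of degree < k (the indicator of [z <= x] having       *)
(* degree dim z) is itself one; this is proved by induction, branching over a  *)
(* point.                                                                      *)
(* Let x in M_j be killed by d^i. If k + j + m - i <= n, then subtracting      *)
(* d^(m-i) of a lift of a multiple of its k-shadow moves x from F_k to         *)
(* F_(k+1), since the constants involved are products of [a] with a not        *)
(* divisible by m. For larger k the sl2-type relation                          *)
(* e d - d e = [n-k] - [k] on M_k (operators acting on the right) shows that   *)
(* one may subtract a multiple of y e^(j-k) with y in S_k instead. Hence the   *)
(* homology at (j, i) is spanned by the images of S_t under e^(j-t), for the t *)
(* in the given range. These images are mutually orthogonal, and orthogonal to *)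
(* the image of d^(m-i) as y e^b = 0 for y in S_t, b > n - 2t, so only the     *)
(* radical of each S_t can become zero. It does: orthogonal complements of     *)
(* subspaces exchange d and e, and give the same description of the kernel of  *)
(* e^(m-i).                                                                    *)

(* Fix a level j and compare the kernel of d^i in M_j with the image of d^(m-i), peeling off
   shadows. If the shadows of x below dimension k vanish, its k-shadow lies in the Specht module
   S_k. [kernel_step] cancels it by a boundary or by some y e^(j-k) with y in S_k, the latter only
   when k satisfies [middle]. By iteration, [kernel_decomp] writes the kernel as boundaries plus
   terms y_t e^(j-t); the process stops because too many vanishing shadows force x = 0
   ([kantor_mx]). Boundaries with a prescribed k-shadow come from [specht_lift], the dual form of
   the injectivity statement [gr_inj]; the terms y e^(j-k) are handled by the commutation rule
   [comm_ed].

   The relations between these terms are found with the standard form. The pieces S_t e^(j-t) are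
   orthogonal to each other ([dot_specht]) and to the boundaries ([dot_image]), so a combination
   that is a boundary has every y_t in the radical of S_t. Conversely, taking orthogonal complements
   of subspaces turns [kernel_decomp] into [kernel_e_decomp], a description of the orthogonal of the
   boundaries, and by it radical elements do become boundaries ([image_perp_specht]). The homology
   is therefore the sum of the S_t modulo radical over the middle t. Each summand is nonzero by
   [kernel_el_nonisotropic], and there is no such t when (k, i) is not a middle index. *)
Require Import Defs.
From mathcomp Require Import all_boot all_order all_algebra.
From mathcomp Require Import all_fingroup all_solvable all_field all_character.
From mathcomp Require Import zify ring.

Set Implicit Arguments.
Unset Strict Implicit.
Unset Printing Implicit Defensive.

Import GRing.Theory.
Local Open Scope ring_scope.

(* lia on goals about dimensions: the dimensions are abstracted first, since *)
(* otherwise every pair of them is compared up to conversion.                 *)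
Ltac dim_lia :=
  repeat match goal with
  | H : is_true (leq _ _) |- _ => revert H
  | H : is_true (negb (leq _ _)) |- _ => revert H
  | H : @eq ?T _ _ |- _ => unify T nat; revert H
  | H : is_true (negb (@eq_op ?T _ _)) |- _ =>
      let U := constr:(Equality.sort T) in unify U nat; revert H
  end;
  repeat match goal with
  | |- context [@dimv ?K ?V ?U] => let d := fresh "dim" in generalize (@dimv K V U); intro d
  end;
  clear; intros; lia.

(** * Counting subspaces *)

Section Lattice.
Variables (K : finFieldType) (n : nat).
Local Notation sp := (subspaces K n).
Local Notation q := #|K|.
Implicit Types (x y z w E P R V U : sp) (p r : 'rV[K]_n).

Definition join_line (z : sp) (p : 'rV[K]_n) : sp := (z + <[p]>)%VS.

Lemma mem_join_line z p v :
  v \in join_line z p -> exists2 u, u \in z & exists c, v = u + c *: p.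
Proof. by case/memv_addP=> u uz [_ /vlineP[c ->] ->]; exists u => //; exists c. Qed.

Lemma sub_join_line z p : (z <= join_line z p)%VS.
Proof. exact: addvSl. Qed.

Lemma line_in_join z p : p \in join_line z p.
Proof. by rewrite memvE addvSr. Qed.

Lemma join_line_sub z p w : (join_line z p <= w)%VS = (z <= w)%VS && (p \in w).
Proof. by rewrite /join_line subv_add memvE. Qed.

Lemma join_lineS z w p : (z <= w)%VS -> (join_line z p <= join_line w p)%VS.
Proof. by move=> zw; rewrite join_line_sub line_in_join (subv_trans zw) ?sub_join_line. Qed.

Lemma join_line_id z p : p \in z -> join_line z p = z.
Proof. by move=> pz; apply/eqP; rewrite eqEsubv join_line_sub subvv pz sub_join_line. Qed.

Lemma dim_join_line z p : p \notin z -> \dim (join_line z p) = (\dim z).+1.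
Proof.
move=> pz; rewrite /join_line dimv_disjoint_sum ?dim_vline.
  by rewrite (_ : p != 0) ?addn1 //; apply: contraNneq pz => ->; rewrite mem0v.
apply/eqP; rewrite -subv0; apply/subvP=> v; rewrite memv_cap => /andP[vz /vlineP[c e]].
have [c0|c0] := eqVneq c 0; first by rewrite e c0 scale0r mem0v.
case/negP: pz; rewrite -[p]scale1r -(mulVf c0) -scalerA -e.
exact: memvZ.
Qed.

Lemma join_lineA z p r : join_line (join_line z p) r = join_line (join_line z r) p.
Proof. by rewrite /join_line -addvA (addvC <[p]>%VS) addvA. Qed.

Lemma join_line_exch z p r :
  p \notin z -> r \in join_line z p -> r \notin z -> join_line z r = join_line z p.
Proof.
move=> pz rzp rz; apply/eqP; rewrite eqEdim join_line_sub sub_join_line rzp /=.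
by rewrite !dim_join_line.
Qed.

(* Hyperplanes x of y: dim x = dim y - 1 is written x + <p> = y, p outside x.  *)
Definition compl_in z p y := [pred x : sp | [&& (z <= x)%VS, p \notin x & join_line x p == y]].

(** Pick a in y outside z + <p>. Each x contains exactly one vector a + c p, and the x containing a
    given one are complements of p above z + <a + c p>. So each extra dimension contributes a factor
    q. *)
Lemma card_compl_in z p y : p \notin z -> (join_line z p <= y)%VS ->
  #|compl_in z p y| = (q ^ (\dim y - (\dim z).+1))%N.
Proof.
move=> pz zpy; move: {2}(\dim y - _)%N (erefl (\dim y - (\dim z).+1)%N) => d.
elim: d z pz zpy => [|d IH] z pz zpy ed.
  have ey : y = join_line z p.
    by apply/eqP; rewrite eq_sym eqEdim zpy dim_join_line //; dim_lia.
  rewrite ed (eq_card (B := pred1 z)) ?card1 // => x; rewrite !inE.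
  apply/idP/eqP => [/and3P[zx px /eqP xy]|->]; last by rewrite subvv pz ey eqxx.
  apply/eqP; rewrite eq_sym eqEdim zx /=.
  by have := dim_join_line px; rewrite xy ey dim_join_line // => -[->].
have [a ay azp] : exists2 a, a \in y & a \notin join_line z p.
  apply/subvPn; apply/negP=> /dimvS; rewrite dim_join_line //; dim_lia.
pose b c : 'rV[K]_n := a + c *: p.
have bz c : b c \notin join_line z p.
  apply: contra azp => h; rewrite -[a](addrK (c *: p)) memvB //.
  by rewrite memvZ // line_in_join.
have bz' c : b c \notin z by apply: contra (bz c); apply/subvP/sub_join_line.
have pzb c : p \notin join_line z (b c).
  apply/negP=> h; case/negP: (bz c).
  by rewrite (join_line_exch (bz' c) h pz) line_in_join.
have e1 x : x \in compl_in z p y -> #|[pred c | b c \in x]| = 1%N.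
  rewrite !inE => /and3P[zx px /eqP xy].
  have axp : a \in join_line x p by rewrite xy.
  have [u ux [c ac]] := mem_join_line axp.
  have {}ac : b (- c) = u by rewrite /b ac scaleNr addrK.
  rewrite (eq_card (B := pred1 (- c))) ?card1 // => c'; rewrite !inE.
  apply/idP/eqP => [bx|->]; last by rewrite ac.
  apply/eqP; apply: contraNT px => nc.
  have nc' : c' - - c != 0 by rewrite subr_eq0.
  have : (c' - - c)^-1 *: (b c' - b (- c)) \in x by rewrite memvZ // memvB // ac.
  by rewrite /b opprD addrACA subrr add0r -scalerBl scalerA mulVf // scale1r.
have : (\sum_(x in compl_in z p y) \sum_(c | b c \in x) 1 = #|compl_in z p y|)%N.
  rewrite -sum1_card; apply: eq_bigr => x /e1 e.
  by rewrite sum1_card -[RHS]e; apply: eq_card => c; rewrite !inE.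
rewrite (exchange_big_dep xpredT) //= => <-.
rewrite (eq_bigr (fun=> (q ^ d)%N)).
  by rewrite sum_nat_const cardE -cardT ed expnS.
move=> c _; rewrite sum1_card.
have ed' : (\dim y - (\dim (join_line z (b c))).+1)%N = d.
  by rewrite (dim_join_line (bz' c)); dim_lia.
have sub : (join_line (join_line z (b c)) p <= y)%VS.
  move: zpy; rewrite !join_line_sub => /andP[-> py].
  by rewrite py memvD ?memvZ.
rewrite -[in RHS]ed' -(IH _ (pzb c) sub ed'); apply: eq_card => x.
transitivity ((x \in compl_in z p y) && (b c \in x)); first by rewrite inE.
by rewrite !inE join_line_sub; case: (z <= x)%VS => //=; rewrite andbC.
Qed.

Lemma compl_in_sub z p y x : x \in compl_in z p y -> (join_line z p <= y)%VS.
Proof. by rewrite inE => /and3P[zx _ /eqP <-]; apply: join_lineS. Qed.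

Definition interval V U t := [pred W : sp | (V <= W <= U)%VS && (\dim W == \dim V + t)%N].

(** Gaussian binomial coefficients, by the q-Pascal rule that the proof of [card_interval]
    reproduces. *)
Fixpoint gauss (d t : nat) : nat :=
  match t, d with
  | 0, _ => 1
  | _.+1, 0 => 0
  | t'.+1, d'.+1 => gauss d' t' + q ^ t * gauss d' t
  end.

(** Fix p in U outside V. The W through p lie above V + <p>; the others are fibred by W + <p>, with
    fibres of size q^t by [card_compl_in]. *)
Lemma card_interval V U t : (V <= U)%VS ->
  #|interval V U t| = gauss (\dim U - \dim V) t.
Proof.
move=> VU; move: {2}(\dim U - \dim V)%N (erefl (\dim U - \dim V)%N) => d.
elim: d V t VU => [|d IH] V [|t] VU ed; rewrite ed /=.
- rewrite (eq_card (B := pred1 V)) ?card1 // => W; rewrite !inE.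
  apply/andP/eqP => [[/andP[VW _] /eqP e]|->]; last by rewrite subvv VU addn0.
  by apply/eqP; rewrite eq_sym eqEdim VW e addn0 /=.
- rewrite eq_card0 // => W; rewrite !inE; apply/negP=> /andP[/andP[_ /dimvS WU] /eqP e].
  dim_lia.
- rewrite (eq_card (B := pred1 V)) ?card1 // => W; rewrite !inE.
  apply/andP/eqP => [[/andP[VW _] /eqP e]|->]; last by rewrite subvv VU addn0.
  by apply/eqP; rewrite eq_sym eqEdim VW e addn0 /=.
have [p pU pV] : exists2 p, p \in U & p \notin V.
  by apply/subvPn; apply/negP=> /dimvS; dim_lia.
have VpU : (join_line V p <= U)%VS by rewrite join_line_sub VU.
have dVp := dim_join_line pV.
have ed' : (\dim U - \dim (join_line V p))%N = d by dim_lia.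
rewrite -(cardID [pred W : sp | p \in W]); congr (_ + _)%N.
  rewrite -[in RHS]ed' -(IH _ _ VpU ed'); apply: eq_card => W.
  rewrite !inE join_line_sub dVp addSnnS.
  by case: (V <= W)%VS; case: (W <= U)%VS; case: (p \in W); rewrite /= ?andbF ?andbT.
have := IH _ t.+1 VpU ed'; rewrite ed' => <-.
rewrite -[LHS]sum1_card -[#|interval _ _ _|]sum1_card big_distrr /=.
rewrite (partition_big (fun W => join_line W p) (mem (interval (join_line V p) U t.+1))) /=.
  apply: eq_bigr => w; rewrite inE join_line_sub dVp => /andP[/andP[/andP[Vw pw] wU] /eqP dw].
  rewrite muln1 sum1_card (eq_card (B := compl_in V p w)) => [|W].
    by rewrite card_compl_in ?join_line_sub ?Vw // dw (_ : _ - _ = t.+1)%N; last dim_lia.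
  rewrite !inE unfold_in /= !inE.
  case: (boolP (p \in W)) => pW /=; first by rewrite andbF.
  case: (V <= W)%VS => //=.
  have [e|_] := eqVneq (join_line W p) w; last by rewrite !andbF.
  rewrite andbT (subv_trans (sub_join_line W p)) ?e //=.
  by have := dim_join_line pW; rewrite e dw; dim_lia.
move=> W; rewrite !inE => /andP[pW /andP[/andP[VW WU] /eqP dW]].
rewrite !join_line_sub (subv_trans VW) ?sub_join_line // line_in_join WU pU.
by rewrite !dim_join_line // dW addSn eqxx.
Qed.

Lemma gauss_gt d t : (d < t)%N -> gauss d t = 0.
Proof. by elim: d t => [|d IH] [|t] //= dt; rewrite !IH ?muln0 //; dim_lia. Qed.

Lemma gaussdd d : gauss d d = 1.
Proof. by elim: d => [|d /= ->] //; rewrite gauss_gt ?muln0. Qed.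

Lemma qnumS (F : fieldType) a : qnum F q a.+1 = 1 + q%:R * qnum F q a.
Proof.
rewrite /qnum big_ord_recl expr0 big_distrr; congr (_ + _).
by apply: eq_bigr => i _; rewrite exprS.
Qed.

Lemma qnumSr (F : fieldType) a : qnum F q a.+1 = qnum F q a + q%:R ^+ a.
Proof. by rewrite /qnum big_ord_recr. Qed.

Lemma gauss1 (F : fieldType) d : (gauss d 1)%:R = qnum F q d.
Proof.
elim: d => [|d IH]; first by rewrite /qnum big_ord0.
have g0 : gauss d 0 = 1%N by case: (d).
by rewrite [gauss _ _]/= -/(gauss d 0) g0 natrD natrM expn1 IH mulr1n qnumS.
Qed.

Lemma gauss_pred (F : fieldType) d : (gauss d.+1 d)%:R = qnum F q d.+1.
Proof.
elim: d => [|d IH]; first by rewrite /qnum big_ord_recl big_ord0 addr0.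
rewrite [gauss _ _]/= -/(gauss d.+1 d) -/(gauss d.+1 d.+1) natrD IH gaussdd.
by rewrite muln1 natrX [RHS]qnumSr.
Qed.

Lemma dim_le z : (\dim z <= n)%N.
Proof. by have := dimvS (subvf z); rewrite dimvf dim_matrix mul1r. Qed.

Lemma dim_join_le z p : (\dim (join_line z p) <= (\dim z).+1)%N.
Proof.
by case: (boolP (p \in z)) => pz; [rewrite join_line_id | rewrite dim_join_line].
Qed.

Lemma ex_notin z : (\dim z < n)%N -> exists p, p \notin z.
Proof.
move=> zn; have /subvPn[p _ pz] : ~~ (fullv <= z)%VS; last by exists p.
by apply/negP=> /dimvS; rewrite dimvf dim_matrix mul1r; dim_lia.
Qed.

Definition lev E k z := (E <= z)%VS && (\dim z == \dim E + k)%N.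

Lemma ex_lev E j : (\dim E + j <= n)%N -> exists x, lev E j x.
Proof.
elim: j => [|j IH] h; first by exists E; rewrite /lev subvv addn0 eqxx.
have [|x /andP[Ex /eqP dx]] := IH; first by dim_lia.
have [|p px] := @ex_notin x; first by rewrite dx; dim_lia.
exists (join_line x p); rewrite /lev dim_join_line // dx addnS eqxx andbT.
exact: subv_trans (sub_join_line x p).
Qed.

Lemma sub_eq_dim z x : (z <= x)%VS -> (\dim x <= \dim z)%N -> z = x.
Proof. by move=> zx dx; apply/eqP; rewrite eqEdim zx. Qed.

Lemma lev0 E z : lev E 0 z = (z == E).
Proof.
apply/andP/eqP => [[Ez /eqP dz]|->]; last by rewrite subvv addn0.
by apply/esym/sub_eq_dim; rewrite // dz addn0.
Qed.

Lemma lev_join E k p z : p \notin E -> lev E k z -> p \notin z ->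
  lev (join_line E p) k (join_line z p).
Proof.
move=> pE /andP[Ez /eqP dz] pz; rewrite /lev join_lineS //=.
by rewrite !dim_join_line // dz addSn.
Qed.

Lemma lev_joinE E k p z : p \notin E ->
  lev (join_line E p) k z = lev E k.+1 z && (p \in z).
Proof.
by move=> pE; rewrite /lev join_line_sub dim_join_line // addSnnS andbAC.
Qed.

End Lattice.
(** * Functions on subspaces as polynomials *)

Section Degree.
Variables (K : finFieldType) (n : nat) (F : fieldType).
Local Notation sp := (subspaces K n).
Local Notation q := #|K|.
Local Notation Q := (q%:R : F).
Hypothesis Q0 : Q != 0.
Implicit Types (x y z w E P R V U : sp) (p r : 'rV[K]_n) (u v f g h c : sp -> F) (k j : nat).
Local Notation "[ 'le' z , x ]" := ((z <= x)%VS)%:R (format "[ 'le'  z ,  x ]").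

Lemma sum_nz (I : finType) (A : pred I) (f : I -> F) :
  \sum_(i | A i) f i != 0 -> exists2 i, A i & f i != 0.
Proof.
move=> nz; apply/exists_inP; apply: contraNT nz; rewrite negb_exists_in => /forall_inP h.
by rewrite big1 // => i /h; rewrite negbK => /eqP.
Qed.

(* Deg E k f: on the subspaces containing E, f is a polynomial of degree less  *)
(* than k, the indicator of [z <= x] having degree dim z - dim E.              *)
Definition Deg E k f := exists2 c : sp -> F,
  (forall z, c z != 0 -> (E <= z)%VS && (\dim z < \dim E + k)%N) &
  (forall x, f x = \sum_z c z * [le z, x]).

Lemma Deg_ext E k f g : f =1 g -> Deg E k f -> Deg E k g.
Proof. by move=> fg [c cP cE]; exists c => // x; rewrite -fg. Qed.

Lemma Deg0 E k : Deg E k (fun=> 0).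
Proof. by exists (fun=> 0) => [z|x]; rewrite ?eqxx // big1 // => z _; rewrite mul0r. Qed.

Lemma DegD E k f g : Deg E k f -> Deg E k g -> Deg E k (fun x => f x + g x).
Proof.
move=> [c cP cE] [d dP dE]; exists (fun z => c z + d z) => [z|x].
  by have [->|/cP //] := eqVneq (c z) 0; rewrite add0r; apply: dP.
by rewrite cE dE -big_split; apply: eq_bigr => z _; rewrite mulrDl.
Qed.

Lemma DegZ E k a f : Deg E k f -> Deg E k (fun x => a * f x).
Proof.
move=> [c cP cE]; exists (fun z => a * c z) => [z|x].
  by rewrite mulf_eq0 negb_or => /andP[_ /cP].
by rewrite cE big_distrr /=; apply: eq_bigr => z _; rewrite mulrA.
Qed.

Lemma Deg_sum (I : finType) (A : pred I) E k (f : I -> sp -> F) :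
  (forall i, A i -> Deg E k (f i)) -> Deg E k (fun x => \sum_(i | A i) f i x).
Proof.
move=> h; elim: (index_enum I) => [|i s IH].
  by apply: Deg_ext (Deg0 E k) => x; rewrite big_nil.
case Ai: (A i); last by apply: Deg_ext IH => x; rewrite big_cons Ai.
by apply: Deg_ext (DegD (h i Ai) IH) => x; rewrite big_cons Ai.
Qed.

Lemma Deg_ind E k z : (E <= z)%VS -> (\dim z < \dim E + k)%N ->
  Deg E k (fun x => [le z, x]).
Proof.
move=> Ez dz; exists (fun w => (w == z)%:R) => [w|x].
  by have [->|_] := eqVneq w z; rewrite ?Ez ?dz // eqxx.
rewrite (bigD1 z) //= eqxx mul1r big1 ?addr0 // => w /negPf ->.
by rewrite mul0r.
Qed.

Lemma Deg_comb E k (A : pred sp) c (phi : sp -> sp) :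
  (forall z, A z -> c z != 0 -> (E <= phi z)%VS && (\dim (phi z) < \dim E + k)%N) ->
  Deg E k (fun x => \sum_(z | A z) c z * [le phi z, x]).
Proof.
move=> h; apply: Deg_sum => z Az; have [->|/(h z Az)/andP[]] := eqVneq (c z) 0.
  by apply: Deg_ext (Deg0 E k) => x; rewrite mul0r.
by move=> ? ?; apply/DegZ/Deg_ind.
Qed.

Lemma Deg_out E k f x : Deg E k f -> ~~ (E <= x)%VS -> f x = 0.
Proof.
case=> c cP -> Ex; apply: big1 => z _.
have [->|/cP/andP[Ez _]] := eqVneq (c z) 0; first by rewrite mul0r.
case zx: (z <= x)%VS; last by rewrite mulr0.
by rewrite (subv_trans Ez zx) in Ex.
Qed.

Lemma Deg_join E p k f : p \notin E -> Deg (join_line E p) k f -> Deg E k.+1 f.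
Proof.
move=> pE [c cP cE]; exists c => // z /cP.
by rewrite join_line_sub dim_join_line // addSnnS => /andP[/andP[-> _] ->].
Qed.

(* As a polynomial, v stands for the form of degree k with coefficients v z.   *)
(* low_on: on level k this form agrees with a polynomial of degree < k;        *)
(* low_sum: it does so on level j.                                             *)
Definition low_on E k v := exists2 h, Deg E k h & forall z, lev E k z -> v z = h z.
Definition low_sum E k j v := exists2 g, Deg E k g & forall x, lev E j x ->
  \sum_(z | lev E k z) v z * [le z, x] = g x.

Lemma low_onD E k u v : low_on E k u -> low_on E k v -> low_on E k (fun z => u z + v z).
Proof.
move=> [f fd fE] [g gd gE]; exists (fun z => f z + g z); first exact: DegD.
by move=> z lz; rewrite fE ?gE.
Qed.

Lemma low_onZ E k a v : low_on E k v -> low_on E k (fun z => a * v z).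
Proof. by move=> [f fd fE]; exists (fun z => a * f z); [apply: DegZ|move=> z /fE ->]. Qed.

Lemma low_on_ext E k u v : (forall z, lev E k z -> u z = v z) -> low_on E k u -> low_on E k v.
Proof. by move=> uv [f fd fE]; exists f => // z lz; rewrite -uv ?fE. Qed.

Lemma low_on_big (I : finType) (A : pred I) E k (f : I -> sp -> F) :
  (forall i, A i -> low_on E k (f i)) -> low_on E k (fun z => \sum_(i | A i) f i z).
Proof.
move=> h; elim: (index_enum I) => [|i s IH].
  by exists (fun=> 0) => [|z _]; [apply: Deg0 | rewrite big_nil].
case Ai: (A i).
  by apply: low_on_ext (low_onD (h i Ai) IH) => z _; rewrite big_cons Ai.
by apply: low_on_ext IH => z _; rewrite big_cons Ai.
Qed.

Lemma low_sum_sub E k j u v :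
  low_sum E k j u -> low_sum E k j v -> low_sum E k j (fun z => v z - u z).
Proof.
move=> [f fd fE] [g gd gE]; exists (fun z => g z + (-1) * f z).
  by apply/DegD/DegZ.
move=> x lx; rewrite -fE // -gE // mulN1r -sumrB; apply: eq_bigr => z _.
by rewrite mulrBl.
Qed.

(** The number of z of level k between w and x depends only on the dimension of w, so summation
    merely rescales the coefficients of the polynomial. *)
Lemma low_on_sum E k j v : low_on E k v -> low_sum E k j v.
Proof.
move=> [h [c cP cE] hE].
pose t z := gauss K (\dim E + j - \dim z) (\dim E + k - \dim z).
exists (fun x => \sum_z c z * (t z)%:R * [le z, x]).
  apply: (@Deg_comb E k xpredT (fun z => c z * (t z)%:R) id) => z _.
  by rewrite mulf_eq0 negb_or => /andP[/cP].
move=> x /andP[Ex /eqP dx]; under eq_bigr => z lz do rewrite hE // cE big_distrl /=.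
rewrite exchange_big; apply: eq_bigr => w _ /=.
have [->|/cP/andP[Ew dw]] := eqVneq (c w) 0.
  by rewrite big1 ?mul0r // => z _; rewrite !mul0r.
under eq_bigr => z _ do rewrite -mulrA -natrM mulnb.
rewrite -big_distrr /= -mulrA; congr (_ * _); rewrite -natr_sum /= -natrM; congr (_%:R).
have [wx|wx] := boolP (w <= x)%VS; last first.
  rewrite muln0 big1 // => z _; apply/eqP; rewrite eqb0.
  by apply: contra wx => /andP[wz zx]; apply: subv_trans zx.
rewrite muln1 /t -dx -(card_interval _ wx) -sum1_card [RHS]big_mkcond /= [LHS]big_mkcond /=.
apply: eq_bigr => z _; rewrite !inE /lev.
have [wz|wz] /= := boolP (w <= z)%VS; last by case: ifP.
rewrite (subv_trans Ew wz) subnKC 1?ltnW //=.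
by case: eqP; case: (z <= x)%VS.
Qed.

End Degree.

(** * Branching: passing from z to z + <p> *)

Section Branching.
Variables (K : finFieldType) (n : nat) (F : fieldType).
Local Notation sp := (subspaces K n).
Local Notation q := #|K|.
Local Notation Q := (q%:R : F).
Hypothesis Q0 : Q != 0.
Implicit Types (x y z w E P R V U : sp) (p r : 'rV[K]_n) (u v f g h c : sp -> F) (k j : nat).
Local Notation "[ 'le' z , x ]" := ((z <= x)%VS)%:R (format "[ 'le'  z ,  x ]").

Lemma sum_ind (I : finType) (A B : pred I) :
  \sum_(i | A i) (B i)%:R = #|[pred i | A i && B i]|%:R :> F.
Proof.
rewrite -sum1_card natr_sum [RHS]big_mkcondr /=.
by apply: eq_bigr => i _; case: (B i).
Qed.

Lemma sum_fiber p E j y z : p \notin E -> (E <= z)%VS -> lev (join_line E p) j y ->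
  \sum_(x | lev E j x && (p \notin x) && (join_line x p == y)) ([le z, x] : F)
  = (p \notin z)%:R * [le join_line z p, y] * Q ^+ (\dim y - (\dim z).+1).
Proof.
move=> pE Ez /andP[Ey /eqP dy]; have [pz|pz] := boolP (p \in z).
  rewrite !mul0r big1 // => x /andP[/andP[_ px] _].
  by case zx: (z <= x)%VS => //; case/negP: px; apply: subvP zx _ pz.
rewrite mul1r sum_ind (eq_card (B := compl_in z p y)) => [|x].
  have [zpy|zpy] := boolP (join_line z p <= y)%VS.
    by rewrite card_compl_in // natrX mul1r.
  rewrite mul0r eq_card0 // => x; apply/negP=> /compl_in_sub.
  by rewrite (negPf zpy).
rewrite !inE /lev.
have [zx|zx] := boolP (z <= x)%VS; last by rewrite andbF.
rewrite (subv_trans Ez zx) andbT /=.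
have [px|px] := boolP (p \in x); first by rewrite andbF.
have [e|//] := eqVneq (join_line x p) y; last by rewrite andbF.
by have := dim_join_line px; rewrite e dy dim_join_line // addSn => -[->]; rewrite eqxx.
Qed.

(** The only possible complement w0 inside z is the intersection of w and z, since z is a hyperplane
    of z + <p>. *)
Lemma sum_compl_le p E w z : p \notin z -> (join_line E p <= w)%VS ->
  \sum_(w0 : sp | [&& (E <= w0)%VS, p \notin w0 & join_line w0 p == w]) ([le w0, z] : F)
  = (E <= z)%VS%:R * [le w, join_line z p].
Proof.
move=> pz; rewrite join_line_sub => /andP[Ew pw].
have [h|h] := boolP ((E <= z)%VS && (w <= join_line z p)%VS); last first.
  rewrite -natrM mulnb (negPf h) big1 // => w0 /and3P[Ew0 _ /eqP e].
  case wz: (w0 <= z)%VS => //; case/negP: h.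
  by rewrite (subv_trans Ew0 wz) -e join_lineS.
case/andP: h => Ez wz; rewrite Ez wz mul1r.
have d1 : (\dim (w :&: z)%VS).+1 = \dim w.
  have := dimv_sum_cap w z; have -> : (w + z)%VS = join_line z p.
    apply/eqP; rewrite eqEsubv subv_add wz sub_join_line join_line_sub addvSr.
    by rewrite (subvP (addvSl w z)).
  by rewrite dim_join_line //; dim_lia.
have pc : p \notin (w :&: z)%VS by rewrite memv_cap negb_and pz orbT.
have jc : join_line (w :&: z)%VS p = w.
  by apply/eqP; rewrite eqEdim join_line_sub capvSl pw dim_join_line // d1 leqnn.
rewrite (bigD1 ((w :&: z)%VS : sp)) /= ?subv_cap ?Ew ?Ez ?pc ?jc ?eqxx //.
rewrite capvSr big1 ?addr0 // => w0 /andP[/and3P[_ pw0 /eqP e] ne].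
case wz0: (w0 <= z)%VS => //; case/eqP: ne; apply/eqP; rewrite eqEdim subv_cap wz0.
by rewrite -{1}e sub_join_line /= -ltnS d1 -e dim_join_line.
Qed.

Definition push E k p v w : F :=
  \sum_(z | lev E k z && (p \notin z) && (join_line z p == w)) v z.

Lemma sum_push E k p v (G : sp -> F) : p \notin E ->
  \sum_(z | lev E k z && (p \notin z)) v z * G (join_line z p)
  = \sum_(w | lev (join_line E p) k w) push E k p v w * G w.
Proof.
move=> pE; rewrite (partition_big (fun z => join_line z p) (lev (join_line E p) k)) /=.
  apply: eq_bigr => w _; rewrite /push big_distrl /=.
  by apply: eq_bigr => z /andP[_ /eqP ->].
by move=> z /andP[lz pz]; apply: lev_join.
Qed.

(** Off p, the condition w <= z + <p> is the sum of the conditions w0 <= z over the complements w0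
    of p in w, and w0 has the same degree over E as w has over E + <p>. *)
Lemma Deg_push E p k u : p \notin E -> Deg (join_line E p) k u ->
  exists2 h, Deg E k h & forall z, (E <= z)%VS -> p \notin z -> h z = u (join_line z p).
Proof.
move=> pE [c cP cE].
exists (fun x => \sum_w c w *
  \sum_(w0 : sp | [&& (E <= w0)%VS, p \notin w0 & join_line w0 p == w]) [le w0, x]).
  apply: Deg_sum => w _; have [->|/cP/andP[Ew dw]] := eqVneq (c w) 0.
    by apply: Deg_ext (Deg0 F E k) => x; rewrite mul0r.
  apply/DegZ/Deg_sum => w0 /and3P[Ew0 pw0 /eqP e]; apply: Deg_ind => //.
  by move: dw; rewrite -e !dim_join_line.
move=> z Ez pz; rewrite cE; apply: eq_bigr => w _.
have [->|/cP/andP[Ew _]] := eqVneq (c w) 0; first by rewrite !mul0r.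
by rewrite sum_compl_le // Ez mul1r.
Qed.

(* The value at z outside P is [R <= z] u(z + P) - u(z + P) / q; subtracting   *)
(* the average over the q atoms R of Q other than P makes it vanish on P <= z  *)
(* without raising the degree.                                                 *)
Definition lift_part p R u z : F :=
  (p \notin z)%:R * ([le R, z] - Q^-1) * u (join_line z p).

(** Replace each w by its complements of p above R, minus 1/q times those above E. If p is in z, the
    two counts have ratio q and cancel; otherwise [sum_compl_le] gives the value. *)
Lemma Deg_lift_part E p R k u : p \notin E -> p \notin R -> lev E 1 R ->
  Deg (join_line R p) k u ->
  exists2 h, Deg E k.+1 h & forall z, (E <= z)%VS -> h z = lift_part p R u z.
Proof.
move=> pE pR /andP[ER /eqP dR] [c cP cE].
pose S V x w : F := \sum_(w0 : sp | [&& (V <= w0)%VS, p \notin w0 & join_line w0 p == w]) [le w0, x].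
exists (fun x => \sum_w c w * (S R x w + (- Q^-1) * S E x w)).
  apply: Deg_sum => w _; have [->|/cP/andP[Ew dw]] := eqVneq (c w) 0.
    by apply: Deg_ext (Deg0 F E k.+1) => x; rewrite mul0r.
  apply/DegZ/DegD; last apply: DegZ; apply: Deg_sum => w0 /and3P[Ew0 pw0 /eqP e];
    apply: Deg_ind => //; rewrite ?(subv_trans ER Ew0) //.
    by move: dw; rewrite -e !dim_join_line // dR addn1 !addSn !addnS.
  by move: dw; rewrite -e !dim_join_line // dR addn1 !addSn !addnS.
move=> z Ez; rewrite /lift_part; have [pz|pz] := boolP (p \in z); last first.
  rewrite mul1r cE big_distrr; apply: eq_bigr => w _ /=.
  have [->|/cP/andP[Rw _]] := eqVneq (c w) 0; first by rewrite !mul0r mulr0.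
  rewrite /S !sum_compl_le //; last by apply: subv_trans Rw; apply: join_lineS.
  by rewrite Ez mul1r; set a := [le R, z]; set b := [le w, _]; set t := Q^-1; ring.
rewrite !mul0r big1 // => w _.
have [->|/cP/andP[Rw _]] := eqVneq (c w) 0; first by rewrite !mul0r.
have key V : p \notin V -> (join_line V p <= w)%VS ->
    S V z w = [le w, z] * Q ^+ (\dim w - (\dim V).+1).
  move=> pV Vw; have /andP[Vw1 pw] : (V <= w)%VS && (p \in w) by rewrite -join_line_sub.
  rewrite /S (eq_bigr (fun=> [le w, z])) => [|w0 /and3P[_ _ /eqP <-]]; last first.
    by rewrite join_line_sub pz andbT.
  rewrite (eq_bigl (mem (compl_in V p w))) => [|w0]; last by rewrite !inE.
  by rewrite sumr_const card_compl_in // -[LHS]mulr_natr natrX.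
have pE' : (join_line E p <= w)%VS by apply: subv_trans Rw; apply: join_lineS.
rewrite (key R) // (key E) // dR addn1.
have dw : ((\dim E).+1 < \dim w)%N.
  by have := dimvS Rw; rewrite dim_join_line // dR addn1.
have -> : (\dim w - (\dim E).+1 = (\dim w - (\dim E).+2).+1)%N by dim_lia.
by rewrite exprS (mulrCA _ Q) mulNr mulKf // subrr mulr0.
Qed.

End Branching.
(** * Injectivity on top degree parts *)

Section GradedInjectivity.
Variables (K : finFieldType) (n : nat) (F : fieldType).
Local Notation sp := (subspaces K n).
Local Notation q := #|K|.
Local Notation Q := (q%:R : F).
Hypothesis Q0 : Q != 0.
Implicit Types (x y z w E P R V U : sp) (p r : 'rV[K]_n) (u v f g h c : sp -> F) (k j : nat).
Local Notation "[ 'le' z , x ]" := ((z <= x)%VS)%:R (format "[ 'le'  z ,  x ]").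

(** Read modulo polynomials of degree less than k, this is injectivity of the inclusion map from
    level k to level j in the lattice above E. *)
Definition gr_inj_at E := forall k j v, (k <= j)%N -> (\dim E + j + k <= n)%N ->
  low_sum E k j v -> low_on E k v.

Lemma gr_inj_0 E j v : (\dim E + j <= n)%N -> low_sum E 0 j v -> low_on E 0 v.
Proof.
move=> dE [g [c cP gE] h]; exists (fun=> 0); first exact: Deg0.
move=> z; rewrite lev0 => /eqP ->; have [x lx] := ex_lev dE.
have := h x lx; rewrite gE [RHS]big1 => [|w _]; last first.
  by have [->|/cP/andP[/dimvS]] := eqVneq (c w) 0; [rewrite mul0r | dim_lia].
rewrite (eq_bigl (pred1 E)) => [|w]; last exact: lev0.
by rewrite big_pred1_eq; have /andP[-> _] := lx; rewrite mulr1.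
Qed.

Lemma gr_inj_diag E k v : low_sum E k k v -> low_on E k v.
Proof.
move=> [g gd h]; exists g => // x lx; rewrite -(h x lx) (bigD1 x) //= subvv mulr1.
rewrite big1 ?addr0 // => z /andP[/andP[_ /eqP dz] zx].
case le: (z <= x)%VS; last by rewrite mulr0.
case/eqP: zx; apply: sub_eq_dim => //; have /andP[_ /eqP ->] := lx.
by rewrite dz.
Qed.

Section Step.
Variables (E : sp) (p : 'rV[K]_n) (k j : nat).
Hypothesis pE : p \notin E.
Local Notation P := (join_line E p).
Hypothesis kj : (k < j)%N.
Hypothesis dim_ok : (\dim E + j.+1 + k.+1 <= n)%N.
Hypothesis IH : forall E', (\dim E < \dim E')%N -> gr_inj_at E'.

Let dP : \dim P = (\dim E).+1. Proof. exact: dim_join_line. Qed.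

Lemma sum_split (G : sp -> F) d :
  \sum_(z | lev E d.+1 z) G z =
  \sum_(z | lev P d z) G z + \sum_(z | lev E d.+1 z && (p \notin z)) G z.
Proof.
rewrite (bigID (fun z => p \in z)) /=; congr (_ + _); apply: eq_bigl => z.
by rewrite lev_joinE.
Qed.

Lemma le_join z x : p \in x -> (z <= x)%VS = (join_line z p <= x)%VS.
Proof. by move=> px; rewrite join_line_sub px andbT. Qed.

(** On the x through p, the z through p contribute only degree k over E + <p>, so the remaining z
    give the hypothesis for [push] there. Induction makes [push] a polynomial; pulling it back and
    dividing by the fibre size q^(k+1) gives [u]. *)
Lemma step_push v : low_sum E k.+1 j.+1 v ->
  exists2 u, low_on E k.+1 u & forall w, push E k.+1 p v w = push E k.+1 p u w.
Proof.
move=> [g [c cP gE] h].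
have : low_sum P k.+1 j (push E k.+1 p v).
  exists (fun x => \sum_z c z * [le join_line z p, x] +
                   (-1) * \sum_(z | lev P k z) v z * [le z, x]).
    apply: DegD; [|apply: DegZ].
      apply: (@Deg_comb _ _ _ _ _ xpredT c (fun z => join_line z p)) => z _ /cP/andP[Ez dz].
      by rewrite join_lineS // dP; have := dim_join_le z p; dim_lia.
    apply: (@Deg_comb _ _ _ _ _ (lev P k) v id) => z /andP[Pz /eqP dz] _.
    by rewrite Pz dz addnS ltnS leqnn.
  move=> x; rewrite lev_joinE // => /andP[lx px].
  under [X in X + _]eq_bigr => z _ do rewrite -le_join //.
  rewrite -gE -h // sum_split mulN1r addrAC subrr add0r -(sum_push _ _ (fun w => [le w, x])) //.
  by apply: eq_bigr => z _; rewrite -le_join.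
case/IH => [|||u0 u0d u0E]; [by rewrite dP|by []|by rewrite dP; dim_lia|].
have [h0 h0d h0E] := Deg_push pE u0d.
exists (fun z => Q ^- k.+1 * h0 z); first by apply: low_onZ; exists h0.
move=> w; rewrite /push; have [lw|lw] := boolP (lev P k.+1 w); last first.
  by rewrite !big1 // => z /andP[/andP[lz pz] /eqP e]; case/negP: lw; rewrite -e lev_join.
rewrite -/(push E k.+1 p v w) u0E //.
rewrite (eq_bigr (fun z => Q ^- k.+1 * u0 w * [le E, z])) => [|z]; last first.
  by move=> /andP[/andP[/andP[Ez _] pz] /eqP <-]; rewrite h0E // Ez mulr1.
rewrite -big_distrr /= sum_fiber ?subvv // pE.
have /andP[-> /eqP ->] := lw.
have -> : (\dim P + k.+1 - (\dim E).+1 = k.+1)%N by rewrite dP; dim_lia.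
by rewrite !mul1r mulrAC mulVf ?mul1r // expf_neq0.
Qed.

Definition push0 v := forall w, push E k.+1 p v w = 0.

Lemma push0_sum v (G : sp -> F) : push0 v ->
  \sum_(z | lev E k.+1 z && (p \notin z)) v z * G (join_line z p) = 0.
Proof. by move=> v0; rewrite sum_push // big1 // => w _; rewrite v0 mul0r. Qed.

(** Over E + <p> the polynomial g can have degree k, one too many for induction at level k. Its top
    part is [push] of c, which is first shown to agree with a polynomial of lower degree. *)
Lemma step_inner v : push0 v -> low_sum E k.+1 j.+1 v ->
  exists2 u, low_on E k.+1 u &
    forall z, lev E k.+1 z -> u z = if p \in z then v z else 0.
Proof.
move=> v0 [g [c cP gE] h].
(* Sum over the x that avoid p and satisfy x + <p> = y. The side of v vanishes by [push0]; what is
   left is a relation among the coefficients of g, whose terms of level k form [push] of c. *)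
have goodc : low_on P k (push E k p c).
  apply: (IH _ (j := j.+1)) => [|||]; [by rewrite dP|by dim_lia|by rewrite dP; dim_lia|].
  exists (fun y => \sum_(z | ~~ lev E k z && (p \notin z))
      (- c z * Q ^+ (\dim E + j.+2 - (\dim z).+1) / Q ^+ (j.+1 - k)) * [le join_line z p, y]).
    apply: Deg_comb => z /andP[lz pz]; rewrite !mulf_eq0 oppr_eq0 !negb_or.
    move=> /andP[/andP[/cP/andP[Ez dz] _] _]; rewrite join_lineS // dim_join_line // dP.
    by move: lz; rewrite /lev Ez /=; dim_lia.
  move=> y ly; have dy : \dim y = (\dim E + j.+2)%N.
    by have /andP[_ /eqP ->] := ly; rewrite dP; dim_lia.
  pose fib (f : sp -> F) := \sum_(x | lev E j.+1 x && (p \notin x) && (join_line x p == y)) f x.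
  have e1 : fib (fun x => \sum_(z | lev E k.+1 z) v z * [le z, x]) = 0.
    rewrite /fib exchange_big /=.
    rewrite (eq_bigr (fun z => (p \notin z)%:R * (v z * [le join_line z p, y] * Q ^+ (j - k)))) => [|z].
      rewrite (bigID (fun z => p \notin z)) /= [X in _ + X]big1 => [|z /andP[_ /negPf ->]].
        rewrite addr0 -[RHS](mul0r (Q ^+ (j - k))) -[X in _ = X * _](push0_sum (fun w => [le w, y]) v0).
        by rewrite big_distrl /=; apply: eq_bigr => z /andP[_ ->] /=; rewrite mul1r.
      by rewrite mul0r.
    move=> /andP[Ez /eqP dz]; rewrite -big_distrr /= sum_fiber // dy dz.
    have -> : (\dim E + j.+2 - (\dim E + k.+1).+1 = j - k)%N by dim_lia.
    by rewrite !mulrA [v z * _]mulrC.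
  have : fib g = 0 by rewrite -e1 /fib; apply: eq_bigr => x /andP[/andP[lx _] _]; rewrite h.
  rewrite /fib; under eq_bigr => x _ do rewrite gE.
  rewrite exchange_big /= => e2.
  rewrite -(sum_push _ _ (fun w => [le w, y])) //.
  have Qjk : Q ^+ (j.+1 - k) != 0 by rewrite expf_neq0.
  apply: (mulIf Qjk); apply/eqP; rewrite -subr_eq0; apply/eqP; rewrite -[RHS]e2.
  rewrite -mulNr -sumrN !big_distrl /= [RHS](bigID (fun z => p \notin z)) /=.
  rewrite [X in _ = _ + X]big1 => [|z]; last first.
    rewrite negbK => pz; have [->|/cP/andP[Ez _]] := eqVneq (c z) 0.
      by rewrite big1 // => x _; rewrite mul0r.
    by rewrite -big_distrr /= sum_fiber // pz !mul0r mulr0.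
  rewrite addr0 [RHS](bigID (lev E k)) /=; congr (_ + _).
    apply: eq_big => [z|z /andP[lz pz]]; first by rewrite andbC.
    have /andP[Ez /eqP dz] := lz; rewrite -big_distrr /= sum_fiber // dy dz pz mul1r mulrA.
    by congr (_ * _ ^+ _); dim_lia.
  apply: eq_big => [z|z /andP[lz pz]]; first by rewrite andbC.
  have [->|/cP/andP[Ez _]] := eqVneq (c z) 0.
    by rewrite oppr0 !mul0r oppr0 mul0r big1 // => x _; rewrite mul0r.
  rewrite -big_distrr /= sum_fiber // dy pz mul1r !mulNr opprK.
  by rewrite mulrAC divfK // mulrAC mulrA.
(* On the x through p only the z through p survive, and their sum differs from that of [push] of c
   by the lower terms of g. *)
have goodv : low_on P k v.
  have : low_on P k (fun w => v w + (-1) * push E k p c w).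
    apply: (IH _ (j := j)) => [|||]; [by rewrite dP|by dim_lia|by rewrite dP; dim_lia|].
    exists (fun x => \sum_(z | ~~ (lev E k z && (p \notin z))) c z * [le join_line z p, x]).
      apply: Deg_comb => z lz /cP/andP[Ez dz]; rewrite join_lineS // dP.
      have [pz|pz] := boolP (p \in z); first by rewrite join_line_id //; dim_lia.
      by rewrite dim_join_line //; move: lz; rewrite /lev Ez pz /= andbT; dim_lia.
    move=> x; rewrite lev_joinE // => /andP[lx px].
    under eq_bigr => z _ do rewrite mulrDl -mulrA mulN1r.
    rewrite sumrB -(sum_push _ _ (fun w => [le w, x])) //.
    have := h x lx; rewrite sum_split.
    under [X in _ + X]eq_bigr => z _ do rewrite le_join //.
    rewrite (push0_sum (fun w => [le w, x])) // addr0 => ->; rewrite gE.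
    under eq_bigr => z _ do rewrite le_join //.
    by rewrite (bigID (fun z => lev E k z && (p \notin z))) /= addrC addrK.
  move=> /low_onD/(_ goodc) [f fd fE]; exists f => // z lz.
  by rewrite -fE // mulN1r subrK.
case: goodv => f fd fE; exists f; first by exists f => //; apply: Deg_join fd.
move=> z lz; have [pz|pz] := boolP (p \in z); first by rewrite fE // lev_joinE // lz.
by apply: Deg_out fd _; rewrite join_line_sub (negPf pz) andbF.
Qed.

Definition atom R := lev E 1 R && (p \notin R).
Definition push_at R v w : F :=
  \sum_(z | lev E k.+1 z && (R <= z)%VS && (p \notin z) && (join_line z p == w)) v z.

Lemma push_at_out R v w : ~~ (join_line R p <= w)%VS -> push_at R v w = 0.
Proof.
move=> Rw; rewrite /push_at big_pred0 // => z; apply/negP.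
by move=> /andP[/andP[/andP[_ Rz] _] /eqP e]; rewrite -e join_lineS in Rw.
Qed.

Lemma sum_push_at v w (A : pred sp) (G : sp -> F) :
  \sum_(R | A R) G R * push_at R v w =
  \sum_(z | lev E k.+1 z && (p \notin z) && (join_line z p == w))
     v z * \sum_(R | A R) G R * [le R, z].
Proof.
rewrite /push_at; under eq_bigr do rewrite big_distrr /=.
rewrite (exchange_big_dep (fun z => lev E k.+1 z && (p \notin z) && (join_line z p == w))) /=.
  apply: eq_bigr => z /andP[/andP[lz pz] ew].
  rewrite big_distrr big_mkcondr /=; apply: eq_bigr => V _.
  rewrite lz pz ew !andbT; case: (V <= z)%VS; last by rewrite !mulr0.
  by rewrite mulr1 mulrC.
by move=> V z _ /andP[/andP[/andP[-> _] ->] ->].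
Qed.

Lemma card_atoms z d : (E <= z)%VS -> p \notin z -> \dim z = (\dim E + d)%N ->
  \sum_(R | atom R) ([le R, z] : F) = qnum F q d.
Proof.
move=> Ez pz dz; rewrite sum_ind -gauss1 (_ : d = (\dim z - \dim E)%N); last by dim_lia.
rewrite -card_interval //; congr (_%:R); apply: eq_card => R.
rewrite !inE /atom /lev; have [Rz|_] := boolP (R <= z)%VS; last by rewrite !andbF.
by rewrite !andbT (contra (subvP Rz p) pz) andbT.
Qed.

Lemma sum_push_at0 v w : push0 v ->
  \sum_(R | atom R) push_at R v w = 0.
Proof.
move=> v0; have := sum_push_at v w atom (fun=> 1).
under eq_bigr do rewrite mul1r; move=> ->.
rewrite (eq_bigr (fun z => v z * qnum F q k.+1)) => [|z].
  by rewrite -big_distrl /= -/(push E k.+1 p v w) v0 mul0r.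
move=> /andP[/andP[/andP[Ez /eqP dz] pz] _]; under eq_bigr do rewrite mul1r.
by rewrite (@card_atoms z k.+1).
Qed.

(* Two distinct complements of P in z + P meet in a hyperplane of z.           *)
Lemma push_at_inv v z : push0 v -> lev E k.+1 z -> p \notin z ->
  \sum_(R | atom R) [le R, z] * push_at R v (join_line z p) = Q ^+ k * v z.
Proof.
move=> v0 lz pz; rewrite sum_push_at.
have /andP[Ez /eqP dz] := lz.
have e z' : lev E k.+1 z' -> p \notin z' -> join_line z' p = join_line z p ->
    \sum_(R | atom R) [le R, z] * [le R, z'] = qnum F q k + (z' == z)%:R * Q ^+ k.
  move=> /andP[Ez' /eqP dz'] pz' ew; under eq_bigr do rewrite -natrM mulnb -subv_cap.
  have [e|ne] := eqVneq z' z; first by rewrite e capvv (@card_atoms z k.+1) // qnumSr mul1r.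
  rewrite mul0r addr0 (@card_atoms _ k) ?subv_cap ?Ez ?Ez' //.
    by rewrite memv_cap negb_and pz.
  have d1 : (\dim (z + z')%VS <= (\dim z).+1)%N.
    rewrite -(dim_join_line pz); apply: dimvS.
    by rewrite subv_add sub_join_line -ew sub_join_line.
  have d2 : (\dim z < \dim (z + z')%VS)%N.
    rewrite ltn_neqAle dimvS ?addvSl // andbT; apply: contra ne => /eqP d.
    have := sub_eq_dim (addvSl z z'); rewrite -d => /(_ (leqnn _)) zz.
    by apply/eqP/sub_eq_dim; [rewrite zz addvSr | rewrite dz dz'].
  by have := dimv_sum_cap z z'; dim_lia.
rewrite (eq_bigr (fun z' => v z' * qnum F q k + (z' == z)%:R * (v z' * Q ^+ k))) => [|z'].
  rewrite big_split /= -big_distrl /= -/(push E k.+1 p v _) v0 mul0r add0r.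
  rewrite (bigD1 z) /= ?lz ?pz ?eqxx // mul1r big1 ?addr0 1?mulrC //.
  by move=> z' /andP[_ /negPf ->]; rewrite mul0r.
by move=> /andP[/andP[lz' pz'] /eqP ew]; rewrite e //; ring.
Qed.

Lemma sum_atoms_of R z : atom R -> p \notin z -> (join_line R p <= join_line z p)%VS ->
  (E <= z)%VS -> \sum_(R' | atom R' && (join_line R' p == join_line R p)) ([le R', z] : F) = 1.
Proof.
move=> /andP[lR pR] pz Rz Ez; have ER := proj1 (andP lR).
rewrite (eq_bigl (fun R' => [&& (E <= R')%VS, p \notin R' & join_line R' p == join_line R p])).
  by rewrite sum_compl_le //; [rewrite Rz Ez mulr1 | apply: join_lineS].
move=> R'; rewrite /atom /lev; case: (E <= R')%VS => //=.
case: (boolP (p \in R')) => pR' /=; first by rewrite ?andbF.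
rewrite andbT; have [e|_] := eqVneq (join_line R' p) (join_line R p); last by rewrite andbF.
rewrite andbT; have := dim_join_line pR'; rewrite e dim_join_line // => -[<-].
by case/andP: lR.
Qed.

Lemma card_atoms_of R : atom R ->
  \sum_(R' | atom R' && (join_line R' p == join_line R p)) (1 : F) = Q.
Proof.
move=> aR; have /andP[/andP[ER /eqP dR] pR] := aR.
have := @sum_fiber _ _ F p E 1 (join_line R p) E pE (subvv _).
rewrite pE mul1r join_lineS // mul1r dim_join_line // dR addn1 subSnn expr1 => <-.
  apply: eq_big => [R'|R' /andP[/andP[/andP[-> _] _] _] //].
  by rewrite /atom.
by rewrite /lev join_lineS // !dim_join_line // dR addSn eqxx.
Qed.

(** As x contains R, z <= x means z + R <= x. If R lies in z + <p> but not in z, then p is in z + R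
    and no x qualifies; otherwise z + R is z or has one dimension more, whence the two exponents. *)
Lemma sum_fiber_atom R y z : atom R -> lev (join_line R p) j y -> (E <= z)%VS ->
  \sum_(x | lev R j x && (p \notin x) && (join_line x p == y)) ([le z, x] : F) =
  (p \notin z)%:R * ((R <= z)%VS%:R * [le join_line z p, y] * Q ^+ (\dim E + j.+2 - (\dim z).+1) +
    (~~ (R <= join_line z p)%VS)%:R * [le join_line z p, y] * Q ^+ (\dim E + j.+2 - (\dim z).+2)).
Proof.
move=> /andP[/andP[ER /eqP dR] pR] ly Ez.
have dy : \dim y = (\dim E + j.+2)%N.
  by have /andP[_ /eqP ->] := ly; rewrite dim_join_line // dR addn1 !addSn !addnS.
have [pz|pz] := boolP (p \in z).
  rewrite mul0r big1 // => x /andP[/andP[_ px] _].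
  by case zx: (z <= x)%VS => //; case/negP: px; apply: subvP zx _ pz.
rewrite (eq_bigr (fun x => [le (z + R)%VS, x])) => [|x /andP[/andP[/andP[Rx _] _] _]]; last first.
  by rewrite subv_add Rx andbT.
rewrite sum_fiber ?addvSr // dy mul1r.
have [Rz|/subvPn[r rR rz]] := boolP (R <= z)%VS.
  rewrite (addv_idPl Rz) pz !mul1r.
  by rewrite (subv_trans Rz (sub_join_line z p)) !mul0r addr0.
have rE : r \notin E by apply: contra rz; apply: subvP.
have eR : R = join_line E r.
  by apply/esym/sub_eq_dim; rewrite ?join_line_sub ?ER ?rR // dim_join_line // dR addn1.
have -> : (z + R)%VS = join_line z r.
  apply/eqP; rewrite eqEsubv subv_add sub_join_line join_line_sub addvSl /=.
  by rewrite eR join_lineS //= (subvP (addvSr z _)) // line_in_join.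
rewrite !mul0r add0r.
have -> : (R <= join_line z p)%VS = (r \in join_line z p).
  by rewrite eR join_line_sub (subv_trans Ez) ?sub_join_line.
have [rzp|rzp] := boolP (r \in join_line z p).
  by rewrite (join_line_exch pz rzp rz) line_in_join !mul0r.
have -> : p \notin join_line z r.
  by apply: contra rzp => pzr; rewrite (join_line_exch rz pzr pz) line_in_join.
have ry : r \in y.
  by have /andP[Ry _] := ly; apply: (subvP Ry); apply: (subvP (sub_join_line R p)).
by rewrite join_lineA join_line_sub ry andbT dim_join_line.
Qed.

(** The two parts of the fibre sum of g according to [sum_fiber_atom]. For c of degree at most k,
    [push_low] has degree less than k over R + <p>, while [push_top] depends on R only through R +
    <p>. *)
Definition push_low R c y := \sum_(z : sp | (R <= z)%VS && (p \notin z))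
  c z * Q ^+ (\dim E + j.+2 - (\dim z).+1) * [le join_line z p, y].

Definition push_top R c y := \sum_(z : sp | ~~ (R <= join_line z p)%VS && (p \notin z))
  c z * Q ^+ (\dim E + j.+2 - (\dim z).+2) * [le join_line z p, y].

Lemma Deg_push_low R R' c : atom R -> atom R' -> join_line R' p = join_line R p ->
  (forall z, c z != 0 -> (E <= z)%VS && (\dim z < \dim E + k.+1)%N) ->
  Deg (join_line R p) k (push_low R' c).
Proof.
move=> /andP[/andP[_ /eqP dR] pR] _ e cP; apply: Deg_comb => z /andP[Rz pz].
rewrite mulf_eq0 negb_or => /andP[/cP/andP[_ dz] _].
by rewrite -e join_lineS // e !dim_join_line // dR; dim_lia.
Qed.

Lemma sum_push_at_atoms R v w : push0 v -> atom R -> (join_line R p <= w)%VS ->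
  \sum_(R' | atom R' && (join_line R' p == join_line R p)) push_at R' v w = 0.
Proof.
move=> v0 aR Rw.
have := sum_push_at v w (fun R' => atom R' && (join_line R' p == join_line R p)) (fun=> 1).
under eq_bigr do rewrite mul1r; move=> ->; rewrite -[RHS](v0 w).
apply: eq_bigr => z /andP[/andP[/andP[Ez _] pz] /eqP ew].
by under eq_bigr do rewrite mul1r; rewrite sum_atoms_of // ?mulr1 // ew.
Qed.

(** Both sides evaluate g summed over the x above R that avoid p and satisfy x + <p> = y, once
    through v and once through c. In the former, the z with R outside z + <p> cancel by [push0]. *)
Lemma sum_fiber_push R v g c y : push0 v ->
    (forall z, lev E k.+1 z -> p \in z -> v z = 0) ->
    (forall z, c z != 0 -> (E <= z)%VS && (\dim z < \dim E + k.+1)%N) ->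
    (forall x, g x = \sum_z c z * [le z, x]) ->
    (forall x, lev E j.+1 x -> \sum_(z | lev E k.+1 z) v z * [le z, x] = g x) ->
    atom R -> lev (join_line R p) j y ->
  Q ^+ (j - k) * \sum_(w | lev (join_line R p) k w) push_at R v w * [le w, y] =
  push_low R c y + push_top R c y.
Proof.
move=> v0 vp cP gE h aR ly; have /andP[/andP[ER /eqP dR] pR] := aR.
pose fib (f : sp -> F) := \sum_(x | lev R j x && (p \notin x) && (join_line x p == y)) f x.
have e1 : fib g = push_low R c y + push_top R c y.
  rewrite /fib; under eq_bigr do rewrite gE; rewrite exchange_big /= /push_low /push_top.
  rewrite [X in _ = X + _]big_mkcond [X in _ = _ + X]big_mkcond -big_split; apply: eq_bigr => z _ /=.
  have [->|/cP/andP[Ez dz]] := eqVneq (c z) 0.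
    by rewrite !mul0r !if_same addr0 big1 // => x _; rewrite mul0r.
  rewrite -big_distrr /= sum_fiber_atom //.
  case: (p \notin z); last by rewrite !andbF !mul0r mulr0 addr0.
  rewrite !andbT mul1r mulrDr; congr (_ + _).
    by case: (R <= z)%VS; rewrite ?mul0r ?mulr0 // mul1r mulrAC mulrA.
  by case: (R <= _)%VS; rewrite ?mul0r ?mulr0 // mul1r mulrAC mulrA.
rewrite -e1; have -> : fib g = fib (fun x => \sum_(z | lev E k.+1 z) v z * [le z, x]).
  apply: eq_bigr => x /andP[/andP[/andP[Rx /eqP dx] _] _]; rewrite h //.
  by rewrite /lev (subv_trans ER Rx) dx dR addn1 addSnnS eqxx.
rewrite /fib exchange_big /=.
rewrite [RHS](eq_bigr (fun z => (p \notin z)%:R * (v z * ((R <= z)%VS%:R * [le join_line z p, y] * Q ^+ (j - k))) +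
   (p \notin z)%:R * (v z * ((~~ (R <= join_line z p)%VS)%:R * [le join_line z p, y] * Q ^+ (j - k.+1))))) => [|z lz]; last first.
  have /andP[Ez /eqP dz] := lz; rewrite -big_distrr /= sum_fiber_atom // dz.
  have -> : (\dim E + j.+2 - (\dim E + k.+1).+1 = j - k)%N by dim_lia.
  have -> : (\dim E + j.+2 - (\dim E + k.+1).+2 = j - k.+1)%N by dim_lia.
  by rewrite mulrCA mulrDr mulrDr.
rewrite big_split /= [X in _ = _ + X](_ : _ = 0) ?addr0; last first.
  rewrite -[RHS](push0_sum (fun w => (~~ (R <= w)%VS)%:R * [le w, y] * Q ^+ (j - k.+1)) v0).
  rewrite [RHS]big_mkcondr /=; apply: eq_bigr => z _.
  by case: (p \notin z); rewrite ?mul1r ?mul0r.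
rewrite big_distrr /= [RHS](bigID (fun z => (R <= z)%VS && (p \notin z))) /=.
rewrite [X in _ = _ + X]big1 ?addr0 => [|z /andP[_]]; last first.
  by rewrite negb_and => /orP[]/negPf ->; rewrite !mul0r ?mulr0.
rewrite [RHS](partition_big (fun z => join_line z p) (lev (join_line R p) k)) /=.
  apply: eq_bigr => w _; rewrite /push_at big_distrl big_distrr /=.
  apply: eq_big => [z|z /andP[/andP[/andP[_ Rz] pz] /eqP ew]]; first by rewrite !andbA.
  by rewrite pz Rz ew !mul1r; ring.
move=> z /andP[/andP[Ez /eqP dz] /andP[Rz pz]].
by rewrite /lev join_lineS //= !dim_join_line // dz dR; apply/eqP; dim_lia.
Qed.

(** For each atom R, [push_at R v] lives above R + <p>, where induction applies. From these
    functions [push_at_inv] and [sum_push_at0] recover v as a combination of the [lift_part]. *)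
Lemma step_outer v : push0 v -> (forall z, lev E k.+1 z -> p \in z -> v z = 0) ->
  low_sum E k.+1 j.+1 v -> low_on E k.+1 v.
Proof.
move=> v0 vp [g [c cP gE] h].
pose same R R' := atom R' && (join_line R' p == join_line R p).
have good R : atom R -> low_on (join_line R p) k (push_at R v).
  move=> aR; have /andP[/andP[ER /eqP dR] pR] := aR.
  have dRp : \dim (join_line R p) = (\dim E).+2 by rewrite dim_join_line // dR addn1.
  apply: (IH _ (j := j)) => [|||]; [by rewrite dRp|by dim_lia|by rewrite dRp; dim_lia|].
  exists (fun y => Q ^- (j - k) * (push_low R c y + (- Q^-1) * \sum_(R' | same R R') push_low R' c y)).
    apply/DegZ/DegD; first exact: Deg_push_low.
    by apply/DegZ/Deg_sum => R' /andP[aR' /eqP e]; apply: Deg_push_low.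
  move=> y ly; have Qjk : Q ^+ (j - k) != 0 by rewrite expf_neq0.
  apply: (mulfI Qjk); rewrite mulVKf // (sum_fiber_push v0 vp cP gE h aR ly); congr (_ + _).
  (* Over the q atoms R' with R' + <p> = R + <p>, the [push_at R' v] add up to [push], which
     vanishes. As [push_top] is the same for all of them, it is -1/q times the sum of the
     [push_low]. *)
  apply: (mulfI Q0); rewrite mulrA mulrN mulfV // mulN1r; apply/eqP; rewrite -addr_eq0; apply/eqP.
  have -> : Q * push_top R c y = \sum_(R' | same R R') push_top R' c y.
    rewrite -(card_atoms_of aR) big_distrl /=; apply: eq_bigr => R' /andP[aR' /eqP e].
    rewrite mul1r; apply: eq_bigl => z; congr (~~ _ && _).
    have e' V : (V <= join_line z p)%VS = (join_line V p <= join_line z p)%VS.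
      by rewrite join_line_sub line_in_join andbT.
    by rewrite e' -e -e'.
  rewrite addrC -big_split /= (eq_bigr (fun R' => Q ^+ (j - k) *
     \sum_(w | lev (join_line R p) k w) push_at R' v w * [le w, y])) => [|R' /andP[aR' /eqP e]]; last first.
    by rewrite -e (sum_fiber_push v0 vp cP gE h) // e.
  rewrite -big_distrr exchange_big big1 /= ?mulr0 // => w /andP[Rw _].
  by rewrite -big_distrl /= sum_push_at_atoms // mul0r.
have [u uP] : exists u : sp -> sp -> F, forall R, atom R ->
    Deg (join_line R p) k (u R) /\
    forall w, lev (join_line R p) k w -> push_at R v w = u R w.
  apply: (@fin_all_exists sp (fun=> sp -> F) (fun R u => atom R ->
    Deg (join_line R p) k u /\
    forall w, lev (join_line R p) k w -> push_at R v w = u w)) => R; case aR: (atom R); last by exists (fun=> 0).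
  by have [f fd fE] := good R aR; exists f.
have : low_on E k.+1 (fun z => Q ^- k * \sum_(R | atom R) lift_part p R (u R) z).
  apply/low_onZ/low_on_big => R aR; have [ud _] := uP R aR.
  have /andP[lR pR] := aR.
  by have [f fd fE] := Deg_lift_part Q0 pE pR lR ud; exists f => // z /andP[Ez _]; rewrite fE.
apply: low_on_ext => z lz; have /andP[Ez /eqP dz] := lz.
have Qk : Q ^+ k != 0 by rewrite expf_neq0.
apply: (mulfI Qk); rewrite mulVKf //.
have [pz|pz] := boolP (p \in z).
  by rewrite vp // mulr0 big1 // => R _; rewrite /lift_part pz !mul0r.
have uE R : atom R -> u R (join_line z p) = push_at R v (join_line z p).
  move=> aR; have [ud uE] := uP R aR; have /andP[/andP[_ /eqP dR] pR] := aR.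
  have [Rz|Rz] := boolP (join_line R p <= join_line z p)%VS; last first.
    by rewrite push_at_out // (Deg_out ud).
  by rewrite uE // /lev Rz /= !dim_join_line // dz dR; apply/eqP; dim_lia.
rewrite -(push_at_inv v0 lz pz) /lift_part pz /=.
rewrite (eq_bigr (fun R => [le R, z] * push_at R v (join_line z p) +
   (- Q^-1) * push_at R v (join_line z p))) => [|R aR]; last first.
  by rewrite uE // mul1r mulrDl.
by rewrite big_split /= -big_distrr /= sum_push_at0 // mulr0 addr0.
Qed.

End Step.

(* Branching over an atom P above E. First the sums of v over the complements  *)
(* of P in z + P are made zero, then v is made zero on the z containing P;     *)
(* what remains is a combination over the atoms R other than P of functions on *)
(* the subspaces above P + R, where induction applies.                         *)
Lemma gr_inj E : gr_inj_at E.
Proof.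
move: {2}(n - \dim E)%N (leqnn (n - \dim E)) => N.
elim: N E => [|N IHN] E dE [|k] [|j] v // kj dok hv; try by apply: (@gr_inj_0 E _ v _ hv); dim_lia.
  by dim_lia.
have [e|ne] := eqVneq k j; first by rewrite e in hv *; apply: gr_inj_diag.
have kj' : (k < j)%N by dim_lia.
have [|p pE] := @ex_notin _ _ E; first by dim_lia.
have IH E' : (\dim E < \dim E')%N -> gr_inj_at E'.
  by move=> dE'; apply: IHN; dim_lia.
have [u u_low uv] := step_push pE kj' dok IH hv.
pose v1 z := v z - u z.
have v1_0 : push0 E p k v1.
  move=> w; rewrite /push /v1 sumrB -!/(push _ _ _ _ _).
  by have := uv w; rewrite /push => ->; rewrite subrr.
have hv1 : low_sum E k.+1 j.+1 v1 by apply: low_sum_sub => //; apply: low_on_sum.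
have [u' u'_low u'E] := step_inner pE kj' dok IH v1_0 hv1.
pose v2 z := v1 z - u' z.
have v2_0 : push0 E p k v2.
  move=> w; rewrite -[RHS](v1_0 w); apply: eq_bigr => z /andP[/andP[lz /negPf pz] _].
  by rewrite /v2 u'E // pz subr0.
have v2p z : lev E k.+1 z -> p \in z -> v2 z = 0.
  by move=> lz pz; rewrite /v2 u'E // pz subrr.
have hv2 : low_sum E k.+1 j.+1 v2 by apply: low_sum_sub => //; apply: low_on_sum.
have := low_onD (low_onD (step_outer pE kj' dok IH v2_0 v2p hv2) u'_low) u_low.
by apply: low_on_ext => z _; rewrite /v2 /v1 !subrK.
Qed.

End GradedInjectivity.
(** * Vanishing and nonisotropic elements *)

Section Kernels.
Variables (K : finFieldType) (n : nat) (F : fieldType).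
Local Notation sp := (subspaces K n).
Local Notation q := #|K|.
Local Notation Q := (q%:R : F).
Hypothesis Q0 : Q != 0.
Implicit Types (x y z w E P R V U : sp) (p r : 'rV[K]_n) (u v f g h c : sp -> F) (k j : nat).
Local Notation "[ 'le' z , x ]" := ((z <= x)%VS)%:R (format "[ 'le'  z ,  x ]").

Lemma sum_compl_in E p w z : p \notin E -> (join_line E p <= w)%VS -> p \in z ->
  \sum_(w0 : sp | [&& (E <= w0)%VS, p \notin w0 & join_line w0 p == w]) ([le w0, z] : F)
  = [le w, z] * Q ^+ (\dim w - (\dim E).+1).
Proof.
move=> pE Ew pz; rewrite (eq_bigr (fun=> [le w, z])) => [|w0 /and3P[_ _ /eqP <-]]; last first.
  by rewrite join_line_sub pz andbT.
rewrite (eq_bigl (mem (compl_in E p w))) => [|w0]; last by rewrite !inE.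
by rewrite sumr_const card_compl_in // -[LHS]mulr_natr natrX.
Qed.

(** Add up the vanishing sums over the complements V0 of p in V above E. A z avoiding p is counted
    once if V <= z + <p>; a z above V is counted once for each V0. *)
Lemma sum_push_above E p V v : p \notin E -> (join_line E p <= V)%VS ->
    (forall z, v z != 0 -> (E <= z)%VS) ->
    (forall V0, (E <= V0)%VS -> ((\dim V0).+1 = \dim V)%N -> \sum_(z : sp | (V0 <= z)%VS) v z = 0) ->
  \sum_(z : sp | p \notin z) v z * [le V, join_line z p] =
  - (Q ^+ (\dim V - (\dim E).+1) * \sum_(z : sp | (V <= z)%VS) v z).
Proof.
move=> pE PV vE h; have pV : p \in V by move: PV; rewrite join_line_sub => /andP[].
apply/eqP; rewrite -addr_eq0; apply/eqP.
rewrite -[RHS](_ : \sum_(V0 : sp | [&& (E <= V0)%VS, p \notin V0 & join_line V0 p == V])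
    \sum_z v z * [le V0, z] = 0); last first.
  apply: big1 => V0 /and3P[EV0 pV0 /eqP e]; rewrite -[RHS](h V0) //.
    rewrite [RHS]big_mkcond /=; apply: eq_bigr => z _.
    by case: (V0 <= z)%VS; rewrite ?mulr1 ?mulr0.
  by rewrite -e dim_join_line.
rewrite exchange_big /= [RHS](bigID (fun z => p \notin z)) /=; congr (_ + _).
  apply: eq_bigr => z pz; have [->|/vE Ez] := eqVneq (v z) 0.
    by rewrite mul0r big1 // => V0 _; rewrite mul0r.
  by rewrite -big_distrr /= sum_compl_le // Ez mul1r.
rewrite big_mkcond [RHS]big_mkcond big_distrr /=; apply: eq_bigr => z _.
rewrite negbK; have [pz|pz] := boolP (p \in z); last first.
  case Vz: (V <= z)%VS; last by rewrite mulr0.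
  by rewrite (subvP Vz p pV) in pz.
rewrite -big_distrr /= sum_compl_in //.
by case: (V <= z)%VS; rewrite ?mul1r ?mul0r ?mulr0 // mulrC.
Qed.

(* Kantor: every function on L_D is a polynomial of degree at most n - D.      *)
Lemma kantor E D v :
    (forall z, v z != 0 -> (E <= z)%VS && (\dim z == D)) ->
    (forall V, (E <= V)%VS -> (\dim V + D <= \dim E + n)%N -> \sum_(z : sp | (V <= z)%VS) v z = 0) ->
  forall z, v z = 0.
Proof.
move=> vD vK z; have [N] := ubnP (n - \dim E)%N.
elim: N E D v vD vK z => // N IH E D v vD vK z dE; apply/eqP/negPn/negP => nz.
have /andP[Ez /eqP dz] := vD z nz; have dzn := dim_le z; have dEz := dimvS Ez.
have [eD|neD] := eqVneq (\dim E) D.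
  have eE x : v x != 0 -> x = E.
    by move=> /vD/andP[Ex /eqP dx]; apply/esym/sub_eq_dim; rewrite // dx eD.
  have ez := eE z nz; case/eqP: nz; have <- : \sum_(x : sp | (E <= x)%VS) v x = 0 by apply: vK; rewrite ?leq_add2l -?dz.
  rewrite (bigD1 E) ?subvv //= ez big1 ?addr0 // => x /andP[_ nx].
  by apply/eqP/negPn/negP => /eE ex; rewrite ex eqxx in nx.
have [p pz pE] : exists2 p, p \in z & p \notin E.
  by apply/subvPn; apply/negP=> /dimvS; move/eqP: neD; dim_lia.
have dP := dim_join_line pE.
have NP : (n - \dim (join_line E p) < N)%N by rewrite dP; dim_lia.
pose vP w := \sum_(x : sp | (p \notin x) && (join_line x p == w)) v x.
have vP_sum V : \sum_(w : sp | (V <= w)%VS) vP w = \sum_(x : sp | p \notin x) v x * [le V, join_line x p].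
  rewrite [RHS](partition_big (fun x => join_line x p) xpredT) //= [LHS]big_mkcond /=.
  apply: eq_bigr => w _; case Vw: (V <= w)%VS.
    by apply: eq_bigr => x /andP[_ /eqP ->]; rewrite Vw mulr1.
  by rewrite big1 // => x /andP[_ /eqP ->]; rewrite Vw mulr0.
have vE x : v x != 0 -> (E <= x)%VS by move=> /vD/andP[].
(* The pushed function sits one level higher above E + <p>, and [sum_push_above] gives the vanishing
   needed for induction. *)
have vP0 w : vP w = 0.
  apply: (IH (join_line E p) D.+1) => // {}w.
    move=> /sum_nz[x /andP[px /eqP <-] /vD/andP[Ex /eqP dx]].
    by rewrite join_lineS // dim_join_line // dx eqxx.
  move=> Pw dw; have Ew := subv_trans (sub_join_line E p) Pw.
  rewrite vP_sum (@sum_push_above E p w) //.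
    by rewrite vK ?mulr0 ?oppr0 //; move: dw; rewrite dP; dim_lia.
  by move=> V0 EV0 dV0; apply: vK => //; move: dw; rewrite dP; dim_lia.
(* Now [sum_push_above] is used in reverse: since [vP] is zero, the sums of v vanish also at V
   through p of dimension one more, as induction above E + <p> requires. *)
pose v' x := if p \in x then v x else 0.
case/eqP: nz; have := IH (join_line E p) D v' _ _ z NP; rewrite /v' pz; apply => [x|V PV dV].
  by case: ifP => [px /vD/andP[Ex ->]|]; rewrite ?eqxx // join_line_sub Ex px.
have EV := subv_trans (sub_join_line E p) PV.
rewrite (eq_bigr v) => [|x Vx]; last first.
  by rewrite (subvP Vx) //; move: PV; rewrite join_line_sub => /andP[].
have := @sum_push_above E p V v pE PV vE.
rewrite -vP_sum big1 => [|w _]; last exact: vP0.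
move=> /(_ _)/esym/eqP; rewrite oppr_eq0 mulf_eq0 expf_eq0 (negPf Q0) andbF /=.
move=> e; apply/eqP/e => V0 EV0 dV0; apply: vK => //; move: dV; rewrite dP; dim_lia.
Qed.

(** For E = 0 these are the coefficient functions of elements of [specht]; general E serve the
    induction. *)
Definition kernel_el E k v :=
  (forall z, v z != 0 -> lev E k z) /\
  (forall V, (E <= V)%VS -> (\dim V < \dim E + k)%N -> \sum_(z : sp | (V <= z)%VS) v z = 0).

Definition lift_el E p R u z : F := [le E, z] * lift_part p R u z.

(** Group the z above V by w = z + <p>. If R is not in V + <p>, one q-th of the complements above V
    contain R and the weights cancel. Otherwise the weight is constant on the w above V + <p>, over
    which u sums to zero. *)
Lemma kernel_el_lift E p R k u : p \notin E -> lev E 1 R -> p \notin R ->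
  kernel_el (join_line R p) k u -> kernel_el E k.+1 (lift_el E p R u).
Proof.
move=> pE lR pR [uD uK]; have /andP[ER /eqP dR] := lR.
have dRp : \dim (join_line R p) = (\dim E).+2 by rewrite dim_join_line // dR addn1.
split=> [z|V EV dV].
  rewrite /lift_el /lift_part; case Ez: (E <= z)%VS; last by rewrite mul0r eqxx.
  have [pz|pz] := boolP (p \in z); first by rewrite !mul0r mulr0 eqxx.
  rewrite !mulf_eq0 !negb_or => /andP[_ /andP[_ /uD/andP[_ /eqP]]].
  by rewrite dim_join_line // dRp /lev Ez; move=> e; apply/eqP; dim_lia.
have [pV|pV] := boolP (p \in V).
  rewrite big1 // => z Vz; rewrite /lift_el /lift_part (subvP Vz p pV).
  by rewrite !mul0r mulr0.
pose a : F := if (R <= join_line V p)%VS then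
  ([le R, V] - Q^-1) * Q ^+ (\dim E + k.+2 - (\dim V).+1) else 0.
transitivity (\sum_w u w * ([le join_line V p, w] * a)); last first.
  have [RV|RV] := boolP (R <= join_line V p)%VS; last first.
    by rewrite /a (negPf RV) big1 // => w _; rewrite !mulr0.
  rewrite -[RHS](mul0r a) -[X in X * a](uK (join_line V p)).
  - rewrite big_distrl [RHS]big_mkcond /=; apply: eq_bigr => w _.
    by case: (_ <= w)%VS; rewrite ?mul1r ?mul0r ?mulr0.
  - by rewrite join_line_sub RV line_in_join.
  by rewrite dRp dim_join_line //; dim_lia.
transitivity (\sum_(z : sp | (V <= z)%VS && (p \notin z)) ([le R, z] - Q^-1) * u (join_line z p)).
  rewrite big_mkcondr; apply: eq_bigr => z Vz.
  rewrite /lift_el /lift_part (subv_trans EV Vz) mul1r.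
  by case: (p \in z); rewrite ?mul0r ?mul1r.
rewrite (partition_big (fun z => join_line z p) xpredT) //=; apply: eq_bigr => w _.
have [u0|/uD lw] := eqVneq (u w) 0.
  rewrite u0 mul0r big1 // => z /andP[_ /eqP ->].
  by rewrite u0 mulr0.
have /andP[Rw /eqP dw] := lw; have ERw : (join_line E p <= w)%VS.
  by apply: subv_trans Rw; apply: join_lineS.
have ew x : p \notin x -> join_line x p = w -> \dim x = (\dim E + k.+1)%N.
  by move=> px e; have := dim_join_line px; rewrite e dw dRp; dim_lia.
have lEw : lev (join_line E p) k.+1 w.
  by rewrite /lev ERw dw dRp dim_join_line //; apply/eqP; dim_lia.
pose cnt (A : pred sp) : F := \sum_(x | A x && (p \notin x) && (join_line x p == w)) [le V, x].
have c1 : cnt (lev E k.+1) = [le join_line V p, w] * Q ^+ (\dim E + k.+2 - (\dim V).+1).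
  rewrite /cnt sum_fiber // pV mul1r dw dRp; by congr (_ * _ ^+ _); dim_lia.
have c2 : cnt (lev R k) = [le R, V] * [le join_line V p, w] * Q ^+ (\dim E + k.+2 - (\dim V).+1) +
    (~~ (R <= join_line V p)%VS)%:R * [le join_line V p, w] * Q ^+ (\dim E + k.+2 - (\dim V).+2).
  by rewrite /cnt (@sum_fiber_atom _ _ F E) ?pV ?mul1r // /atom lR.
transitivity (u w * (cnt (lev R k) - Q^-1 * cnt (lev E k.+1))).
  rewrite /cnt [Q^-1 * _]big_distrr /= [X in X - _]big_mkcond [X in _ - X]big_mkcond -sumrB.
  rewrite big_distrr big_mkcond /=; apply: eq_bigr => z _.
  have [pz|pz] := boolP (p \in z); first by rewrite !andbF /= subrr mulr0.
  have [ez|_] := eqVneq (join_line z p) w; last by rewrite !andbF subrr mulr0.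
  rewrite !andbT ez /lev; case Vz: (V <= z)%VS; last by rewrite !mulr0 !if_same subrr mulr0.
  rewrite (subv_trans EV Vz) (ew _ pz ez) eqxx /= mulr1 dR addn1 addSnnS eqxx andbT.
  by rewrite mulrC; case: (R <= z)%VS.
rewrite c1 c2 /a; congr (_ * _).
have [RV|RV] := boolP (R <= join_line V p)%VS.
  by rewrite !mul0r addr0; ring.
have -> : (R <= V)%VS = false by apply/negP=> h; rewrite (subv_trans h (sub_join_line V p)) in RV.
have -> : (\dim E + k.+2 - (\dim V).+1 = (\dim E + k.+2 - (\dim V).+2).+1)%N by dim_lia.
by rewrite !mul0r add0r mul1r mulr0 exprS (mulrCA _ Q) mulKf // subrr.
Qed.

(* The two elements differ in the choice of the atom R of the same Q = P + R.  *)
Lemma kernel_el_nonisotropic E k : (\dim E + k.*2 <= n)%N ->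
  exists u v, [/\ kernel_el E k u, kernel_el E k v & \sum_z u z * v z != 0].
Proof.
elim: k E => [|k IH] E dE.
  have dl : kernel_el E 0 (fun z => (z == E)%:R).
    split=> [z|V EV]; last by have := dimvS EV; dim_lia.
    by rewrite lev0; case: (z == E); rewrite ?eqxx.
  exists (fun z => (z == E)%:R), (fun z => (z == E)%:R); split=> //.
  rewrite (bigD1 E) //= eqxx mulr1 big1 ?addr0 ?oner_eq0 // => z /negPf ->.
  by rewrite mul0r.
have [|p pE] := @ex_notin _ _ E; first by dim_lia.
have [|r rP] := @ex_notin _ _ (join_line E p); first by rewrite dim_join_line //; dim_lia.
have rE : r \notin E by apply: contra rP; apply/subvP/sub_join_line.
have rpP : r + p \notin join_line E p.
  by apply: contra rP => h; rewrite -[r](addrK p) memvB // line_in_join.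
have rpE : r + p \notin E by apply: contra rpP; apply/subvP/sub_join_line.
pose R0 := join_line E r; pose R1 := join_line E (r + p).
have atomP s : s \notin E -> s \notin join_line E p -> atom E p (join_line E s).
  move=> sE sP; rewrite /atom /lev sub_join_line dim_join_line // addn1 eqxx /=.
  by apply: contra sP => h; rewrite (join_line_exch sE h pE) line_in_join.
have /andP[l0 p0] := atomP r rE rP; have /andP[l1 p1] := atomP (r + p) rpE rpP.
have Q01 : join_line R1 p = join_line R0 p.
  apply: sub_eq_dim; last by rewrite !dim_join_line.
  rewrite !join_line_sub line_in_join andbT (subv_trans (sub_join_line E r)) ?sub_join_line //=.
  by rewrite memvD ?line_in_join // (subvP (sub_join_line _ _)) // line_in_join.
have dQ : \dim (join_line R0 p) = (\dim E).+2 by rewrite !dim_join_line.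
have [|u [v [uK vK uv]]] := IH (join_line R0 p); first by rewrite dQ; dim_lia.
exists (lift_el E p R0 u), (lift_el E p R1 v); split; try by apply: kernel_el_lift; rewrite ?Q01.
pose m01 z : F := [le E, z] * (p \notin z)%:R * (([le R0, z] - Q^-1) * ([le R1, z] - Q^-1)).
have -> : \sum_z lift_el E p R0 u z * lift_el E p R1 v z =
    \sum_z m01 z * (u (join_line z p) * v (join_line z p)).
  apply: eq_bigr => z _; rewrite /lift_el /lift_part /m01.
  case: (E <= z)%VS; last by rewrite !mul0r.
  by case: (p \in z); rewrite ?mul0r ?mulr0 ?mul0r // !mul1r mulrACA.
(* No z avoiding p contains both R0 and R1, which makes the factor -q^k / q. With R0 = R1 it would
   be q^k - q^k / q, which is zero when q = 1 in F. *)
suff -> : \sum_z m01 z * (u (join_line z p) * v (join_line z p)) =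
    (- Q ^+ k / Q) * \sum_w u w * v w.
  by rewrite mulf_neq0 // mulf_neq0 ?invr_eq0 // oppr_eq0 expf_neq0.
rewrite (partition_big (fun z => join_line z p) xpredT) //= big_distrr /=.
apply: eq_bigr => w _; under eq_bigr => z /eqP -> do [].
rewrite -big_distrl /=; have [->|u0] := eqVneq (u w) 0; first by rewrite !mul0r !mulr0.
congr (_ * _); have /andP[Qw /eqP dw] := uK.1 w u0.
pose cnt V : F := \sum_(x : sp | [&& (V <= x)%VS, p \notin x & join_line x p == w]) [le x, fullv].
have cntE V : p \notin V -> (join_line V p <= w)%VS -> cnt V = Q ^+ (\dim w - (\dim V).+1).
  by move=> pV Vw; rewrite /cnt sum_compl_in ?memvf // subvf mul1r.
have Ew : (join_line E p <= w)%VS.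
  by apply: subv_trans Qw; apply/join_lineS/sub_join_line.
transitivity (- Q^-1 * cnt R0 - Q^-1 * cnt R1 + Q^-1 * Q^-1 * cnt E).
  rewrite /cnt !big_distrr /= [in RHS]big_mkcond [X in _ - X + _]big_mkcond.
  rewrite [X in _ + X]big_mkcond -sumrB -big_split big_mkcond /=; apply: eq_bigr => z _.
  rewrite /m01 subvf; case: eqP => [_|_]; last by rewrite !andbF subr0 addr0.
  have [pz|pz] := boolP (p \in z); first by rewrite !andbF mulr0 mul0r subr0 addr0.
  rewrite !andbT; case Ez: (E <= z)%VS; last first.
    rewrite !mul0r; have nR s : (join_line E s <= z)%VS = false by rewrite join_line_sub Ez.
    by rewrite !nR subr0 addr0.
  rewrite !mul1r !mulr1; case R0z: (R0 <= z)%VS; case R1z: (R1 <= z)%VS; try by rewrite /=; ring.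
  case/negP: pz; move: R0z R1z; rewrite !join_line_sub Ez /= => rz rpz.
  by rewrite -[p](addKr r) memvD ?memvN.
rewrite !cntE //; last by rewrite Q01.
rewrite dw dQ !dim_join_line //.
have -> : ((\dim E).+2 + k - (\dim E).+2 = k)%N by dim_lia.
have -> : ((\dim E).+2 + k - (\dim E).+1 = k.+1)%N by dim_lia.
by rewrite exprS -mulrA mulKf //; ring.
Qed.

End Kernels.
(** * The incidence map and its transpose *)

Section Operators.
Variables (K : finFieldType) (n : nat) (F : fieldType).
Local Notation sp := (subspaces K n).
Local Notation q := #|K|.
Local Notation Q := (q%:R : F).
Local Notation N := (Ndim K n).
Implicit Types (x y z w E P R U V W : sp) (u v : 'rV[F]_N) (f g h c : sp -> F) (k j r i b : nat).
Local Notation "[ 'le' z , x ]" := ((z <= x)%VS)%:R (format "[ 'le'  z ,  x ]").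

Definition coef v U : F := v 0 (enum_rank U).
Definition vec f : 'rV[F]_N := \row_a f (enum_val a).

Lemma coef_vec f U : coef (vec f) U = f U.
Proof. by rewrite /coef mxE enum_rankK. Qed.

Lemma coefP u v : (forall U, coef u U = coef v U) -> u = v.
Proof. by move=> h; apply/rowP => a; have := h (enum_val a); rewrite /coef enum_valK. Qed.

Lemma coefD u v U : coef (u + v) U = coef u U + coef v U.
Proof. by rewrite /coef mxE. Qed.

Lemma coefZ a v U : coef (a *: v) U = a * coef v U.
Proof. by rewrite /coef mxE. Qed.

Lemma coef0 U : coef 0 U = 0.
Proof. by rewrite /coef mxE. Qed.

Lemma sum_ord_sp (G : sp -> F) : \sum_(a < N) G (enum_val a) = \sum_U G U.
Proof.
rewrite (reindex (@enum_rank sp)) /=; last first.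
  by exists enum_val => a _; rewrite ?enum_rankK ?enum_valK.
by apply: eq_bigr => U _; rewrite enum_rankK.
Qed.

Lemma coef_rel v (s : rel sp) V : coef (v *m rel_mx F s) V = \sum_U coef v U * (s U V)%:R.
Proof.
rewrite /coef mxE -sum_ord_sp; apply: eq_bigr => a _.
by rewrite mxE enum_valK enum_rankK.
Qed.

Lemma tr_rel (s : rel sp) : (rel_mx F s)^T = rel_mx F (fun U V => s V U).
Proof. by apply/matrixP=> a b; rewrite !mxE. Qed.

Definition dot u v : F := (u *m v^T) 0 0.

Lemma dotE u v : dot u v = \sum_U coef u U * coef v U.
Proof.
rewrite /dot mxE -sum_ord_sp; apply: eq_bigr => a _.
by rewrite mxE /coef enum_valK.
Qed.

Lemma dotC u v : dot u v = dot v u.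
Proof. by rewrite !dotE; apply: eq_bigr => U _; rewrite mulrC. Qed.

Lemma dot_adj u v (A : 'M[F]_N) : dot (u *m A) v = dot u (v *m A^T).
Proof. by rewrite /dot trmx_mul trmxK mulmxA. Qed.

Lemma dotDl u v v' : dot (u + v) v' = dot u v' + dot v v'.
Proof. by rewrite /dot mulmxDl mxE. Qed.

Lemma dotZl a u v : dot (a *: u) v = a * dot u v.
Proof. by rewrite /dot -scalemxAl mxE. Qed.

Lemma dotDr u v v' : dot v' (u + v) = dot v' u + dot v' v.
Proof. by rewrite dotC dotDl !(dotC v'). Qed.

Lemma dot0l v : dot 0 v = 0.
Proof. by rewrite /dot mul0mx mxE. Qed.

Lemma dot0r v : dot v 0 = 0.
Proof. by rewrite dotC dot0l. Qed.

Lemma dot_suml (I : Type) (s : seq I) (A : pred I) (f : I -> 'rV_N) v :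
  dot (\sum_(i <- s | A i) f i) v = \sum_(i <- s | A i) dot (f i) v.
Proof. by rewrite /dot mulmx_suml summxE. Qed.

Local Notation Mk := (Mk F K n).
Local Notation d := (incidence F K n).
Local Notation shadow := (shadow F K n).
Local Notation specht := (specht F K n).

Definition homog k v := v *m Mk k = v.

Lemma coef_Mk v k V : coef (v *m Mk k) V = coef v V * (\dim V == k)%:R.
Proof.
rewrite coef_rel (bigD1 V) //= eqxx big1 ?addr0 // => U /negPf nU.
by rewrite eq_sym nU mulr0.
Qed.

Lemma homogP k v : homog k v <-> forall U, coef v U != 0 -> \dim U = k.
Proof.
split=> [h U|h].
  by rewrite -h coef_Mk; have [//|_] := eqVneq (\dim U) k; rewrite mulr0 eqxx.
apply: coefP => U; rewrite coef_Mk; have [->|/h ->] := eqVneq (coef v U) 0.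
  by rewrite mul0r.
by rewrite eqxx mulr1.
Qed.

Lemma homog_out k v U : homog k v -> \dim U != k -> coef v U = 0.
Proof. by move=> /homogP h ne; apply/eqP; apply: contraNT ne => /h ->. Qed.

Lemma sub_Mk k v : (v <= Mk k)%MS = (v *m Mk k == v).
Proof.
apply/idP/eqP => [/submxP[D ->]|<-]; last exact: submxMl.
rewrite -mulmxA; congr (_ *m _); apply/row_matrixP => a; rewrite row_mul.
apply: coefP => U; rewrite coef_Mk /coef !mxE enum_rankK.
have [->|_] := eqVneq U (enum_val a); last by rewrite mul0r.
by case: (_ == k); rewrite ?mulr1 ?mulr0.
Qed.

Lemma homogE k v : homog k v <-> (v <= Mk k)%MS.
Proof. by rewrite sub_Mk; split=> [/eqP|/eqP]. Qed.

Lemma homog0 k : homog k 0. Proof. exact: mul0mx. Qed.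
Lemma homogD k u v : homog k u -> homog k v -> homog k (u + v).
Proof. by move=> hu hv; rewrite /homog mulmxDl hu hv. Qed.
Lemma homogZ k a v : homog k v -> homog k (a *: v).
Proof. by move=> hv; rewrite /homog -scalemxAl hv. Qed.
Lemma homogB k u v : homog k u -> homog k v -> homog k (u - v).
Proof. by move=> hu hv; rewrite /homog mulmxBl hu hv. Qed.
Lemma coef_shadow j v r V : homog j v ->
  coef (v *m shadow r) V = (\dim V == r)%:R * \sum_(U : sp | (V <= U)%VS) coef v U.
Proof.
move=> hv; rewrite coef_rel big_distrr [RHS]big_mkcond /=; apply: eq_bigr => U _.
by case: (V <= U)%VS; case: (_ == r); rewrite ?mulr1 ?mulr0 ?mul1r ?mul0r.
Qed.

Lemma homog_shadow v r : homog r (v *m shadow r).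
Proof.
apply/homogP => V; rewrite coef_rel; apply: contraNeq => /negPf ne.
by rewrite big1 // => U _; rewrite ne andbF mulr0.
Qed.

Lemma homog_d k v : homog k.+1 v -> homog k (v *m d).
Proof.
move=> hv; apply/homogP => V; rewrite coef_rel => /sum_nz[U _].
rewrite mulf_eq0 negb_or => /andP[/((homogP _ _).1 hv) ->].
by case: andP => [[_ /eqP[->]] //|_]; rewrite eqxx.
Qed.

Lemma homog_d0 v : homog 0 v -> v *m d = 0.
Proof.
move=> hv; apply: coefP => V; rewrite coef0 coef_rel big1 // => U _.
have [->|/((homogP _ _).1 hv) ->] := eqVneq (coef v U) 0; first by rewrite mul0r.
by rewrite andbF mulr0.
Qed.

Lemma homog_e k v : homog k v -> homog k.+1 (v *m d^T).
Proof.
move=> hv; apply/homogP => V; rewrite tr_rel coef_rel => /sum_nz[U _].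
rewrite mulf_eq0 negb_or => /andP[/((homogP _ _).1 hv) <-].
by case: andP => [[_ /eqP ->] //|_]; rewrite eqxx.
Qed.

Lemma mulX v (A : 'M_N) i : v *m A ^+ i.+1 = v *m A ^+ i *m A.
Proof. by rewrite exprSr -mulmxE mulmxA. Qed.

Lemma mulX0 v (A : 'M_N) : v *m A ^+ 0 = v.
Proof. by rewrite expr0 mulmx1. Qed.

Lemma mulXD v (A : 'M_N) i j : v *m A ^+ (i + j) = v *m A ^+ i *m A ^+ j.
Proof. by rewrite exprD -mulmxE mulmxA. Qed.

Lemma homog_dX k i v : homog (k + i) v -> homog k (v *m d ^+ i).
Proof.
elim: i k => [|i IH] k hv; first by rewrite mulX0 -[k]addn0.
by rewrite mulX; apply: homog_d; apply: IH; rewrite addSnnS.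
Qed.

Lemma homog_eX k i v : homog k v -> homog (k + i) (v *m d^T ^+ i).
Proof.
elim: i => [|i IH] hv; first by rewrite mulX0 addn0.
by rewrite mulX addnS; apply/homog_e/IH.
Qed.

Lemma dX_gt k i v : homog k v -> (k < i)%N -> v *m d ^+ i = 0.
Proof.
move=> hv ki; rewrite -(subnKC ki) mulXD mulX homog_d0 ?mul0mx //.
by apply: (@homog_dX 0); rewrite add0n.
Qed.

Lemma trX (A : 'M[F]_N) i : (A ^+ i)^T = A^T ^+ i.
Proof.
elim: i => [|i IH]; first by rewrite !expr0 trmx1.
by rewrite exprS exprSr -!mulmxE trmx_mul IH.
Qed.

(** An r-dimensional V in U lies in [dim U - r] hyperplanes of U. *)
Lemma mul_d_shadow j v r : homog j v -> v *m d *m shadow r = qnum F q (j - r) *: (v *m shadow r).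
Proof.
move=> hv; apply: coefP => V; rewrite coefZ (coef_shadow _ _ hv) coef_rel.
have [eV|_] := eqVneq (\dim V) r; last first.
  by rewrite mul0r mulr0 big1 // => U _; rewrite andbF mulr0.
under eq_bigr => U _ do rewrite andbT coef_rel big_distrl /=.
rewrite exchange_big mul1r big_distrr [RHS]big_mkcond /=; apply: eq_bigr => U _.
under eq_bigr => W _ do rewrite -mulrA -natrM mulnb.
rewrite -big_distrr /=; have [->|/((homogP _ _).1 hv) dU] := eqVneq (coef v U) 0.
  by rewrite mul0r mulr0 if_same.
rewrite sum_ind; have [VU|VU] := boolP (V <= U)%VS; last first.
  rewrite eq_card0 ?mulr0 // => W; rewrite !inE /=; apply: contraNF VU.
  by move=> /andP[/andP[WU _] VW]; apply: subv_trans VW WU.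
rewrite mulrC; congr (_ * _); have := dimvS VU; rewrite eV dU => rj.
have [e|ne] := eqVneq r j.
  rewrite e subnn /qnum big_ord0 eq_card0 // => W; rewrite !inE /=.
  apply/negP => /andP[/andP[_ /eqP dW] VW]; have := dimvS VW; dim_lia.
have -> : (j - r = (j - r).-1.+1)%N by dim_lia.
rewrite -gauss_pred (_ : (j - r).-1.+1 = \dim U - \dim V)%N; last by rewrite eV dU; dim_lia.
rewrite -card_interval //; congr (_%:R); apply: eq_card => W; rewrite !inE /= eV.
by rewrite andbAC [X in X && _]andbC; congr (_ && _); apply/eqP/eqP; dim_lia.
Qed.

(** The falling product [a][a-1]...[a-i+1], a q-factorial when a = i; for i > a it contains the
    factor [0] = 0. *)
Definition qfall a i : F := \prod_(t < i) qnum F q (a - t).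

Lemma mul_dX_shadow j v i r : homog j v ->
  v *m d ^+ i *m shadow r = qfall (j - r) i *: (v *m shadow r).
Proof.
have [ji|ij] := ltnP j i.
  move=> hv; rewrite (dX_gt hv ji) mul0mx; have [rj|jr] := leqP r j.
    by rewrite /qfall (bigD1 (Ordinal (leq_ltn_trans (leq_subr r j) ji))) //= subnn {1}/qnum big_ord0 mul0r scale0r.
  rewrite (_ : v *m shadow r = 0) ?scaler0 //; apply: coefP => V.
  rewrite (coef_shadow _ _ hv) coef0; case: eqP => [dV|_]; rewrite ?mul0r // mul1r.
  rewrite big1 // => U VU; apply: homog_out hv _; have := dimvS VU; rewrite dV.
  by apply: contraTneq => ->; rewrite -ltnNge.
elim: i ij => [|i IH] ij hv; first by rewrite mulX0 /qfall big_ord0 scale1r.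
have hi : homog (j - i) (v *m d ^+ i) by apply: homog_dX; rewrite subnK // ltnW.
rewrite mulX (mul_d_shadow _ hi) IH // 1?ltnW // scalerA /qfall big_ord_recr /= mulrC.
by rewrite subnAC.
Qed.

Lemma shadow_id j v : homog j v -> v *m shadow j = v.
Proof.
move=> hv; apply: coefP => V; rewrite (coef_shadow _ _ hv).
have [e|ne] := eqVneq (\dim V) j; last by rewrite mul0r (homog_out hv).
rewrite mul1r (bigD1 V) //= big1 ?addr0 // => U /andP[VU ne].
apply: homog_out hv _; apply: contraNneq ne => dU.
by apply/eqP/esym/sub_eq_dim; rewrite // dU e.
Qed.

Lemma dX_shadow k i v : homog (k + i) v -> v *m d ^+ i = qfall i i *: (v *m shadow k).
Proof.
move=> hv; rewrite -(shadow_id (homog_dX hv)) (mul_dX_shadow _ _ hv).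
by rewrite addnC addnK.
Qed.

Lemma shadow_shadow j k r v : homog j v -> (r <= k <= j)%N ->
  v *m shadow k *m shadow r = (gauss K (j - r) (k - r))%:R *: (v *m shadow r).
Proof.
move=> hv /andP[rk kj]; apply: coefP => V.
rewrite coefZ (coef_shadow _ _ hv) (coef_shadow _ _ (homog_shadow _ _)).
have [eV|_] := eqVneq (\dim V) r; last by rewrite !mul0r mulr0.
rewrite !mul1r (eq_bigr (fun W => \sum_U coef v U * ((\dim W == k) && (W <= U)%VS)%:R)) => [|W VW]; last first.
  rewrite (coef_shadow _ _ hv) big_distrr [LHS]big_mkcond /=; apply: eq_bigr => U _.
  by case: (W <= U)%VS; case: (_ == k); rewrite ?mulr1 ?mulr0 ?mul1r ?mul0r.
rewrite exchange_big big_distrr [RHS]big_mkcond /=; apply: eq_bigr => U _.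
rewrite -big_distrr /=; have [->|/((homogP _ _).1 hv) dU] := eqVneq (coef v U) 0.
  by rewrite mul0r mulr0 if_same.
rewrite sum_ind; have [VU|VU] := boolP (V <= U)%VS; last first.
  rewrite eq_card0 ?mulr0 // => W; rewrite !inE /=; apply: contraNF VU.
  by move=> /and3P[VW _ WU]; apply: subv_trans VW WU.
rewrite mulrC -dU -eV -card_interval //; congr (_%:R * _); apply: eq_card => W.
rewrite !inE /= subnKC ?eV // -!andbA; congr (_ && _); exact: andbC.
Qed.

Lemma spechtP k v : (v <= specht k)%MS <-> homog k v /\ forall r, (r < k)%N -> v *m shadow r = 0.
Proof.
rewrite sub_capmx; split=> [/andP[hv hr]|[hv hr]].
  split; first exact/homogE.
  move=> r rk; apply/sub_kermxP.
  by move/sub_bigcapmxP: hr => /(_ (Ordinal rk) isT).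
apply/andP; split; first exact/homogE.
by apply/sub_bigcapmxP => -[r rk] _ /=; apply/sub_kermxP/hr.
Qed.

Lemma specht_homog k v : (v <= specht k)%MS -> homog k v.
Proof. by case/spechtP. Qed.

Lemma specht_shadow k v r : (v <= specht k)%MS -> (r < k)%N -> v *m shadow r = 0.
Proof. by case/spechtP => _; apply. Qed.

Lemma specht_sum k v V : (v <= specht k)%MS -> (\dim V < k)%N ->
  \sum_(U : sp | (V <= U)%VS) coef v U = 0.
Proof.
move=> sv dV; have := specht_shadow sv dV; move/(congr1 (coef^~ V)).
by rewrite /= (coef_shadow _ _ (specht_homog sv)) eqxx mul1r coef0.
Qed.

Lemma specht_kernel_el k f : kernel_el (0%VS : sp) k f -> (vec f <= specht k)%MS.
Proof.
move=> [fD fK]; have hf : homog k (vec f).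
  by apply/homogP => U; rewrite coef_vec => /fD/andP[_]; rewrite dimv0 => /eqP.
apply/spechtP; split=> // r rk; apply: coefP => V; rewrite coef0 (coef_shadow _ _ hf).
have [eV|_] := eqVneq (\dim V) r; last by rewrite mul0r.
rewrite mul1r; under eq_bigr do rewrite coef_vec.
by rewrite fK ?sub0v // dimv0 eV.
Qed.

End Operators.

(** * Orthogonal complements of subspaces for the standard form *)

Section OrthogonalComplement.
Variables (K : finFieldType) (n : nat).
Local Notation sp := (subspaces K n).
Implicit Types (U V : sp).

Definition basis_mx U : 'M[K]_(\dim U, n) := \matrix_(i < \dim U) (vbasis U)`_i.

Definition orth U : sp :=
  lker (linfun (mulmxr (basis_mx U)^T : 'rV[K]_n -> 'rV[K]_(\dim U))).

Lemma row_basis_mx U i : row i (basis_mx U) = (vbasis U)`_i.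
Proof. by apply/rowP => a; rewrite !mxE. Qed.

Lemma mem_orth U (v : 'rV[K]_n) :
  reflect (forall u, u \in U -> u *m v^T = 0) (v \in orth U).
Proof.
rewrite memv_ker lfunE /=; apply: (iffP eqP) => [h u uU|h].
  rewrite (coord_vbasis uU) mulmx_suml big1 // => i _.
  rewrite -scalemxAl -row_basis_mx -row_mul -[basis_mx U *m _]trmxK trmx_mul trmxK h.
  by rewrite trmx0 row0 scaler0.
apply: trmx_inj; rewrite trmx_mul trmxK trmx0; apply/row_matrixP => i.
rewrite row_mul row_basis_mx h ?row0 //; apply: vbasis_mem.
by rewrite mem_nth ?size_tuple.
Qed.

Lemma basis_mx_free U : row_free (basis_mx U).
Proof.
rewrite -kermx_eq0; apply/eqP/row_matrixP => i; rewrite row0.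
have h : row i (kermx (basis_mx U)) *m basis_mx U = 0 by rewrite -row_mul mulmx_ker row0.
apply/rowP => a; rewrite [RHS]mxE.
have /freeP/(_ (row i (kermx (basis_mx U)) 0)) := basis_free (vbasisP U); apply.
rewrite -[RHS]h; apply/rowP => b; rewrite summxE mxE; apply: eq_bigr => t _.
by rewrite !mxE.
Qed.

Lemma dim_orth U : \dim (orth U) = (n - \dim U)%N.
Proof.
have := limg_ker_dim (linfun (mulmxr (basis_mx U)^T : 'rV[K]_n -> 'rV[K]_(\dim U))) fullv.
rewrite capfv dimvf dim_matrix mul1r -/(orth U) => h.
suff e : \dim (limg (linfun (mulmxr (basis_mx U)^T : 'rV[K]_n -> 'rV[K]_(\dim U)))) = \dim U.
  by move: h; rewrite e => h; apply: (@addIn (\dim U)); rewrite h subnK ?dim_le.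
have -> : limg (linfun (mulmxr (basis_mx U)^T : 'rV[K]_n -> 'rV[K]_(\dim U))) = fullv.
  apply/eqP; rewrite eqEsubv subvf; apply/subvP => y _.
  have /row_freeP[B' BB'] := basis_mx_free U.
  have -> : y = linfun (mulmxr (basis_mx U)^T : 'rV[K]_n -> 'rV[K]_(\dim U)) (y *m B'^T).
    by rewrite lfunE /= -mulmxA -trmx_mul BB' trmx1 mulmx1.
  exact: memv_img (memvf _).
by rewrite dimvf dim_matrix mul1r.
Qed.

Lemma orthK : involutive orth.
Proof.
move=> U; apply/esym/sub_eq_dim.
  apply/subvP => u uU; apply/mem_orth => v /mem_orth h.
  by apply: trmx_inj; rewrite trmx_mul trmxK trmx0 h.
by rewrite !dim_orth; have := dim_le U; dim_lia.
Qed.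

Lemma orth_sub U V : (orth U <= orth V)%VS = (V <= U)%VS.
Proof.
have half U' V' : (V' <= U')%VS -> (orth U' <= orth V')%VS.
  move=> VU; apply/subvP => v /mem_orth h; apply/mem_orth => u uV.
  by apply: h; apply: subvP VU u uV.
by apply/idP/idP; [move/half; rewrite !orthK | apply: half].
Qed.

End OrthogonalComplement.

(** * The sl2-type relation, and Specht modules under both maps *)

Section Relations.
Variables (K : finFieldType) (n : nat) (F : fieldType).
Local Notation sp := (subspaces K n).
Local Notation q := #|K|.
Local Notation Q := (q%:R : F).
Hypothesis Q0 : Q != 0.
Local Notation N := (Ndim K n).
Implicit Types (x y z w E P R U V W : sp) (u v : 'rV[F]_N) (k j r i b : nat).
Local Notation "[ 'le' z , x ]" := ((z <= x)%VS)%:R (format "[ 'le'  z ,  x ]").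
Local Notation Mk := (Mk F K n).
Local Notation d := (incidence F K n).
Local Notation shadow := (shadow F K n).
Local Notation specht := (specht F K n).
Local Notation qn := (qnum F q).

Lemma row_mxP (A B : 'M[F]_N) : (forall v, v *m A = v *m B) -> A = B.
Proof. by move=> h; apply/row_matrixP => a; rewrite !rowE. Qed.

Lemma homog_Mk v k : homog k (v *m Mk k).
Proof. exact/homogE/submxMl. Qed.

Lemma tr_Mk k : (Mk k)^T = Mk k.
Proof.
rewrite tr_rel; apply/matrixP => a b; rewrite !mxE; congr (nat_of_bool _)%:R.
by rewrite eq_sym; have [->|] := eqVneq.
Qed.

(** On M_k, the power e^(j-k) is a q-factorial times this map ([eX_up]), which keeps its meaning
    when that factor is zero. *)
Definition up k j : 'M[F]_N := (shadow k)^T *m Mk j.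

Lemma coef_up k j v V : homog k v ->
  coef (v *m up k j) V = (\dim V == j)%:R * \sum_(U : sp | (U <= V)%VS) coef v U.
Proof.
move=> hv; rewrite mulmxA coef_Mk mulrC tr_rel coef_rel; congr (_ * _).
rewrite [RHS]big_mkcond /=; apply: eq_bigr => U _.
have [->|/((homogP _ _).1 hv) ->] := eqVneq (coef v U) 0; first by rewrite mul0r if_same.
by rewrite eqxx andbT; case: (U <= V)%VS; rewrite ?mulr1 ?mulr0.
Qed.

Lemma eX_up k b v : homog k v -> v *m d^T ^+ b = qfall K F b b *: (v *m up k (k + b)).
Proof.
move=> hv; have e : Mk (k + b) *m d ^+ b = qfall K F b b *: (Mk (k + b) *m shadow k).
  by apply: row_mxP => u; rewrite -scalemxAr !mulmxA (dX_shadow (homog_Mk u (k + b))).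
rewrite -(homog_eX b hv) -mulmxA -[X in _ *m X]trmxK trmx_mul tr_Mk trX trmxK e.
by rewrite linearZ /= -scalemxAr trmx_mul tr_Mk.
Qed.

Lemma homog_up k j v : homog j (v *m up k j).
Proof. by rewrite mulmxA; apply: homog_Mk. Qed.

(** The diagonal counts the superspaces and the hyperplanes of V. For distinct U and V of dimension
    k, both products give 1 or 0 according to whether U + V has dimension k + 1. *)
Lemma comm_ed k v : (k <= n)%N -> homog k v ->
  v *m d^T *m d = v *m d *m d^T + (qn (n - k) - qn k) *: v.
Proof.
move=> kn hv; apply: coefP => V; rewrite coefD coefZ tr_rel !coef_rel.
have e1 : \sum_U coef (v *m rel_mx F (fun U V0 => (U <= V0)%VS && ((\dim U).+1 == \dim V0))) U *
      ((V <= U)%VS && ((\dim V).+1 == \dim U))%:R =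
    \sum_U coef v U * #|[pred W : sp | [&& (U <= W)%VS, (\dim U).+1 == \dim W, (V <= W)%VS & (\dim V).+1 == \dim W]]|%:R.
  under eq_bigr => W _ do rewrite coef_rel big_distrl /=.
  rewrite exchange_big /=; apply: eq_bigr => U _.
  under eq_bigr => W _ do rewrite -mulrA -natrM mulnb.
  rewrite -big_distrr sum_ind /=; congr (_ * _%:R); apply: eq_card => W.
  by rewrite !inE /= -!andbA.
have e2 : \sum_U coef (v *m d) U * ((U <= V)%VS && ((\dim U).+1 == \dim V))%:R =
    \sum_U coef v U * #|[pred W : sp | [&& (W <= U)%VS, (\dim W).+1 == \dim U, (W <= V)%VS & (\dim W).+1 == \dim V]]|%:R.
  under eq_bigr => W _ do rewrite coef_rel big_distrl /=.
  rewrite exchange_big /=; apply: eq_bigr => U _.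
  under eq_bigr => W _ do rewrite -mulrA -natrM mulnb.
  rewrite -big_distrr sum_ind /=; congr (_ * _%:R); apply: eq_card => W.
  by rewrite !inE /= -!andbA.
rewrite e1 e2 {e1 e2}; apply/eqP; rewrite addrC -subr_eq -sumrB; apply/eqP.
under eq_bigr => U _ do rewrite -mulrBr.
rewrite (bigD1 V) //= big1 => [|U nUV]; rewrite ?addr0.
  have [->|/((homogP _ _).1 hv) dV] := eqVneq (coef v V) 0; first by rewrite mul0r mulr0.
  rewrite mulrC; congr (_ * _); congr (_ - _).
    rewrite -gauss1; have -> : (n - k = \dim (fullv : sp) - \dim V)%N.
      by rewrite dimvf dim_matrix mul1r dV.
    rewrite -card_interval ?subvf //; congr (_%:R); apply: eq_card => W.
    by rewrite !inE subvf andbT addn1 [in RHS]eq_sym; case: (V <= W)%VS => //=; rewrite andbb.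
  case: k dV {hv kn} => [|k] dV.
    rewrite /qnum big_ord0 eq_card0 // => W; rewrite !inE; apply/negP => /and4P[_ /eqP]; dim_lia.
  rewrite -gauss_pred; have -> : (k.+1 = \dim V - \dim (0%VS : sp))%N by rewrite dimv0 dV subn0.
  rewrite -(card_interval k (sub0v V)); congr (_%:R); apply: eq_card => W.
  rewrite !inE sub0v dimv0 dV eqSS add0n.
  by case: (W <= V)%VS => //=; rewrite andbb.
have [->|/((homogP _ _).1 hv) dU] := eqVneq (coef v U) 0; first by rewrite mul0r.
suff -> : #|[pred W : sp | [&& (U <= W)%VS, (\dim U).+1 == \dim W, (V <= W)%VS & (\dim V).+1 == \dim W]]| =
   #|[pred W : sp | [&& (W <= U)%VS, (\dim W).+1 == \dim U, (W <= V)%VS & (\dim W).+1 == \dim V]]|.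
  by rewrite subrr mulr0.
have [dV|ndV] := eqVneq (\dim V) k; last first.
  rewrite !eq_card0 // => W; rewrite !inE; apply: contraNF ndV => /and4P[_ /eqP a _ /eqP b'];
    apply/eqP; dim_lia.
have dUV := dimv_sum_cap U V.
have dUVk : (k < \dim (U + V)%VS)%N.
  rewrite ltn_neqAle -{2}dU dimvS ?addvSl // andbT; apply: contra nUV => /eqP e.
  have eU : U = (U + V)%VS :> sp by apply: sub_eq_dim; rewrite ?addvSl // -e dU.
  have eV : V = (U + V)%VS :> sp by apply: sub_eq_dim; rewrite ?addvSr // -e dV.
  by rewrite [X in X == _]eU [X in _ == X]eV.
have [e|ne] := eqVneq (\dim (U + V)%VS) k.+1.
  rewrite (eq_card (B := pred1 ((U + V)%VS : sp))) => [|W].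
    rewrite card1 (eq_card (B := pred1 ((U :&: V)%VS : sp))) ?card1 // => W.
    rewrite !inE; apply/and4P/eqP => [[WU /eqP w1 WV _]|->].
      by apply: sub_eq_dim; rewrite ?subv_cap ?WU //; dim_lia.
    by rewrite capvSl capvSr; split=> //; apply/eqP; dim_lia.
  rewrite !inE; apply/and4P/eqP => [[UW /eqP w1 VW _]|->].
    by apply/esym/sub_eq_dim; rewrite ?subv_add ?UW //; dim_lia.
  by rewrite addvSl addvSr; split=> //; apply/eqP; dim_lia.
rewrite !eq_card0 // => W; rewrite !inE; apply: contraNF ne.
  move=> /and4P[WU /eqP w1 WV _]; have : (W <= U :&: V)%VS by rewrite subv_cap WU.
  by move/dimvS => h; apply/eqP; dim_lia.
move=> /and4P[UW /eqP w1 VW _]; have : (U + V <= W)%VS by rewrite subv_add UW.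
by move/dimvS => h; apply/eqP; dim_lia.
Qed.

Lemma qnumD a b : qn (a + b) = qn a + Q ^+ a * qn b.
Proof.
elim: b => [|b IH]; first by rewrite addn0 {3}/qnum big_ord0 mulr0 addr0.
by rewrite addnS !qnumSr IH mulrDr -exprD addrA.
Qed.

(** The factor by which d takes y e^(t+1) back to y e^t when y in M_k is killed by d; see [eX_d]. *)
Definition lcoef k t : F := Q ^+ k * qn t.+1 * qn (n - k.*2 - t).

Lemma lcoef_rec k t : (k.*2 + t < n)%N ->
  lcoef k t.+1 = lcoef k t + (qn (n - (k + t.+1)) - qn (k + t.+1)).
Proof.
move=> h; have [M eM] : exists M, (n - k.*2 - t = M.+1)%N.
  by exists (n - k.*2 - t).-1; dim_lia.
have e1 : (n - k.*2 - t.+1 = M)%N by dim_lia.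
have e2 : (n - (k + t.+1) = k + M)%N by dim_lia.
have c : qn t.+1 + Q ^+ t.+1 * qn M = qn M + Q ^+ M * qn t.+1.
  by rewrite -!qnumD addnC.
rewrite /lcoef eM e1 e2 !(qnumD k) (qnumSr K F t.+1) (qnumSr K F M).
move: (qn t.+1) (qn M) (Q ^+ t.+1) (Q ^+ M) c => a b x y c.
have -> : Q ^+ k * (a + x) * b = Q ^+ k * (a * b + (a + x * b) - a) by ring.
by rewrite c; ring.
Qed.

Lemma eX_d k b v : (k.*2 + b <= n)%N -> homog k v -> v *m d = 0 ->
  v *m d^T ^+ b.+1 *m d = lcoef k b *: (v *m d^T ^+ b).
Proof.
move=> h hv vd; elim: b h => [|b IH] h.
  rewrite mulX !mulX0 (comm_ed _ hv); last by dim_lia.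
  rewrite vd mul0mx add0r; congr (_ *: _); rewrite /lcoef subn0.
  have e : (n - k = k + (n - k.*2))%N by dim_lia.
  have q1 : qn 1 = 1 by rewrite qnumS /qnum big_ord0 mulr0 addr0.
  by rewrite e qnumD addrAC subrr add0r q1 mulr1.
have hk : homog (k + b.+1) (v *m d^T ^+ b.+1) by apply: homog_eX.
rewrite mulX (comm_ed _ hk); last by dim_lia.
rewrite IH; last by dim_lia.
by rewrite -scalemxAl -mulX -scalerDl lcoef_rec //; dim_lia.
Qed.

Lemma eX_dX k a c v : (k.*2 + a + c <= n.+1)%N -> homog k v -> v *m d = 0 ->
  v *m d^T ^+ (a + c) *m d ^+ c = (\prod_(t < c) lcoef k (a + t)) *: (v *m d^T ^+ a).
Proof.
move=> h hv vd; elim: c h => [|c IH] h.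
  by rewrite addn0 mulX0 big_ord0 scale1r.
rewrite [d ^+ c.+1]exprS -mulmxE mulmxA addnS (@eX_d k) //; last by dim_lia.
rewrite -scalemxAl IH; last by dim_lia.
by rewrite scalerA big_ord_recr /= mulrC.
Qed.

Lemma specht_d s v : (v <= specht s)%MS -> v *m d = 0.
Proof.
case: s => [|s] /[dup] /specht_homog hv sv; first exact: homog_d0.
rewrite -[d]expr1 (@dX_shadow _ _ _ s 1) ?addn1 //.
by rewrite (specht_shadow sv) ?scaler0.
Qed.

(* A functional killing the image of sigma vanishes in degree j on polynomials *)
(* of degree at most k, so its top coefficient has degree less than k, and     *)
(* pairs to zero with specht k.                                                *)
Lemma specht_lift k j v : (k <= j)%N -> (j + k <= n)%N -> (v <= specht k)%MS ->
  exists u, [/\ homog j u, u *m shadow k = v & forall r, (r < k)%N -> u *m shadow r = 0].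
Proof.
move=> kj jkn sv; have hv := specht_homog sv.
(* [S] records all shadows of dimension at most k at once, so a preimage of v under it has k-shadow
   v and no lower shadows. Membership in the row space is tested on the columns c of the
   cokernel. *)
pose S := rel_mx F (fun U V : sp => [&& (V <= U)%VS, \dim U == j & (\dim V <= k)%N]).
have /submxP[D eD] : (v <= S)%MS.
  rewrite submxE; apply/eqP/rowP => b; rewrite [RHS]mxE.
  pose c (U : sp) : F := cokermx S (enum_rank U) b.
  have cS U : \dim U = j -> \sum_(V : sp | (V <= U)%VS && (\dim V <= k)%N) c V = 0.
    move=> dU; have := mulmx_coker S; move/(congr1 (fun A : 'M_N => A (enum_rank U) b)).
    rewrite [in RHS]mxE mxE => e; rewrite -[RHS]e big_mkcond /= -sum_ord_sp.
    apply: eq_bigr => a _.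
    rewrite mxE enum_rankK dU eqxx /= /c enum_valK.
    by case: ifP => _; rewrite ?mul1r ?mul0r.
  have [||h [a aP aE] hE] := @gr_inj K n F Q0 0%VS k j c kj.
  - by rewrite dimv0 add0n.
  - exists (fun x => \sum_(z : sp | (\dim z < k)%N) (- c z) * [le z, x]).
      by apply: (@Deg_comb _ _ _ _ _ _ _ id) => z dz _; rewrite sub0v dimv0.
    move=> x /andP[_ /eqP]; rewrite dimv0 add0n => dx.
    apply/eqP; rewrite -subr_eq0; apply/eqP; rewrite -[RHS](cS x dx).
    under [X in _ - X]eq_bigr do rewrite mulNr.
    rewrite sumrN opprK [RHS](bigID (fun V => (\dim V == k)%N)) /=; congr (_ + _).
      rewrite big_mkcond [RHS]big_mkcond /=; apply: eq_bigr => z _.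
      rewrite /lev sub0v dimv0 add0n /=; case: eqP => [->|_]; last by rewrite andbF.
      by rewrite leqnn !andbT; case: (z <= x)%VS; rewrite ?mulr1 ?mulr0.
    rewrite big_mkcond [RHS]big_mkcond /=; apply: eq_bigr => z _.
    rewrite -andbA ltn_neqAle [X in _ = if _ && X then _ else _]andbC.
    by case: (z <= x)%VS; rewrite ?mulr1 ?mulr0 ?if_same.
  transitivity (\sum_U coef v U * c U).
    by rewrite mxE -sum_ord_sp; apply: eq_bigr => t _; rewrite /coef /c enum_valK.
  transitivity (\sum_U coef v U * \sum_z a z * [le z, U]).
    apply: eq_bigr => U _; have [->|/((homogP _ _).1 hv) dU] := eqVneq (coef v U) 0.
      by rewrite !mul0r.
    by rewrite hE ?aE // /lev sub0v dimv0 dU add0n eqxx.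
  under eq_bigr do rewrite big_distrr /=.
  rewrite exchange_big big1 //= => z _.
  have [->|/aP/andP[_ dz]] := eqVneq (a z) 0.
    by rewrite big1 // => U _; rewrite mul0r mulr0.
  rewrite -[RHS](mulr0 (a z)) -[X in _ * X](specht_sum sv (V := z)) ?big_distrr ?[RHS]big_mkcond /=.
    by apply: eq_bigr => U _; rewrite mulrCA; case: (z <= U)%VS; rewrite ?mulr1 ?mulr0.
  by move: dz; rewrite dimv0 add0n.
have Sj V : coef v V = \sum_(U : sp | (V <= U)%VS) coef (D *m Mk j) U * (\dim V <= k)%:R.
  rewrite eD coef_rel [RHS]big_mkcond /=; apply: eq_bigr => U _; rewrite coef_Mk.
  by case: (V <= U)%VS; case: (_ == j); case: (_ <= k)%N; rewrite ?mulr1 ?mulr0 ?mul0r.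
have hD : homog j (D *m Mk j) by apply: homog_Mk.
exists (D *m Mk j); split=> // [|r rk]; apply: coefP => V; rewrite (coef_shadow _ _ hD).
  rewrite Sj -big_distrl /= mulrC; have [->|ne] := eqVneq (\dim V) k; first by rewrite leqnn.
  have := homog_out hv ne; rewrite Sj -big_distrl /= => e.
  by rewrite mulr0 e.
rewrite coef0; have [e|_] := eqVneq (\dim V) r; last by rewrite mul0r.
have : coef v V = 0 by apply: homog_out hv _; rewrite e; apply: contraTneq rk => ->; rewrite ltnn.
by rewrite Sj e (ltnW rk) -big_distrl /= mulr1 mul1r.
Qed.

Lemma kantor_mx j v : homog j v -> (forall r, (r + j <= n)%N -> v *m shadow r = 0) -> v = 0.
Proof.
move=> hv h; apply: coefP => U; rewrite coef0.
apply: (@kantor K n F Q0 0%VS j (coef v)) => [z /((homogP _ _).1 hv) ->|V _].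
  by rewrite sub0v eqxx.
rewrite dimv0 add0n => /h/(congr1 (fun u => coef u V)).
by rewrite /= (coef_shadow _ _ hv) eqxx mul1r coef0.
Qed.

(* Moebius inversion on the lattice of subspaces of V.                         *)
Lemma specht_cap_sum k v V T : (v <= specht k)%MS -> (\dim V < k)%N -> (T <= V)%VS ->
  \sum_(z : sp | (z :&: V)%VS == T) coef v z = 0.
Proof.
move=> sv dV; have [M] := ubnP (\dim V - \dim T)%N.
elim: M T => // M IH T dT TV.
have := specht_sum sv (leq_ltn_trans (dimvS TV) dV).
rewrite (bigID (fun z : sp => (z :&: V)%VS == T)) /=.
rewrite [X in _ + X](partition_big (fun z : sp => (z :&: V)%VS : sp)
  (fun T' : sp => [&& (T <= T')%VS, (T' <= V)%VS & T' != T])) /=; last first.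
  by move=> z /andP[Tz ->]; rewrite subv_cap Tz TV capvSr.
rewrite [X in _ + X]big1 ?addr0 => [h|T' /and3P[TT' T'V ne]].
  rewrite -[RHS]h; apply: eq_bigl => z; case: eqP => [<-|]; last by rewrite andbF.
  by rewrite capvSl.
rewrite -[RHS](IH T') //; last first.
  have : (\dim T < \dim T')%N.
    rewrite ltn_neqAle dimvS // andbT; apply: contra ne => /eqP e.
    by apply/eqP/esym/sub_eq_dim; rewrite ?e.
  by have := dimvS T'V; dim_lia.
apply: eq_bigl => z; apply/andP/idP => [[]//|/eqP e]; rewrite e eqxx ne andbT.
by split=> //; move: TT'; rewrite -e subv_cap => /andP[].
Qed.

(** At V, each z is weighted by the number of j-spaces containing z + V, which depends only on the
    intersection of z and V. The z with a given intersection have total coefficient zero by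
    [specht_cap_sum]. *)
Lemma specht_up_shadow k j r v : (v <= specht k)%MS -> (r < k)%N ->
  v *m up k j *m shadow r = 0.
Proof.
move=> sv rk; have hv := specht_homog sv; apply: coefP => V.
rewrite (coef_shadow _ _ (homog_up _ _ _)) coef0.
have [dV|_] := eqVneq (\dim V) r; last by rewrite mul0r.
pose cnt (a : nat) : F := if (a <= j)%N then (gauss K (n - a) (j - a))%:R else 0.
have cntE z : \sum_(U : sp | (V <= U)%VS) (\dim U == j)%:R * [le z, U] = cnt (\dim (z + V)%VS).
  under eq_bigr do rewrite -natrM mulnb; rewrite sum_ind /cnt.
  case: leqP => h; last first.
    rewrite eq_card0 // => U; rewrite !inE; apply/negP => /and3P[VU /eqP dU zU].
    have : (z + V <= U)%VS by rewrite subv_add zU.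
    by move/dimvS; dim_lia.
  have -> : (n - \dim (z + V)%VS = \dim (fullv : sp) - \dim (z + V)%VS)%N.
    by rewrite dimvf dim_matrix mul1r.
  rewrite -card_interval ?subvf //; congr (_%:R); apply: eq_card => U.
  rewrite !inE subvf andbT subnKC // subv_add.
  by case: (V <= U)%VS; case: (z <= U)%VS; rewrite ?andbF ?andbT.
rewrite mul1r; transitivity (\sum_z coef v z * cnt (\dim (z + V)%VS)).
  transitivity (\sum_(U : sp | (V <= U)%VS) \sum_z coef v z * ((\dim U == j)%:R * [le z, U])).
    apply: eq_bigr => U VU; rewrite (coef_up _ _ hv) big_distrr big_mkcond /=.
    by apply: eq_bigr => z _; case: (z <= U)%VS; rewrite ?mulr1 ?mulr0 // mulrC.
  by rewrite exchange_big /=; apply: eq_bigr => z _; rewrite -cntE big_distrr.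
rewrite (partition_big (fun z : sp => (z :&: V)%VS : sp) (fun T => (T <= V)%VS)) /=; last first.
  by move=> z _; apply: capvSr.
apply: big1 => T TV; rewrite (eq_bigr (fun z => coef v z * cnt (k + r - \dim T)%N)) => [|z /eqP e].
  by rewrite -big_distrl /= (specht_cap_sum sv) ?mul0r // dV.
have [->|/((homogP _ _).1 hv) dz] := eqVneq (coef v z) 0; first by rewrite !mul0r.
by congr (_ * cnt _); have := dimv_sum_cap z V; rewrite e dz dV; dim_lia.
Qed.

Lemma specht_up0 k j v : (v <= specht k)%MS -> (n < k + j)%N -> v *m up k j = 0.
Proof.
move=> sv nkj; apply: (@kantor_mx j); first exact: homog_up.
by move=> r rj; apply: specht_up_shadow => //; dim_lia.
Qed.

Lemma specht_eX0 k b v : (v <= specht k)%MS -> (n < k.*2 + b)%N -> v *m d^T ^+ b = 0.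
Proof.
move=> sv h; rewrite (eX_up _ (specht_homog sv)) specht_up0 ?scaler0 //; dim_lia.
Qed.

Lemma specht_eX_shadow k b v r : (v <= specht k)%MS -> (r < k)%N ->
  v *m d^T ^+ b *m shadow r = 0.
Proof.
move=> sv rk; rewrite (eX_up _ (specht_homog sv)) -scalemxAl.
by rewrite specht_up_shadow ?scaler0.
Qed.

End Relations.

(** * Orthogonal complements exchange the incidence map and its transpose *)

Section Duality.
Variables (K : finFieldType) (n : nat) (F : fieldType).
Local Notation sp := (subspaces K n).
Local Notation N := (Ndim K n).
Implicit Types (U V W : sp) (u v : 'rV[F]_N) (k j r i b : nat).
Local Notation d := (incidence F K n).
Local Notation shadow := (shadow F K n).

Definition orth_mx : 'M[F]_N := rel_mx F (fun U V => V == orth U).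

Lemma coef_orth v V : coef (v *m orth_mx) V = coef v (orth V).
Proof.
rewrite coef_rel (bigD1 (orth V)) //= orthK eqxx mulr1 big1 ?addr0 // => U ne.
by case: eqP => [e|]; rewrite ?mulr0 //; rewrite e orthK eqxx in ne.
Qed.

Lemma orth_mxK v : v *m orth_mx *m orth_mx = v.
Proof. by apply: coefP => V; rewrite !coef_orth orthK. Qed.

Lemma homog_orth k v : (k <= n)%N -> homog k v -> homog (n - k) (v *m orth_mx).
Proof.
move=> kn /homogP h; apply/homogP => U; rewrite coef_orth => /h; rewrite dim_orth => <-.
by have := dim_le U; dim_lia.
Qed.

Lemma sum_orth (G : sp -> F) : \sum_U G (orth U) = \sum_U G U.
Proof. by rewrite [RHS](reindex_inj (inv_inj (@orthK K n))). Qed.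

Lemma orth_d v : v *m orth_mx *m d = v *m d^T *m orth_mx.
Proof.
apply: coefP => V; rewrite coef_orth coef_rel tr_rel coef_rel -[RHS]sum_orth.
apply: eq_bigr => U _; rewrite coef_orth orth_sub !dim_orth; congr (_ * (nat_of_bool (_ && _))%:R).
by have := dim_le U; have := dim_le V; move=> hU hV; apply/eqP/eqP; dim_lia.
Qed.

Lemma orth_dX v b : v *m orth_mx *m d ^+ b = v *m d^T ^+ b *m orth_mx.
Proof. by elim: b => [|b IH]; rewrite ?mulX0 // mulX IH orth_d -mulX. Qed.

Lemma orth_eX v b : v *m orth_mx *m d^T ^+ b = v *m d ^+ b *m orth_mx.
Proof. by rewrite -[LHS]orth_mxK -orth_dX orth_mxK. Qed.

End Duality.

(** * Kernels and images of powers of the incidence map *)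

Section Decomposition.
Variables (K : finFieldType) (n : nat) (F : fieldType) (m : nat).
Local Notation sp := (subspaces K n).
Local Notation q := #|K|.
Local Notation Q := (q%:R : F).
Hypothesis Q0 : Q != 0.
Hypothesis qm : is_qchar F q m.
Local Notation N := (Ndim K n).
Implicit Types (U V W : sp) (u v w x y : 'rV[F]_N) (k j r i b s t a : nat).
Local Notation Mk := (Mk F K n).
Local Notation d := (incidence F K n).
Local Notation shadow := (shadow F K n).
Local Notation specht := (specht F K n).
Local Notation qn := (qnum F q).
Local Notation J := (orth_mx K n F).

(** Write a = t m + r. As [t m] = 0, [a] is q^(t m) [r], and [r] is nonzero by minimality of m. *)
Lemma qnum_mod a : (0 < a %% m)%N -> qn a != 0.
Proof.
case: qm => m1 m0 mmin.
have small r : (0 < r < m)%N -> qn r != 0.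
  case: r => [|[|r]] //= rm; first by rewrite qnumS /qnum big_ord0 mulr0 addr0 oner_eq0.
  by apply: contraTneq rm => /mmin; rewrite -leqNgt; apply.
move=> a0; have mult t : qn (t * m) = 0.
  by elim: t => [|t IH]; rewrite ?mul0n ?mulSn ?qnumD ?m0 ?IH ?mulr0 ?addr0 // /qnum big_ord0.
rewrite (divn_eq a m) qnumD mult add0r mulf_neq0 ?expf_neq0 //.
by apply: small; rewrite a0 ltn_pmod //; apply: leq_trans m1.
Qed.

Lemma qnum_small a : (0 < a < m)%N -> qn a != 0.
Proof. by move=> /andP[a0 am]; apply: qnum_mod; rewrite modn_small. Qed.

Lemma qfall_neq0 a i : (i <= a %% m)%N -> qfall K F a i != 0.
Proof.
move=> h; have m0 : (0 < m)%N by case: qm => m1 _ _; apply: leq_trans m1.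
apply/prodf_neq0 => -[t ti] _ /=; apply: qnum_mod.
rewrite [X in (X - t)%N](divn_eq a m) -addnBA; last by apply: leq_trans h; apply: ltnW.
rewrite modnMDl modn_small ?subn_gt0; first exact: leq_trans h.
by apply: leq_ltn_trans (leq_subr _ _) _; apply: ltn_pmod.
Qed.

Lemma lcoef_neq0 k t : (n < k.*2 + m)%N -> (k.*2 + t < n)%N -> lcoef K n F k t != 0.
Proof.
move=> h1 h2; rewrite !mulf_neq0 ?expf_neq0 // qnum_small //; dim_lia.
Qed.

Lemma dX_m j v : homog j v -> v *m d ^+ m = 0.
Proof.
move=> hv; have [jm|mj] := ltnP j m; first exact: dX_gt hv jm.
have hv' : homog (j - m + m) v by rewrite subnK.
rewrite (dX_shadow hv') /qfall; case: qm => m1 m0 _.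
have m_gt0 : (0 < m)%N by apply: leq_trans m1.
by rewrite (bigD1 (Ordinal m_gt0)) //= subn0 m0 mul0r scale0r.
Qed.

(* n - j - (m - i) < t, j - i < t, t <= j and t <= n - j, written without      *)
(* subtraction; Tset lists the numbers n - t for these t, and some above n.    *)
Definition middle j i t := [&& n < t + j + (m - i), j < t + i, t <= j & t + j <= n]%N.

Lemma specht_of_shadow j k v : homog j v -> (k <= j)%N ->
  (forall r, (r < k)%N -> v *m shadow r = 0) -> (v *m shadow k <= specht k)%MS.
Proof.
move=> hv kj h; apply/spechtP; split=> [|r rk]; first exact: homog_shadow.
by rewrite (shadow_shadow hv) ?h ?scaler0 // ltnW.
Qed.

(** The k-shadow of x is in S_k. It is zero if i is at most the residue of j - k modulo m. Otherwise
    it is cancelled by a boundary when level j + m - i leaves room for [specht_lift], and by a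
    multiple of y e^(j-k) when it does not. *)
Lemma kernel_step j i k x : (0 < i < m)%N -> (j.*2 < n + i)%N -> (k <= j)%N -> (k + j <= n)%N ->
    homog j x -> x *m d ^+ i = 0 -> (forall r, (r < k)%N -> x *m shadow r = 0) ->
  exists u y, let x' := x - u *m d ^+ (m - i) - y *m d^T ^+ (j - k) in
    [/\ homog (j + (m - i)) u, (y <= specht k)%MS, ~~ middle j i k -> y = 0,
        x' *m d ^+ i = 0 & forall r, (r <= k)%N -> x' *m shadow r = 0].
Proof.
move=> /andP[i0 im] ji kj kjn hx xi xk; have sp_y := specht_of_shadow hx kj xk.
have x_small : (i <= (j - k) %% m)%N -> x *m shadow k = 0.
  move=> h; have := mul_dX_shadow i k hx; rewrite xi mul0mx => /esym/eqP.
  by rewrite scaler_eq0 (negPf (qfall_neq0 h)) => /eqP.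
have triv : x *m shadow k = 0 -> exists u y, let x' := x - u *m d ^+ (m - i) - y *m d^T ^+ (j - k) in
    [/\ homog (j + (m - i)) u, (y <= specht k)%MS, ~~ middle j i k -> y = 0,
        x' *m d ^+ i = 0 & forall r, (r <= k)%N -> x' *m shadow r = 0].
  move=> x0; exists 0, 0; rewrite !mul0mx !subr0; split; rewrite ?sub0mx //; first exact: homog0.
  by move=> r; rewrite leq_eqVlt => /orP[/eqP ->|/xk].
have [/x_small/triv //|small] := leqP i ((j - k) %% m)%N.
have [hk|hk] := leqP (k + j + (m - i)) n.
  have kj' : (k <= j + (m - i))%N by dim_lia.
  have kjn' : (j + (m - i) + k <= n)%N by dim_lia.
  have [u0 [hu0 u0k u0r]] := specht_lift Q0 kj' kjn' sp_y.
  (* The residue of j - k is less than i, so adding m - i crosses no multiple of m and c is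
     nonzero. *)
  pose c := qfall K F (j + (m - i) - k) (m - i).
  have c0 : c != 0.
    apply: qfall_neq0; have -> : (j + (m - i) - k = (j - k) + (m - i))%N by dim_lia.
    rewrite -modnDml modn_small; last by move: small; move: (_ %% _)%N => a; dim_lia.
    exact: leq_addl.
  exists (c^-1 *: u0), 0; rewrite mul0mx subr0; split=> [||//||r]; rewrite ?sub0mx //.
  - exact: homogZ.
  - rewrite mulmxBl xi -!scalemxAl -mulXD subnK ?(ltnW im) // (dX_m hu0).
    by rewrite scaler0 subr0.
  rewrite mulmxBl -!scalemxAl (mul_dX_shadow _ _ hu0) leq_eqVlt => /orP[/eqP ->|rk].
    by rewrite u0k scalerA mulVf // scale1r subrr.
  by rewrite u0r // xk // !scaler0 subr0.
(* Here k + j + (m - i) > n, so 2j < n + i forces j - k < m. The residue bound then reads j - k < i,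
   and k satisfies [middle]. *)
have jkm : (j - k < m)%N by dim_lia.
rewrite modn_small // in small.
have mid : middle j i k by rewrite /middle; apply/and4P; split; dim_lia.
pose y := x *m shadow k; have yd := specht_d sp_y; have hy := specht_homog sp_y.
have hye : homog (k + (j - k)) (y *m d^T ^+ (j - k)) by apply: homog_eX.
pose P := \prod_(t < j - k) lcoef K n F k t.
have P0 : P != 0.
  by apply/prodf_neq0 => -[t tj] _ /=; apply: lcoef_neq0; dim_lia.
have eyd : y *m d^T ^+ (j - k) *m d ^+ (j - k) = P *: y.
  have := @eX_dX K n F k 0 (j - k) y; rewrite add0n mulX0 addn0 => -> //; dim_lia.
pose c := qfall K F (j - k) (j - k).
have eys : P *: y = c *: (y *m d^T ^+ (j - k) *m shadow k) by rewrite -eyd (dX_shadow hye).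
have ij : i = (j - k + (i - (j - k)).-1.+1)%N by dim_lia.
(* By [eys], this multiple makes the k-shadow of the correction equal to y. *)
exists 0, ((c / P) *: y); rewrite mul0mx subr0; split=> [|||| r].
- exact: homog0.
- exact: scalemx_sub.
- by rewrite mid.
- rewrite mulmxBl xi -!scalemxAl ij mulXD eyd exprS -mulmxE -scalemxAl mulmxA yd mul0mx.
  by rewrite !scaler0 subr0.
rewrite mulmxBl -!scalemxAl leq_eqVlt => /orP[/eqP ->|rk].
  by rewrite mulrC -scalerA -eys scalerA mulVf // scale1r subrr.
by rewrite xk // (specht_eX_shadow _ sp_y) // scaler0 subr0.
Qed.

(** [kernel_step] is applied for k = 0, 1, and so on. Once k exceeds j or n - j the remainder is
    zero, by [shadow_id] or [kantor_mx]. *)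
Lemma kernel_decomp j i x : (0 < i < m)%N -> (j <= n)%N -> (j.*2 < n + i)%N ->
    homog j x -> x *m d ^+ i = 0 ->
  exists u (y : nat -> 'rV[F]_N), [/\ homog (j + (m - i)) u,
    forall t, (y t <= specht t)%MS, forall t, ~~ middle j i t -> y t = 0
    & x = u *m d ^+ (m - i) + \sum_(t < n.+1) y t *m d^T ^+ (j - t)].
Proof.
move=> im jn ji hx xi.
suff gen M k : (n < k + M)%N -> forall x, homog j x -> x *m d ^+ i = 0 ->
    (forall r, (r < k)%N -> x *m shadow r = 0) ->
  exists u (y : nat -> 'rV[F]_N), [/\ homog (j + (m - i)) u,
    forall t, (y t <= specht t)%MS, forall t, ~~ middle j i t -> y t = 0
    & x = u *m d ^+ (m - i) + \sum_(t < n.+1) y t *m d^T ^+ (j - t)].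
  by apply: (gen n.+1 0).
elim: M k => [|M IH] k kM {hx xi}x hx xi xk.
  suff -> : x = 0.
    exists 0, (fun=> 0); split=> [|t||]; rewrite ?sub0mx //; first exact: homog0.
    by rewrite mul0mx add0r big1 // => t _; rewrite mul0mx.
  by apply: (kantor_mx Q0 hx) => r rj; apply: xk; dim_lia.
have [/andP[kj kjn]|nk] := boolP ((k <= j) && (k + j <= n))%N; last first.
  suff -> : x = 0.
    exists 0, (fun=> 0); split=> [|t||]; rewrite ?sub0mx //; first exact: homog0.
    by rewrite mul0mx add0r big1 // => t _; rewrite mul0mx.
  move: nk; rewrite negb_and -!ltnNge => /orP[jk|jk].
    by rewrite -(shadow_id hx) xk.
  by apply: (kantor_mx Q0 hx) => r rj; apply: xk; dim_lia.
have [u0 [y0 []]] := kernel_step im ji kj kjn hx xi xk.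
set x' := (x - _ - _) => hu0 sy0 y0mid x'i x'k.
have hx' : homog j x'.
  apply: homogB; first apply: homogB => //.
    by apply: homog_dX.
  have := homog_eX (j - k) (specht_homog sy0); by rewrite subnKC.
have [|u [y [hu sy ymid ex]]] := IH k.+1 _ x' hx' x'i x'k; first by dim_lia.
exists (u + u0), (fun t => y t + (if t == k then y0 else 0)); split.
- exact: homogD.
- by move=> t; apply: addmx_sub => //; case: eqP => [->|_]; rewrite ?sub0mx.
- by move=> t tm; rewrite ymid // add0r; case: eqP tm => [-> /y0mid|].
have kn : (k < n.+1)%N by dim_lia.
rewrite mulmxDl; under eq_bigr do rewrite mulmxDl.
rewrite big_split /= [X in _ + (_ + X)](bigD1 (Ordinal kn)) //= eqxx.
rewrite [X in _ + (_ + (_ + X))]big1 => [|t nt]; last first.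
  by rewrite (_ : (t == k :> nat) = false) ?mul0mx //; apply: contraNF nt => /eqP e; apply/eqP/val_inj.
by rewrite addr0 addrACA -ex /x' [_ + y0 *m _]addrC addrA subrK subrK.
Qed.

Lemma middle_orth j i t : (j <= n)%N -> (0 < i < m)%N -> middle (n - j) (m - i) t = middle j i t.
Proof.
move=> jn /andP[i0 im]; rewrite /middle subKn ?(ltnW im) //.
by apply/and4P/and4P => -[h1 h2 h3 h4]; split; dim_lia.
Qed.

(** The shadows of y J below t are values of the maps [up] on y that vanish by [specht_up0], so y J
    d^(a+b) is in S_t. Applying e^b and moving J across gives y e^(a+b) d^b, a nonzero multiple of y
    e^a. *)
Lemma specht_orth t y a b : (y <= specht t)%MS -> (a + b = n - t.*2)%N -> (n < t.*2 + m)%N ->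
  (t.*2 <= n)%N -> exists2 y', (y' <= specht t)%MS & y *m J *m d ^+ a = y' *m d^T ^+ b.
Proof.
move=> sy ab nm tn; have hy := specht_homog sy; have yd := specht_d sy.
have t_n : (t <= n)%N by dim_lia.
have hz := homog_orth t_n hy.
have z0 r : (r < t)%N -> y *m J *m shadow r = 0.
  move=> rt; apply: coefP => V; rewrite (coef_shadow _ _ hz) coef0.
  have [dV|_] := eqVneq (\dim V) r; last by rewrite mul0r.
  have nt : (n < t + (n - r))%N by dim_lia.
  have := congr1 (fun v => coef v (orth V)) (specht_up0 Q0 sy nt).
  rewrite (coef_up _ _ hy) dim_orth dV eqxx mul1r coef0 => e; rewrite mul1r -[RHS]e.
  rewrite [LHS]big_mkcond [RHS]big_mkcond /= -[LHS]sum_orth; apply: eq_bigr => U _.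
  by rewrite coef_orth orthK -{1}(orthK V) orth_sub.
have hz' : homog (t + (a + b)) (y *m J).
  by rewrite ab (_ : t + (n - t.*2) = n - t)%N //; dim_lia.
have sz : (y *m J *m d ^+ (a + b) <= specht t)%MS.
  rewrite (dX_shadow hz') scalemx_sub //; apply: (specht_of_shadow hz) => //; dim_lia.
pose P := \prod_(s < b) lcoef K n F t (a + s).
have P0 : P != 0.
  by apply/prodf_neq0 => -[s sb] _ /=; apply: lcoef_neq0; dim_lia.
exists (P^-1 *: (y *m J *m d ^+ (a + b))); first exact: scalemx_sub.
rewrite -scalemxAl [in RHS]orth_dX orth_eX (@eX_dX K n F t) //; last by dim_lia.
by rewrite -/P -scalemxAl scalerA mulVf // scale1r orth_dX.
Qed.

(** This is [kernel_decomp] for x J at level n - j with m - i in place of i, carried back by J;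
    [specht_orth] restores the form of the Specht terms. *)
Lemma kernel_e_decomp j i x : (0 < i < m)%N -> (j <= n)%N -> (n < j.*2 + (m - i))%N ->
    homog j x -> x *m d^T ^+ (m - i) = 0 ->
  exists u (y : nat -> 'rV[F]_N), [/\ forall t, (y t <= specht t)%MS, forall t, ~~ middle j i t -> y t = 0
    & x = u *m d^T ^+ i + \sum_(t < n.+1) y t *m d^T ^+ (j - t)].
Proof.
move=> im jn ji hx xi; have /andP[i0 i_m] := im.
have hxJ := homog_orth jn hx.
have xJi : x *m J *m d ^+ (m - i) = 0 by rewrite orth_dX xi mul0mx.
have im' : (0 < m - i < m)%N by apply/andP; split; dim_lia.
have jn' : (n - j <= n)%N by dim_lia.
have ji' : ((n - j).*2 < n + (m - i))%N by dim_lia.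
have [u [y [hu sy ymid ex]]] := kernel_decomp im' jn' ji' hxJ xJi.
have /fin_all_exists[y' y'P] : forall t : 'I_n.+1, exists z : 'rV[F]_N, [/\ (z <= specht t)%MS,
    ~~ middle j i t -> z = 0 & y t *m d^T ^+ (n - j - t) *m J = z *m d^T ^+ (j - t)].
  move=> t.
  have [mid|mid] := boolP (middle j i t); last first.
    by exists 0; rewrite sub0mx ymid ?middle_orth // !mul0mx.
  have /and4P[h1 h2 h3 h4] := mid.
  have e : (n - j - t + (j - t) = n - t.*2)%N by dim_lia.
  have tm : (n < t.*2 + m)%N by dim_lia.
  have tn : (t.*2 <= n)%N by dim_lia.
  have [z sz ez] := specht_orth (sy t) e tm tn.
  by exists z; split=> //; rewrite -orth_dX.
exists (u *m J), (fun t => if insub t is Some t' then y' t' else 0); split.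
- by move=> t; case: insubP => [t' _ <-|_]; rewrite ?sub0mx //; case: (y'P t').
- by move=> t; case: insubP => [t' _ <-|_] //; case: (y'P t').
rewrite -[LHS]orth_mxK ex mulmxDl subKn ?(ltnW i_m) // mulmx_suml orth_eX; congr (_ + _).
by apply: eq_bigr => t _; rewrite valK; case: (y'P t).
Qed.

Definition image j i := im_incidence F K n (j + (m - i)) (m - i).

Lemma image_of j i u : homog (j + (m - i)) u -> (u *m d ^+ (m - i) <= image j i)%MS.
Proof. by move=> hu; rewrite -hu -mulmxA submxMl. Qed.

Lemma image_ex j i v : (v <= image j i)%MS ->
  exists2 u, homog (j + (m - i)) u & v = u *m d ^+ (m - i).
Proof.
move=> /submxP[D ->]; exists (D *m Mk (j + (m - i))); first exact: homog_Mk.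
by rewrite mulmxA.
Qed.

(** A linear form that vanishes on the image of d^(m-i) restricts on M_j to pairing with an element
    killed by e^(m-i). *)
Lemma image_perp j i v : homog j v ->
  (forall w, homog j w -> w *m d^T ^+ (m - i) = 0 -> dot v w = 0) -> (v <= image j i)%MS.
Proof.
move=> hv h; rewrite submxE; apply/eqP/rowP => b; rewrite [RHS]mxE.
pose c := row b (cokermx (image j i))^T.
have hc : homog j (c *m Mk j) by apply: homog_Mk.
transitivity (dot v (c *m Mk j)).
  rewrite -tr_Mk -dot_adj hv dotE mxE -sum_ord_sp; apply: eq_bigr => a _.
  by rewrite /coef !mxE enum_valK.
apply: h => //.
have he := homog_eX (m - i) hc; rewrite -he.
have := mulmx_coker (image j i); move/(congr1 (fun A => row b A^T)).
rewrite trmx_mul row_mul -/c trmx0 row0 /image /im_incidence trmx_mul tr_Mk trX mulmxA => e.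
suff -> : c *m Mk j *m d^T ^+ (m - i) *m Mk (j + (m - i)) =
  c *m d^T ^+ (m - i) *m Mk (j + (m - i)) by [].
apply: coefP => V; rewrite !coef_Mk; have [dV|] := eqVneq (\dim V) (j + (m - i))%N; last by rewrite !mulr0.
rewrite !mulr1; elim: (m - i)%N V dV {he e} => [|a IH] V dV.
  by rewrite !mulX0 coef_Mk dV addn0 eqxx mulr1.
rewrite !mulX tr_rel !coef_rel; apply: eq_bigr => U _.
have [/andP[_ /eqP dU]|] := boolP (_ && _); last by rewrite !mulr0.
by rewrite -tr_rel IH // ; move: dU; rewrite dV; dim_lia.
Qed.

(** For t <= s, move e^(j-t) across as d^(j-t): its first j - s factors bring y e^(j-s) back to a
    multiple of y, and one more kills it. *)
Lemma dot_specht j s t y w : (y <= specht s)%MS -> (w <= specht t)%MS ->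
    (s <= j)%N -> (t <= j)%N -> (s + j <= n)%N -> (t + j <= n)%N ->
  dot (y *m d^T ^+ (j - s)) (w *m d^T ^+ (j - t)) =
  if s == t then (\prod_(a < j - s) lcoef K n F s a) * dot y w else 0.
Proof.
wlog st : s t y w / (s >= t)%N.
  move=> W sy sw sj tj sn tn; have [ts|st] := leqP t s; first exact: W.
  rewrite dotC W ?(ltnW st) // eq_sym; case: eqP => // ->; by rewrite dotC.
move=> sy sw sj tj sn tn.
have eyd : y *m d^T ^+ (j - s) *m d ^+ (j - s) = (\prod_(a < j - s) lcoef K n F s a) *: y.
  have := @eX_dX K n F s 0 (j - s) y; rewrite add0n mulX0 addn0 => -> //; [dim_lia| |].
    exact: specht_homog sy.
  exact: specht_d sy.
rewrite -[X in dot _ (_ *m X)]trX -dot_adj.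
have -> : (j - t = (j - s) + (s - t))%N by dim_lia.
rewrite mulXD eyd; have [<-|ne] := eqVneq s t; first by rewrite subnn mulX0 dotZl.
have -> : (s - t = (s - t).-1.+1)%N by move/eqP: ne; dim_lia.
by rewrite exprS -mulmxE mulmxA -scalemxAl (specht_d sy) scaler0 mul0mx dot0l.
Qed.

Lemma prod_lcoef_neq0 j i t : (0 < i < m)%N -> middle j i t ->
  \prod_(a < j - t) lcoef K n F t a != 0.
Proof.
move=> im /and4P[h1 h2 h3 h4]; apply/prodf_neq0 => -[a aj] _ /=.
by apply: lcoef_neq0; dim_lia.
Qed.

(** Moved across, d^(m-i) raises the exponent of e to j - t + m - i, which exceeds n - 2t. *)
Lemma dot_image j i t u w : middle j i t -> (w <= specht t)%MS -> (u <= image j i)%MS ->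
  dot u (w *m d^T ^+ (j - t)) = 0.
Proof.
move=> /and4P[h1 h2 h3 h4] sw /image_ex[u' _ ->].
rewrite dot_adj trX -mulXD (specht_eX0 Q0 sw) ?dot0r //; dim_lia.
Qed.

(** Pairing the sum with w e^(j-t) isolates y t up to a nonzero constant. *)
Lemma image_sum_perp j i (y : nat -> 'rV[F]_N) (ts : seq nat) : (0 < i < m)%N -> uniq ts ->
    (forall t, t \in ts -> middle j i t && (y t <= specht t)%MS) ->
    ((\sum_(t <- ts) y t *m d^T ^+ (j - t))%R <= image j i)%MS ->
  forall t w, t \in ts -> (w <= specht t)%MS -> dot (y t) w = 0.
Proof.
move=> im uts h himg t w tts sw; have /andP[mid st] := h t tts.
have := dot_image mid sw himg; rewrite dot_suml (bigD1_seq t) //= big1_seq => [|s /andP[ne sts]].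
  have /and4P[_ _ h3 h4] := mid; rewrite addr0 dot_specht // eqxx => /eqP.
  by rewrite mulf_eq0 (negPf (prod_lcoef_neq0 im mid)) => /eqP.
have /andP[/and4P[_ _ s3 s4] ss] := h s sts; have /and4P[_ _ h3 h4] := mid.
by rewrite dot_specht // (negPf ne).
Qed.

(** By [image_perp] it suffices to pair with the terms of [kernel_e_decomp]. The part u e^i gives
    zero because j - t < i, the Specht parts because y is in the radical. *)
Lemma image_perp_specht j i t y : (0 < i < m)%N -> (j <= n)%N -> (n < j.*2 + (m - i))%N ->
    middle j i t -> (y <= specht t)%MS -> (forall w, (w <= specht t)%MS -> dot y w = 0) ->
  (y *m d^T ^+ (j - t) <= image j i)%MS.
Proof.
move=> im jn ji mid sy yperp; have /and4P[h1 h2 h3 h4] := mid.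
apply: image_perp => [|w hw we].
  by have := homog_eX (j - t) (specht_homog sy); rewrite subnKC.
have [u [y' [sy' y'mid ->]]] := kernel_e_decomp im jn ji hw we.
have yd : y *m d^T ^+ (j - t) *m d ^+ i = 0.
  have -> : i = (j - t + (i - (j - t)).-1.+1)%N by dim_lia.
  have := @eX_dX K n F t 0 (j - t) y; rewrite add0n mulX0 addn0 mulXD => -> //.
  - by rewrite exprS -mulmxE mulmxA -scalemxAl (specht_d sy) scaler0 mul0mx.
  - by dim_lia.
  - exact: specht_homog sy.
  exact: specht_d sy.
rewrite dotDr dotC dot_adj trX trmxK yd dot0r add0r dotC dot_suml big1 // => s _.
have [ms|ms] := boolP (middle j i s); last by rewrite y'mid // mul0mx dot0l.
have /and4P[_ _ s3 s4] := ms.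
rewrite dotC dot_specht //; case: eqP => [e|//].
by rewrite yperp ?mulr0 // e.
Qed.

Lemma image_low j i x : (0 < i < m)%N -> (j <= n)%N -> (j.*2 + (m - i) <= n)%N ->
  homog j x -> x *m d ^+ i = 0 -> (x <= image j i)%MS.
Proof.
move=> im jn ji hx xi; have /andP[i0 i_m] := im.
have ji' : (j.*2 < n + i)%N by dim_lia.
have [u [y [hu _ ymid ->]]] := kernel_decomp im jn ji' hx xi.
rewrite big1 ?addr0 => [|t _]; first exact: image_of.
rewrite ymid ?mul0mx //; apply/negP => /and4P[h1 h2 h3 h4]; dim_lia.
Qed.

(** No t satisfies [middle] here, so the kernel of e^(m-i) lies in the image of e^i, which is
    orthogonal to the kernel of d^i. *)
Lemma image_high j i x : (0 < i < m)%N -> (j <= n)%N -> (n + i <= j.*2)%N ->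
  homog j x -> x *m d ^+ i = 0 -> (x <= image j i)%MS.
Proof.
move=> im jn ji hx xi; apply: image_perp => // w hw we.
have /andP[i0 i_m] := im.
have ji' : (n < j.*2 + (m - i))%N by dim_lia.
have [u [y [_ ymid ->]]] := kernel_e_decomp im jn ji' hw we.
rewrite big1 ?addr0 => [|t _]; last first.
  rewrite ymid ?mul0mx //; apply/negP => /and4P[h1 h2 h3 h4]; dim_lia.
by rewrite dotC dot_adj trX trmxK xi dot0r.
Qed.

(** For f and g in S_t with nonzero pairing, f e^(j-t) is not orthogonal to g e^(j-t), whereas
    boundaries are. *)
Lemma image_proper j i t : (0 < i < m)%N -> middle j i t ->
  exists2 x, homog j x /\ x *m d ^+ i = 0 & ~~ (x <= image j i)%MS.
Proof.
move=> im mid; have /and4P[h1 h2 h3 h4] := mid.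
have [|f [g [fK gK fg]]] := @kernel_el_nonisotropic K n F Q0 (0%VS : sp) t.
  by rewrite dimv0 add0n; dim_lia.
have sf := specht_kernel_el fK; have sg := specht_kernel_el gK.
have fE : vec f *m d^T ^+ (j - t) *m d ^+ (j - t) = (\prod_(a < j - t) lcoef K n F t a) *: vec f.
  have := @eX_dX K n F t 0 (j - t) (vec f); rewrite add0n mulX0 addn0 => -> //.
  - by dim_lia.
  - exact: specht_homog sf.
  exact: specht_d sf.
exists (vec f *m d^T ^+ (j - t)); first split.
- by have := homog_eX (j - t) (specht_homog sf); rewrite subnKC.
- have -> : i = (j - t + (i - (j - t)).-1.+1)%N by dim_lia.
  by rewrite mulXD fE exprS -mulmxE mulmxA -scalemxAl (specht_d sf) scaler0 mul0mx.
apply: contra fg => himg; have := dot_image mid sg himg.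
rewrite dot_specht // eqxx => /eqP; rewrite mulf_eq0 (negPf (prod_lcoef_neq0 im mid)) /=.
by rewrite dotE (eq_bigr (fun z => f z * g z)) // => z _; rewrite !coef_vec.
Qed.

End Decomposition.
(** * Subquotient representations *)

Section Subquotients.
Variables (F : fieldType) (gT : finGroupType) (G : {group gT}) (n : nat).
Variable rG : mx_representation F G n.
Implicit Types (U V : 'M[F]_n) (r : representation F G).

(* The rows of L lift to V a basis of V / U on which G acts through r.         *)
Definition lifts_basis U V r (L : 'M[F]_(rdegree r, n)) :=
  [/\ (L <= V)%MS,
      forall g, g \in G -> (r g *m L - L *m rG g <= U)%MS,
      (V <= U + L)%MS
    & forall c : 'rV_(rdegree r), (c *m L <= U)%MS -> c = 0].

Lemma section_lifts U V (modU : mxmodule rG U) (modV : mxmodule rG V) : (U <= V)%MS ->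
  exists L, @lifts_basis U V (Representation (section_repr modU modV)) L.
Proof.
move=> UV; set r := Representation _; pose W := <<in_factmod U V>>%MS.
exists (val_factmod (val_submod (1%:M : 'M_(\rank W)))).
have vW : (val_submod (1%:M : 'M_(\rank W)) <= in_factmod U V)%MS.
  by rewrite (val_submod1 W) genmxE.
have valV A : (val_factmod (in_factmod U (A : 'M_n)) <= A + U)%MS.
  have := add_sub_fact_mod U A; move/(canRL (addKr _)) => ->.
  by rewrite addrC addmx_sub_adds // eqmx_opp val_submodP.
split.
- have h : (val_factmod (val_submod (1%:M : 'M_(\rank W))) <= val_factmod (in_factmod U V))%MS.
    by rewrite val_factmodS.
  apply: submx_trans h _; apply: submx_trans (valV V) _; by rewrite addsmx_sub submx_refl.
- move=> g Gg; rewrite -in_factmod_eq0 linearB /= [in_factmod U (_ *m val_factmod _)]in_factmodE.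
  rewrite -mulmxA -in_factmodE in_factmodJ // !val_factmodK.
  have := val_submodJ (section_module modU modV) 1%:M Gg; rewrite mul1mx => <-.
  by rewrite [X in _ - X]val_submodE subrr.
- have h : (val_factmod (in_factmod U V) <= val_factmod (val_submod (1%:M : 'M_(\rank W))))%MS.
    by rewrite val_factmodS (val_submod1 W) genmxE.
  by rewrite -[V in (V <= _)%MS](add_sub_fact_mod U V) addmx_sub_adds ?val_submodP //.
move=> c; rewrite -in_factmod_eq0 in_factmodE -mulmxA -in_factmodE val_factmodK.
by rewrite -val_submodE val_submod_eq0 => /eqP.
Qed.

Lemma lifts_section U V (modU : mxmodule rG U) (modV : mxmodule rG V) r L :
  @lifts_basis U V r L -> mx_rsim r (section_repr modU modV).
Proof.
case=> LV Lg VL Lfree; pose W := <<in_factmod U V>>%MS.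
have sLW : (in_factmod U L <= W)%MS.
  rewrite genmxE in_factmodE [X in (_ <= X)%MS]in_factmodE; exact: submxMr.
have freeL : row_free (in_factmod U L).
  rewrite -kermx_eq0; apply/eqP/row_matrixP => a; rewrite row0; apply: Lfree.
  by rewrite -in_factmod_eq0 in_factmodE -mulmxA -in_factmodE -row_mul mulmx_ker row0.
have eqW : (in_factmod U L :=: W)%MS.
  apply/eqmxP; rewrite sLW genmxE /=.
  have /submxP[D ->] : (V <= col_mx U L)%MS by rewrite -addsmxE.
  rewrite -[D]hsubmxK mul_row_col linearD /=.
  have /eqP -> : in_factmod U (lsubmx D *m U) == 0 by rewrite in_factmod_eq0 submxMl.
  by rewrite add0r in_factmodE -mulmxA -in_factmodE submxMl.
have eV : val_submod (in_submod W (in_factmod U L)) = in_factmod U L by apply: in_submodK.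
exists (in_submod W (in_factmod U L)).
- by rewrite -[RHS]eqW; apply/esym/eqP.
- rewrite -kermx_eq0; apply/eqP/row_matrixP => a; rewrite row0.
  set B := in_submod _ _; have kB : row a (kermx B) *m B = 0 by rewrite -row_mul mulmx_ker row0.
  by apply: (row_free_inj freeL); rewrite mul0mx -eV val_submodE mulmxA -/B kB mul0mx.
move=> g Gg; have key : r g *m in_factmod U L = in_factmod U L *m factmod_repr modU g.
  rewrite -in_factmodJ //; apply/eqP.
  rewrite -subr_eq0 in_factmodE mulmxA -in_factmodE -linearB in_factmod_eq0.
  exact: Lg.
have := in_submodJ (section_module modU modV) g sLW; rewrite [LHS]in_submodE => e.
by rewrite [in LHS]in_submodE mulmxA key; apply: e.
Qed.

Lemma section_degree0 U V (modU : mxmodule rG U) (modV : mxmodule rG V) :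
  rdegree (Representation (section_repr modU modV)) = 0 <-> (V <= U)%MS.
Proof.
rewrite /= genmxE -in_factmod_eq0 -mxrank_eq0; split=> [->//|/eqP]; exact.
Qed.

(** Stacks lifted bases, each moved by an equivariant [T t]. Independence modulo I is reduced to all
    y t being in [U t], which in the application follows from orthogonality. *)
Lemma lifts_big (I : 'M[F]_n) (U V T : nat -> 'M[F]_n) (r : nat -> representation F G) (ts : seq nat) :
    uniq ts -> (forall t, centgmx rG (T t)) ->
    (forall t, t \in ts -> exists L, @lifts_basis (U t) (V t) (r t) L) ->
    (forall t, t \in ts -> (U t *m T t <= I)%MS) ->
  let R := \big[dadd_grepr/grepr0]_(t <- ts) r t in
  exists L : 'M_(rdegree R, n), [/\
    forall c : 'rV_(rdegree R), exists y : nat -> 'rV[F]_n,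
      [/\ forall t, t \in ts -> (y t <= V t)%MS, c *m L = \sum_(t <- ts) y t *m T t
        & (forall t, t \in ts -> (y t <= U t)%MS) -> c = 0],
    forall g, g \in G -> (R g *m L - L *m rG g <= I)%MS
    & forall t, t \in ts -> (V t *m T t <= I + L)%MS].
Proof.
move=> uts Tc; elim: ts uts => [|t0 ts IH] uts hL hI /=.
  rewrite big_nil /=; exists 0; split=> [c|g _|//].
    by exists (fun=> 0); rewrite big_nil mulmx0; split=> // _; apply/rowP => -[].
  by rewrite mulmx0 mul0mx subrr sub0mx.
have /andP[t0ts uts'] := uts.
have [||L [Lc Lg LV]] := IH uts'.
- by move=> t h; apply: hL; rewrite inE h orbT.
- by move=> t h; apply: hI; rewrite inE h orbT.
have [L0 [L0V L0g VL0 L0free]] := hL t0 (mem_head _ _).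
rewrite big_cons; move: (\big[_/_]_(t <- ts) r t) L Lc Lg LV => R L Lc Lg LV.
exists (col_mx (L0 *m T t0) L); split.
- move=> c; have [y [yV yE yU]] := Lc (rsubmx c).
  pose y' t := if t == t0 then lsubmx c *m L0 else y t.
  have y't t : t \in ts -> y' t = y t.
    by move=> h; rewrite /y'; case: eqP => // e; rewrite -e h in t0ts.
  exists y'; split.
  + move=> t; rewrite inE /y'; case: eqP => [-> _|_ /=]; last exact: yV.
    by apply: submx_trans L0V; apply: submxMl.
  + rewrite big_cons {1}/y' eqxx -mulmxA (eq_big_seq (fun t => y t *m T t)) => [|t /y't -> //].
    by rewrite -yE -mul_row_col hsubmxK.
  move=> hy; rewrite -[c]hsubmxK (L0free (lsubmx c)) ?yU ?row_mx0 //.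
    by move=> t h; rewrite -y't // hy // inE h orbT.
  by have := hy t0 (mem_head _ _); rewrite /y' eqxx.
- move=> g Gg; rewrite /= mul_block_col mul_col_mx !mul0mx addr0 add0r opp_col_mx add_col_mx.
  rewrite -addsmxE addsmx_sub Lg // andbT.
  have /centgmxP/(_ g Gg) c := Tc t0.
  rewrite -[L0 *m _ *m _]mulmxA c !mulmxA -mulmxBl.
  by apply: submx_trans (hI t0 (mem_head _ _)); apply/submxMr/L0g.
move=> t; rewrite inE => /orP[/eqP ->|/LV h].
  apply: submx_trans (submxMr (T t0) VL0) _; rewrite addsmxMr; apply: addsmxS.
    exact: hI (mem_head _ _).
  by rewrite -addsmxE addsmxSl.
by apply: submx_trans h _; apply: addsmxS => //; rewrite -addsmxE addsmxSr.
Qed.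

End Subquotients.

(** * Incidence homology as a sum of heads of Specht modules *)

Section Homology.
Variables (K : finFieldType) (n : nat) (F : fieldType) (m : nat).
Local Notation q := #|K|.
Local Notation Q := (q%:R : F).
Hypothesis Q0 : Q != 0.
Hypothesis qm : is_qchar F q m.
Local Notation N := (Ndim K n).
Implicit Types (u v w x y : 'rV[F]_N) (k j i t : nat).
Local Notation d := (incidence F K n).
Local Notation specht := (specht F K n).
Local Notation specht_perp := (specht_perp F K n).
Local Notation rho := (perm_repr F K n).

Lemma ker_incidenceP k i x : (x <= ker_incidence F K n k i)%MS <-> homog k x /\ x *m d ^+ i = 0.
Proof.
rewrite sub_capmx; split=> [/andP[/sub_kermxP ? /homogE ?] //|[hx xi]].
by apply/andP; split; [apply/sub_kermxP | apply/homogE].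
Qed.

Lemma specht_perpP t x : (x <= specht t)%MS ->
  (x <= specht_perp t)%MS <-> forall w, (w <= specht t)%MS -> dot x w = 0.
Proof.
move=> sx; have hx := specht_homog sx; rewrite sub_capmx; split=> [/andP[_ /sub_kermxP h] w /submxP[D ->]|h].
  by rewrite /dot trmx_mul mulmxA h mul0mx mxE.
apply/andP; split; first exact/homogE.
apply/sub_kermxP/rowP => a; rewrite [RHS]mxE -[RHS](h (row a (specht t))) ?row_sub //.
by rewrite /dot !mxE; apply: eq_bigr => b _; rewrite !mxE.
Qed.

(** With [rad_of], the two layers of D^(n-t,t) for 2t >= n, both zero when t > n. *)
Definition head_of t : 'M[F]_N := if (t <= n)%N then specht (n - t) else 0.
Definition rad_of t : 'M[F]_N :=
  if (t <= n)%N then (specht (n - t) :&: specht_perp (n - t))%MS else 0.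

Lemma Dmod_lifts t : (n <= t.*2)%N ->
  exists L, @lifts_basis _ _ _ _ rho (rad_of t) (head_of t) (Dmod F K n t) L.
Proof.
rewrite /rad_of /head_of /Dmod => nt; case: (leqP t n) => tn; last first.
  exists (0 : 'M_(0, N)); split=> [|g _||c _]; rewrite ?sub0mx //.
    by rewrite mulmx0 mul0mx subrr sub0mx.
  by apply/rowP => -[].
have -> : minn t (n - t) = (n - t)%N by apply/minn_idPr; dim_lia.
exact/section_lifts/capmxSl.
Qed.

(** [Tset] lists the larger part t, [middle] the smaller part n - t; the t above n stand for zero
    modules. *)
Lemma TsetP k i : (0 < i < m)%N -> (k <= n)%N -> middle_index n m k i ->
  [/\ uniq (Tset n m k i), forall t, t \in Tset n m k i -> (n <= t.*2)%N,
    forall t, t \in Tset n m k i -> (t <= n)%N -> middle n m k i (n - t)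
    & forall t, middle n m k i t -> (n - t)%N \in Tset n m k i].
Proof.
move=> im kn /and4P[_ i0 i_m /andP[h1 h2]]; rewrite /Tset /middle.
case: leqP => c1; case: leqP => c2; (split=> [|t|t|t]; rewrite ?iota_uniq // mem_index_iota;
  [move=> /andP[h3 h4] | move=> /andP[h3 h4] tn; apply/and4P; split
  | move=> /and4P[h3 h4 h5 h6]; apply/andP; split]); dim_lia.
Qed.

Lemma homology_main k i : (k <= n)%N -> (0 < i < m)%N ->
  (rdegree (incidence_homology F K n m k i) <> 0 <-> middle_index n m k i)
  /\ (middle_index n m k i ->
      mx_rsim (incidence_homology F K n m k i)
        (\big[@dadd_grepr F (GLelt K n) (GLq K n)/grepr0]_(t <- Tset n m k i)
           Dmod F K n t)).
Proof.
move=> kn im; have /andP[i0 i_m] := im.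
rewrite -/(image K n F m k i); split.
  have deg := section_degree0 (im_incidence_module F K n (k + (m - i)) (m - i)) (ker_incidence_module F K n k i).
  split=> [nz|mid].
    apply/negPn/negP => nmid; apply: nz; apply/deg; apply/row_subP => a.
    have /ker_incidenceP[hx xi] := row_sub a (ker_incidence F K n k i).
    have [low|high] := leqP (k.*2 + (m - i)) n.
      exact: image_low.
    apply: image_high => //; move: nmid; rewrite /middle_index kn i0 i_m high /= -leqNgt; dim_lia.
  move=> /deg h; case/and4P: mid => _ _ _ /andP[h1 h2].
  (* The largest t with t <= k and t + k <= n; the middle index inequalities give the other two
     conditions. *)
  have mid : middle n m k i (minn k (n - k)).
    by rewrite /middle; apply/and4P; split; dim_lia.
  have [x xk /negP[]] := image_proper Q0 qm im mid.
  by apply: submx_trans h; apply/ker_incidenceP.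
move=> mid; have [uT Tn Tmid midT] := TsetP im kn mid.
case/and4P: mid => _ _ _ /andP[h1 h2].
pose T t := d^T ^+ (k - (n - t)).
have Tc t : centgmx rho (T t).
  apply: exp_centg; rewrite tr_rel; apply: rel_mx_centg => g U V.
  by rewrite sp_act_sub !sp_act_dim.
have radI t : t \in Tset n m k i -> (rad_of t *m T t <= image K n F m k i)%MS.
  move=> tT; rewrite /rad_of; case: leqP => tn; last by rewrite mul0mx sub0mx.
  apply/row_subP => a; rewrite row_mul; have := row_sub a (specht (n - t) :&: specht_perp (n - t))%MS.
  rewrite sub_capmx => /andP[sx sp]; apply: image_perp_specht => //; first exact: Tmid.
  exact/specht_perpP.
have [L [Lc Lg LV]] := lifts_big uT Tc (fun t tT => Dmod_lifts (Tn t tT)) radI.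
apply: mx_rsim_sym; apply: (@lifts_section _ _ _ _ _ _ _ _ _ _ L); split=> //.
- apply/row_subP => a; rewrite rowE; have [y [yV -> _]] := Lc (delta_mx 0 a).
  rewrite big_seq; apply: summx_sub => t tT; have := yV t tT; rewrite /head_of.
  case: leqP => tn; last by move/submx0null => ->; rewrite mul0mx sub0mx.
  move=> sy; have /and4P[m1 m2 m3 m4] := Tmid t tT tn.
  apply/ker_incidenceP; split.
    by have := homog_eX (k - (n - t)) (specht_homog sy); rewrite subnKC.
  have e : i = (k - (n - t) + (i - (k - (n - t))).-1.+1)%N by dim_lia.
  rewrite /T e mulXD; have := @eX_dX K n F (n - t) 0 (k - (n - t)) (y t); rewrite add0n mulX0 addn0 => -> //.
  + by rewrite exprS -mulmxE mulmxA -scalemxAl (specht_d sy) scaler0 mul0mx.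
  + by dim_lia.
  + exact: specht_homog sy.
  exact: specht_d sy.
- apply/row_subP => a; have /ker_incidenceP[hx xi] := row_sub a (ker_incidence F K n k i).
  have ki : (k.*2 < n + i)%N by dim_lia.
  have [u [y [hu sy ymid ->]]] := kernel_decomp Q0 qm im kn ki hx xi.
  apply: addmx_sub; first by apply: submx_trans (addsmxSl _ _); apply: image_of.
  apply: summx_sub => t _; have [tm|tm] := boolP (middle n m k i t); last first.
    by rewrite ymid // mul0mx sub0mx.
  have tn : (t <= n)%N by rewrite -ltnS.
  have := LV _ (midT t tm); rewrite /head_of leq_subr subKn // /T subKn //.
  by apply: submx_trans; apply: submxMr.
move=> c; have [y [yV -> yU]] := Lc c => himg; apply: yU => t tT.
rewrite /rad_of; have := yV t tT; rewrite /head_of; case: (leqP t n) => // tn sy.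
rewrite sub_capmx sy; apply/specht_perpP => // w sw.
(* For independence, pass to the Specht indices n - s, dropping the s above n, for which y s is
   zero. *)
pose ts := [seq (n - s)%N | s <- Tset n m k i & (s <= n)%N].
have uts : uniq ts.
  rewrite map_inj_in_uniq ?filter_uniq // => a b.
  by rewrite !mem_filter => /andP[an _] /andP[bn _]; dim_lia.
have y0 s : s \in Tset n m k i -> (n < s)%N -> y s = 0.
  by move=> sT ns; have := yV s sT; rewrite /head_of leqNgt ns => /submx0null.
have := image_sum_perp Q0 qm (j := k) (y := fun t => y (n - t)%N) im uts _ _ _ sw.
rewrite /= subKn //; apply.
- move=> s /mapP[s' ]; rewrite mem_filter => /andP[sn sT] ->; rewrite subKn // Tmid //=.
  by have := yV s' sT; rewrite /head_of sn.
- rewrite big_map big_filter; move: himg; rewrite [X in (X <= _)%MS -> _]big_seq.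
  rewrite (bigID (fun s => s <= n)%N) /= [X in _ + X]big1 ?addr0 => [|s /andP[sT ns]]; last first.
    by rewrite y0 ?mul0mx // ltnNge.
  rewrite -big_seq_cond [X in (X <= _)%MS -> _](eq_bigr (fun s => y (n - (n - s))%N *m d^T ^+ (k - (n - s)))) //.
  by move=> s sn; rewrite subKn.
by apply/mapP; exists t; rewrite // mem_filter tn.
Qed.

End Homology.

Local Close Scope ring_scope.

Theorem theorem3 (q : nat) (K : finFieldType) (hq : #|K| = q)
    (F : fieldType) (p : nat) (hp : p \in [pchar F]%R) (hpq : ~~ (p %| q))
    (m : nat) (hm : is_qchar F q m)
    (n k i : nat) (hk : k <= n) (hi : 0 < i < m) :
  (rdegree (incidence_homology F K n m k i) <> 0 <-> middle_index n m k i)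
  /\ (middle_index n m k i ->
      mx_rsim (incidence_homology F K n m k i)
        (\big[@dadd_grepr F (GLelt K n) (GLq K n)/grepr0]_(t <- Tset n m k i)
           Dmod F K n t)).
Proof.
rewrite -hq in hpq hm; apply: homology_main => //.
by rewrite -(dvdn_pcharf hp).
Qed.
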